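(* Let $U\subseteq\mathbf{R}^d$ be open, $\tau>0$, $\sigma>1$, and let $P(x,D)=\sum_{|\alpha|\le m}a_\alpha(x)D^\alpha$ be a differential operator of order $m$ on $U$ with $a_\alpha\in\mathcal{E}_{\{\tau,\sigma\}}(U)$ for $|\alpha|\le m$. Let $u\in\mathcal{D}'(U)$. Then $$\mathrm{WF}_{\{\tau,\sigma\}}(P(x,D)u)\subseteq\mathrm{WF}_{\{\tau,\sigma\}}(u).$$
   Context: $\mathbf{N}$ denotes the nonnegative integers, $\mathcal{D}'(U)$ the Schwartz distributions on $U$, $\mathcal{E}'(U)$ the compactly supported ones (with the strong topology), $\lfloor\cdot\rfloor$ the floor function, $\widehat f(\xi)=\int f(x)e^{-2\pi i x\xi}\,dx$; $D^\alpha$ is the partial derivative $\partial^\alpha$ up to a nonzero normalizing constant factor depending only on $|\alpha|$. A conic neighborhood of $\xi_0\ne0$ is an open cone containing $\xi_0$. $\mathcal{E}_{\{\tau,\sigma\}}(U)$ is the set of $\phi\in C^\infty(U)$ such that for every compact $K\subset U$ there are $h>0$, $A>0$ with $|\partial^\alpha\phi(x)|\le A h^{|\alpha|^\sigma}|\alpha|^{\tau|\alpha|^\sigma}$ for all $\alpha\in\mathbf{N}^d$, $x\in K$ (with $|\alpha|^{\tau|\alpha|^\sigma}=1$ for $\alpha=0$). For $u\in\mathcal{D}'(U)$ and $(x_0,\xi_0)\in U\times(\mathbf{R}^d\setminus\{0\})$: $(x_0,\xi_0)\notin\mathrm{WF}_{\{\tau,\sigma\}}(u)$ if and only if there exist an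 open neighborhood $\Omega\subset U$ of $x_0$, a conic neighborhood $\Gamma$ of $\xi_0$, a bounded sequence $\{u_N\}_{N\in\mathbf{N}}$ in $\mathcal{E}'(U)$ with $u_N=u$ on $\Omega$ for all $N$, and constants $A,h>0$ such that $$|\widehat u_N(\xi)|\le A\,\frac{h^N N!^{\tau/\sigma}}{|\xi|^{\lfloor N^{1/\sigma}\rfloor}},\qquad N\in\mathbf{N},\ \xi\in\Gamma\setminus\{0\}.$$ *)

(* Defs.v *)
From HB Require Import structures.
From mathcomp Require Import all_boot all_order all_algebra.
From mathcomp Require Import all_classical all_reals all_analysis.
From mathcomp Require Import complex.

Set Implicit Arguments.
Unset Strict Implicit.
Unset Printing Implicit Defensive.

Import Order.TTheory GRing.Theory Num.Theory.
Import numFieldNormedType.Exports.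

Local Open Scope classical_set_scope.
Local Open Scope ring_scope.
Local Open Scope complex_scope.

(* R^d is 'rV[R]_d, whose library topology comes from the sup norm and is
   therefore the usual one; `enorm` is the Euclidean norm. Complex-valued
   functions on an open set U are represented by total functions on R^d whose
   values off U are irrelevant; every notion below only looks at them on U.
   The test functions on U are extended by 0, hence are smooth on all of R^d. *)

Section Euclidean.
Variables (R : realType) (d : nat).
Implicit Types x xi : 'rV[R]_d.

Definition dotv x xi : R := \sum_(i < d) x 0 i * xi 0 i.

Definition enorm xi : R := Num.sqrt (dotv xi xi).

Definition conic_nbhs xi (Gamma : set 'rV[R]_d) : Prop :=
  [/\ open Gamma, Gamma xi &
      forall (t : R) eta, 0 < t -> Gamma eta -> Gamma (t *: eta)].

End Euclidean.

Section Smooth.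
Variables (R : realType) (d : nat).
Implicit Types (f g : 'rV[R]_d -> R[i]) (U K : set 'rV[R]_d).

Definition unitv (i : 'I_d) : 'rV[R]_d := delta_mx 0 i.

(* R[i] carries no normed-module structure over R in the library, so
   derivatives are taken on the real and imaginary parts. *)
Definition partial (i : 'I_d) f : 'rV[R]_d -> R[i] :=
  fun x => 'D_(unitv i) (fun y => complex.Re (f y)) x
           +i* 'D_(unitv i) (fun y => complex.Im (f y)) x.

Definition smooth U f : Prop :=
  forall (s : seq 'I_d) x, U x ->
    let g := foldr partial f s in
    [/\ {for x, continuous (fun y => complex.Re (g y))},
        {for x, continuous (fun y => complex.Im (g y))} &
        forall i, derivable (fun y => complex.Re (g y)) x (unitv i) /\
                  derivable (fun y => complex.Im (g y)) x (unitv i)].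

Definition multi_index := {ffun 'I_d -> nat}.

Definition mdeg (alpha : multi_index) : nat := (\sum_(i < d) alpha i)%N.

Definition mpartial (alpha : multi_index) f : 'rV[R]_d -> R[i] :=
  foldr (fun i g => iter (alpha i) (partial i) g) f (enum 'I_d).

(* The multi-indices of degree at most m have entries at most m, which turns
   them into a finite type. *)
Definition to_multi m (b : {ffun 'I_d -> 'I_m.+1}) : multi_index :=
  [ffun i => nat_of_ord (b i)].

(* Sum of F alpha over |alpha| <= m *)
Definition sum_multi (V : nmodType) (m : nat) (F : multi_index -> V) : V :=
  \sum_(b : {ffun 'I_d -> 'I_m.+1} | (mdeg (to_multi b) <= m)%N) F (to_multi b).

Definition seminorm K (k : nat) f : R :=
  sum_multi k (fun alpha => sup [set Normc.normc (mpartial alpha f x) | x in K]).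

(* For alpha = 0 both powR factors are 1, since sigma <> 0 makes
   0 `^ sigma = 0, and a `^ 0 = 1 even for a = 0. *)
Definition ets_class (tau sigma : R) U f : Prop :=
  smooth U f /\
  forall K, compact K -> K `<=` U ->
    exists h A : R, [/\ 0 < h, 0 < A &
      forall (alpha : multi_index) x, K x ->
        let n : R := (mdeg alpha)%:R in
        Normc.normc (mpartial alpha f x)
          <= A * h `^ (n `^ sigma) * n `^ (tau * n `^ sigma)].

End Smooth.

Section Distributions.
Variables (R : realType) (d : nat).
Implicit Types (f g : 'rV[R]_d -> R[i]) (U K : set 'rV[R]_d).

Definition functional := ('rV[R]_d -> R[i]) -> R[i].
Implicit Types u v : functional.

Definition supported_in K f : Prop := forall x, ~ K x -> f x = 0.

Definition test_fun U f : Prop :=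
  smooth setT f /\ exists K, [/\ compact K, K `<=` U & supported_in K f].

Definition linear_on (D : ('rV[R]_d -> R[i]) -> Prop) u : Prop :=
  forall (a : R[i]) f g, D f -> D g ->
    u (fun x => a * f x + g x) = a * u f + u g.

(* u \in D'(U) *)
Definition is_distribution U u : Prop :=
  linear_on (test_fun U) u /\
  forall K, compact K -> K `<=` U ->
    exists (C : R) (k : nat), forall f, smooth setT f -> supported_in K f ->
      Normc.normc (u f) <= C * seminorm K k f.

(* v \in E'(U): the compactly supported distributions on U, acting by their
   canonical extension to C^oo(U); that is, the continuous linear forms on the
   Frechet space C^oo(U). The estimate also forces v f to depend only on the
   restriction of f to U. *)
Definition compact_distribution U v : Prop :=
  linear_on (smooth U) v /\
  exists K (C : R) (k : nat), [/\ compact K, K `<=` U &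
    forall f, smooth U f -> Normc.normc (v f) <= C * seminorm K k f].

Definition bounded_smooth U (B : set ('rV[R]_d -> R[i])) : Prop :=
  B `<=` smooth U /\
  forall K (k : nat), compact K -> K `<=` U ->
    exists M : R, forall f, B f -> seminorm K k f <= M.

(* The strong topology of E'(U) is defined by the seminorms
   v |-> sup_(f in B) |v f| with B bounded in C^oo(U). *)
Definition bounded_seq U (v : nat -> functional) : Prop :=
  (forall N, compact_distribution U (v N)) /\
  forall B, bounded_smooth U B ->
    exists M : R, forall N f, B f -> Normc.normc (v N f) <= M.

Definition eq_on (Omega : set 'rV[R]_d) u v : Prop :=
  forall f, test_fun Omega f -> u f = v f.

(* x |-> e^(-2 pi i x.xi) *)
Definition character (xi : 'rV[R]_d) : 'rV[R]_d -> R[i] :=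
  fun x => cos (2 * pi * dotv x xi) -i* sin (2 * pi * dotv x xi).

Definition fourier v (xi : 'rV[R]_d) : R[i] := v (character xi).

Definition dmul (a : 'rV[R]_d -> R[i]) u : functional :=
  fun f => u (fun x => a x * f x).

Definition dpartial (alpha : multi_index d) u : functional :=
  fun f => (-1) ^+ mdeg alpha * u (mpartial alpha f).

(* P(x, D) u with D^alpha = c |alpha| * d^alpha, where c is the normalizing
   constant of D. *)
Definition diffop (c : nat -> R[i]) (m : nat)
    (a : multi_index d -> 'rV[R]_d -> R[i]) u : functional :=
  fun f => sum_multi m (fun alpha =>
    dmul (a alpha) (fun g => c (mdeg alpha) * dpartial alpha u g) f).

Definition ets_regular (tau sigma : R) U u (x0 xi0 : 'rV[R]_d) : Prop :=
  exists (Omega Gamma : set 'rV[R]_d) (v : nat -> functional) (A h : R),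
    [/\ [/\ open Omega, Omega x0 & Omega `<=` U],
        conic_nbhs xi0 Gamma,
        bounded_seq U v /\ (forall N, eq_on Omega (v N) u),
        0 < A /\ 0 < h &
        forall (N : nat) xi, Gamma xi -> xi != 0 ->
          Normc.normc (fourier (v N) xi)
            <= A * (h ^+ N * (N`!)%:R `^ (tau / sigma)
                    / enorm xi ^ Num.floor (N%:R `^ sigma^-1))].

Definition WF (tau sigma : R) U u : set ('rV[R]_d * 'rV[R]_d) :=
  [set p | [/\ U p.1, p.2 != 0 & ~ ets_regular tau sigma U u p.1 p.2]].

End Distributions.

(* Main.v *)
Require Import Defs.
From mathcomp Require Import all_boot all_order all_algebra.
From mathcomp Require Import all_classical all_reals all_analysis.
From mathcomp Require Import complex.
From mathcomp Require Import ring lra zify.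
Set Implicit Arguments.
Unset Strict Implicit.
Unset Printing Implicit Defensive.
Import Order.TTheory GRing.Theory Num.Theory.
Import numFieldNormedType.Exports.
Local Open Scope classical_set_scope.
Local Open Scope ring_scope.
Local Open Scope complex_scope.

(** Let (x0, xi0) be outside the wave front set of u, as witnessed by a cone
    Gamma and distributions v_N that equal u near x0 and whose Fourier
    transforms decay in Gamma. Put
      w_N = sum_alpha chi a_alpha D^alpha v_(N'),
    where chi is a fixed cutoff equal to 1 near x0 and N' is chosen so that
    floor(N'^(1/sigma)) is at least n + k, with n = floor(N^(1/sigma)) and k a
    constant. Near x0, w_N is P u; the points to prove are that (w_N) is bounded and that its
    Fourier transforms decay in a smaller cone.

    Three facts prepare the estimate.
    - A bounded sequence of E'(U) is equicontinuous: one compact set K, one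
      order k0 and one constant serve all v_N (bounded_seq_equibounded).
      Otherwise normalizing a sequence of bad test functions gives a bounded set
      on which the v_N are unbounded.
    - Since sigma > 1, a single Gevrey cutoff works for all N: the derivatives of
      chi of order n are at most C^n (2n)!^const, which is below H^(n^sigma) for
      some H (exists_cutoff, cutoff_growth). So b = chi a_alpha obeys bounds of
      the same kind as a_alpha, on the whole space (cut_bound).
    - Passing from N to N' is harmless: h^N' N'!^(tau/sigma), and the weight of
      the class at order n + k, are at most A' h'^N N!^(tau/sigma)
      (reindexed_growth). With x = N^(1/sigma), this is because
      (x + k)^sigma - x^sigma = O(x^(sigma - 1)) while ln N = O(x).

    The Fourier transform of w_N at xi is a combination of the numbers
    v_N'(D^alpha (b e_xi)) with e_xi the character. The classical argument splits
    the convolution of the transforms of b and v_N' where the frequency of b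
    reaches eps |xi|. Here b is approximated instead, with its derivatives of
    order at most k0 + m, by a finite combination of plane waves of frequency at
    most eps |xi|: the sum of the moduli of the coefficients is bounded
    independently of xi, and the error is (C / |xi|)^q times a bound on
    derivatives of b of order q + const (trig_approx). The waves move xi inside
    Gamma, where the transform of v_N' decays to the order n + k at least; the
    remainder is controlled by equicontinuity, which costs |xi|^(k0 + m), and
    taking q = n + k0 + m compensates for it (fourier_product_estimate).

    The approximation is a truncated discrete Fourier sum on a grid of a large
    cube. Inversion on the grid is an exact finite computation
    (fourier_inversion), and summation by parts bounds the coefficients
    uniformly in the mesh (dft_decay). Transforms of derivatives are
    the expected multiples of the transform up to O(mesh) (dft_dseq). For given
    xi and N, the mesh is taken so fine that these errors, and those made by
    passing from grid points to all points, are below the bound to be proved. *)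

Ltac nonneg := repeat first [ assumption | by [] | by apply: ltW | apply: addr_ge0
  | apply: mulr_ge0 | apply: exprn_ge0 | apply: sqr_ge0 | rewrite invr_ge0 ].

(** * Modulus of complex numbers *)

Section ComplexModulus.
Variable R : realType.
Implicit Types z w : R[i].

Lemma ReD z w : complex.Re (z + w) = complex.Re z + complex.Re w.
Proof. by case: z w => a b [c e]. Qed.

Lemma ImD z w : complex.Im (z + w) = complex.Im z + complex.Im w.
Proof. by case: z w => a b [c e]. Qed.

Lemma ReM z w :
  complex.Re (z * w) = complex.Re z * complex.Re w - complex.Im z * complex.Im w.
Proof. by case: z w => a b [c e]. Qed.

Lemma ImM z w :
  complex.Im (z * w) = complex.Re z * complex.Im w + complex.Im z * complex.Re w.
Proof. by case: z w => a b [c e]. Qed.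

Lemma normcD z w : Normc.normc (z + w) <= Normc.normc z + Normc.normc w.
Proof. exact: le_normcD. Qed.

Lemma normcN z : Normc.normc (- z) = Normc.normc z.
Proof. exact: normcN. Qed.

Lemma normcB z w : Normc.normc (z - w) <= Normc.normc z + Normc.normc w.
Proof. by rewrite -(normcN w); exact: normcD. Qed.

Lemma normc_ge0 z : 0 <= Normc.normc z.
Proof. by case: z => a b; exact: sqrtr_ge0. Qed.

Lemma Re_le_normc z : `|complex.Re z| <= Normc.normc z.
Proof.
case: z => a b /=; rewrite -sqrtr_sqr ler_sqrt; last by rewrite addr_ge0 ?sqr_ge0.
by rewrite lerDl sqr_ge0.
Qed.

Lemma Im_le_normc z : `|complex.Im z| <= Normc.normc z.
Proof.
case: z => a b /=; rewrite -sqrtr_sqr ler_sqrt; last by rewrite addr_ge0 ?sqr_ge0.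
by rewrite lerDr sqr_ge0.
Qed.

Lemma normc_le_ReIm z : Normc.normc z <= `|complex.Re z| + `|complex.Im z|.
Proof.
case: z => a b /=.
rewrite -[leRHS]ger0_norm ?addr_ge0// -sqrtr_sqr ler_sqrt ?sqr_ge0//.
rewrite sqrrD !real_normK ?num_real// lerD2r lerDl.
by rewrite mulrn_wge0 ?mulr_ge0.
Qed.

Lemma normc_sum (I : Type) (r : seq I) (P : pred I) (F : I -> R[i]) :
  Normc.normc (\sum_(i <- r | P i) F i) <= \sum_(i <- r | P i) Normc.normc (F i).
Proof.
elim/big_rec2: _ => [|i y x _ H]; first by rewrite Normc.normc0.
by apply: le_trans (normcD _ _) _; rewrite lerD2l.
Qed.

Lemma normcX z n : Normc.normc (z ^+ n) = Normc.normc z ^+ n.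
Proof. by elim: n => [|n IH]; rewrite ?expr0 ?Normc.normc1// !exprS Normc.normcM IH. Qed.

Lemma normc_prod (I : Type) (r : seq I) (P : pred I) (F : I -> R[i]) :
  Normc.normc (\prod_(i <- r | P i) F i) = \prod_(i <- r | P i) Normc.normc (F i).
Proof. by apply: (big_morph _ (@Normc.normcM R) (Normc.normc1 R)). Qed.

Lemma normc_real (x : R) : Normc.normc x%:C = `|x|.
Proof. by rewrite /= expr0n/= addr0 sqrtr_sqr. Qed.

End ComplexModulus.

(** * Partial derivatives of complex-valued functions *)

Section Partials.
Variables (R : realType) (d : nat).
Local Notation V := 'rV[R]_d.
Implicit Types (f g : V -> R[i]) (x : V) (i j : 'I_d).

(** Reduces every derivative in the direction v to one in a single real variable,
    where the mean value theorem is available. *)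
Lemma is_derive_lineE (F : V -> R) x v t l :
  is_derive (x + t *: v) v F l <-> is_derive t 1 (fun s : R => F (x + s *: v)) l.
Proof.
have E : (fun h : R => h^-1 *: ((F \o shift (x + t *: v)) (h *: v) - F (x + t *: v))) =
  (fun h : R => h^-1 *: (((fun s : R => F (x + s *: v)) \o shift t) (h *: 1) - F (x + t *: v))).
  apply/funext => h /=; congr (_ *: (F _ - _)).
  by rewrite scalerDl addrCA; congr (_ + (_ + _)); rewrite [h *: 1]mulr1.
split=> -[H1 H2]; apply: DeriveDef.
- by move: H1; rewrite /derivable E.
- by move: H2; rewrite /derive E.
- by move: H1; rewrite /derivable -E.
- by move: H2; rewrite /derive -E.
Qed.

(** Stated on real and imaginary parts, as partial is; unlike an equation
    about partial, it includes the existence of the derivative. *)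
Definition has_partial i f x (l : R[i]) : Prop :=
  is_derive x (unitv R i) (fun y => complex.Re (f y)) (complex.Re l) /\
  is_derive x (unitv R i) (fun y => complex.Im (f y)) (complex.Im l).

Lemma has_partialE i f x l : has_partial i f x l -> partial i f x = l.
Proof. by case: l => a b [H1 H2]; rewrite /partial !derive_val. Qed.

Lemma has_partial_eq i f x l l' : has_partial i f x l -> l = l' -> has_partial i f x l'.
Proof. by move=> H <-. Qed.

Lemma has_partial_near i f g x l : (\near x, f x = g x) ->
  has_partial i f x l -> has_partial i g x l.
Proof.
move=> fg [H1 H2]; split.
  apply: near_eq_is_derive H1.
  by apply: filterS fg => y ->.
apply: near_eq_is_derive H2.
by apply: filterS fg => y ->.
Qed.

Lemma has_partial_cst i (a : R[i]) x : has_partial i (fun=> a) x 0.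
Proof. by split; exact: is_derive_cst. Qed.

Lemma has_partialD i f g x l l' : has_partial i f x l -> has_partial i g x l' ->
  has_partial i (fun y => f y + g y) x (l + l').
Proof.
move=> [H1 H2] [H3 H4]; split.
  rewrite (_ : (fun y => _) = (fun y => complex.Re (f y)) + (fun y => complex.Re (g y))).
    by rewrite ReD; exact: is_deriveD.
  by apply/funext => y; rewrite ReD.
rewrite (_ : (fun y => _) = (fun y => complex.Im (f y)) + (fun y => complex.Im (g y))).
  by rewrite ImD; exact: is_deriveD.
by apply/funext => y; rewrite ImD.
Qed.

Lemma has_partialM i f g x l l' : has_partial i f x l -> has_partial i g x l' ->
  has_partial i (fun y => f y * g y) x (l * g x + f x * l').
Proof.
move=> [H1 H2] [H3 H4]; split.
  rewrite (_ : (fun y => _) = (fun y => complex.Re (f y)) * (fun y => complex.Re (g y))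
     - (fun y => complex.Im (f y)) * (fun y => complex.Im (g y))).
    apply: (is_derive_eq (is_deriveB (is_deriveM H1 H3) (is_deriveM H2 H4))); rewrite ReD !ReM /GRing.scale/=; ring.
  by apply/funext => y; rewrite ReM.
rewrite (_ : (fun y => _) = (fun y => complex.Re (f y)) * (fun y => complex.Im (g y))
     + (fun y => complex.Im (f y)) * (fun y => complex.Re (g y))).
  apply: (is_derive_eq (is_deriveD (is_deriveM H1 H4) (is_deriveM H2 H3))); rewrite ImD !ImM /GRing.scale/=; ring.
by apply/funext => y; rewrite ImM.
Qed.

Definition regular_at f x : Prop :=
  [/\ {for x, continuous (fun y => complex.Re (f y))},
      {for x, continuous (fun y => complex.Im (f y))} &
      forall i, has_partial i f x (partial i f x)].

Lemma smoothP U f : smooth U f <->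
  forall (s : seq 'I_d) x, U x -> regular_at (foldr (@partial R d) f s) x.
Proof.
split=> H s x Ux; have [H1 H2 H3] := H s x Ux; split=> // i.
  by have [D1 D2] := H3 i; split; exact: derivableP.
by have [D1 D2] := H3 i; split; [exact: @ex_derive D1|exact: @ex_derive D2].
Qed.

(** Smoothness to finite order, unfolded from the first derivative taken: closure
    properties of smooth functions then follow by induction on the order, which
    the quantification over all lists of indices in smooth does not allow. *)
Fixpoint Cn (n : nat) (U : set V) f : Prop :=
  (forall x, U x -> regular_at f x) /\
  (if n is n'.+1 then forall i, Cn n' U (partial i f) else True).

Lemma Cn_regular n U f x : Cn n U f -> U x -> regular_at f x.
Proof. by case: n => [|n] [H _] Ux; exact: H. Qed.

Lemma CnW n U f : Cn n.+1 U f -> Cn n U f.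
Proof.
by elim: n f => [|n IH] f [H1 H2]; split => // i; exact: IH.
Qed.

Lemma smooth_Cn U f : smooth U f <-> forall n, Cn n U f.
Proof.
rewrite smoothP; split=> H.
  move=> n; elim: n f H => [|n IH] f H; split=> //.
  - by move=> x; exact: (H [::]).
  - by move=> x; exact: (H [::]).
  by move=> i; apply: IH => s x Ux; have := H (rcons s i) x Ux; rewrite foldr_rcons.
move=> s; elim/last_ind: s f H => [|s i IH] f H x Ux.
  by case: (H 0%N) => K _; exact: K.
by rewrite foldr_rcons; apply: IH => // n; have [_ K] := H n.+1; exact: K.
Qed.

Lemma partial_eq U f g i : open U -> (forall x, U x -> f x = g x) ->
  forall x, U x -> regular_at f x -> partial i f x = partial i g x.
Proof.
move=> oU fg x Ux [_ _ H]; apply/esym/has_partialE.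
apply: has_partial_near (H i).
by apply: filterS (open_nbhs_nbhs (conj oU Ux)).
Qed.

Lemma continuous_near (F G : V -> R) x : (\forall y \near x, F y = G y) ->
  {for x, continuous F} -> {for x, continuous G}.
Proof.
move=> FG cF; rewrite /prop_for /continuous_at -(nbhs_singleton FG).
apply: cvg_trans cF.
apply: (@near_eq_cvg _ _ (nbhs x) _ F G).
by apply: filterS FG => y ->.
Qed.

Lemma regular_at_eq U f g x : open U -> (forall x, U x -> f x = g x) ->
  U x -> regular_at f x -> regular_at g x.
Proof.
move=> oU fg Ux rf.
have nfg : \near x, f x = g x by apply: filterS (open_nbhs_nbhs (conj oU Ux)).
have [c1 c2 H] := rf.
split.
- by apply: continuous_near c1; apply: filterS nfg => y ->.
- by apply: continuous_near c2; apply: filterS nfg => y ->.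
move=> i; rewrite -(partial_eq i oU fg Ux rf).
exact: has_partial_near (H i).
Qed.

Lemma Cn_eq n U f g : open U -> (forall x, U x -> f x = g x) -> Cn n U f -> Cn n U g.
Proof.
move=> oU; elim: n f g => [|n IH] f g fg [H1 H2]; split=> //.
- by move=> x Ux; exact: (regular_at_eq oU fg Ux (H1 x Ux)).
- by move=> x Ux; exact: (regular_at_eq oU fg Ux (H1 x Ux)).
move=> i; apply: IH (H2 i) => x Ux.
exact: (partial_eq i oU fg Ux (H1 x Ux)).
Qed.

Lemma regular_cst (a : R[i]) x : regular_at (fun=> a) x.
Proof.
split; [exact: (@cst_continuous _ _ (complex.Re a))|exact: (@cst_continuous _ _ (complex.Im a))|].
by move=> i; rewrite (has_partialE (has_partial_cst i a x)); exact: has_partial_cst.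
Qed.

Lemma partial_cst i (a : R[i]) : partial i (fun=> a) = fun=> 0 :> R[i].
Proof. by apply/funext => x; exact: has_partialE (has_partial_cst i a x). Qed.

Lemma Cn_cst n U (a : R[i]) : Cn n U (fun=> a).
Proof.
elim: n a => [|n IH] a; split=> //; do ?by move=> x _; exact: regular_cst.
by move=> i; rewrite partial_cst; exact: IH.
Qed.

Lemma regularD f g x : regular_at f x -> regular_at g x ->
  regular_at (fun y => f y + g y) x.
Proof.
move=> [c1 c2 H] [c3 c4 H']; split.
- apply: (@continuous_near (fun y => complex.Re (f y) + complex.Re (g y))).
    by apply: filterE => y; rewrite ReD.
  exact: (continuousD c1 c3).
- apply: (@continuous_near (fun y => complex.Im (f y) + complex.Im (g y))).
    by apply: filterE => y; rewrite ImD.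
  exact: (continuousD c2 c4).
move=> i; have K := has_partialD (H i) (H' i).
by rewrite (has_partialE K).
Qed.

Lemma regularM f g x : regular_at f x -> regular_at g x ->
  regular_at (fun y => f y * g y) x.
Proof.
move=> [c1 c2 H] [c3 c4 H']; split.
- apply: (@continuous_near (fun y => complex.Re (f y) * complex.Re (g y)
     - complex.Im (f y) * complex.Im (g y))).
    by apply: filterE => y; rewrite ReM.
  exact: (continuousB (continuousM c1 c3) (continuousM c2 c4)).
- apply: (@continuous_near (fun y => complex.Re (f y) * complex.Im (g y)
     + complex.Im (f y) * complex.Re (g y))).
    by apply: filterE => y; rewrite ImM.
  exact: (continuousD (continuousM c1 c4) (continuousM c2 c3)).
move=> i; have K := has_partialM (H i) (H' i).
by rewrite (has_partialE K).
Qed.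

Lemma partialD i f g x : regular_at f x -> regular_at g x ->
  partial i (fun y => f y + g y) x = partial i f x + partial i g x.
Proof. by move=> [_ _ H] [_ _ H']; exact: has_partialE (has_partialD _ _). Qed.

Lemma partialM i f g x : regular_at f x -> regular_at g x ->
  partial i (fun y => f y * g y) x = partial i f x * g x + f x * partial i g x.
Proof. by move=> [_ _ H] [_ _ H']; exact: has_partialE (has_partialM _ _). Qed.

Lemma CnD n U f g : open U -> Cn n U f -> Cn n U g -> Cn n U (fun y => f y + g y).
Proof.
move=> oU; elim: n f g => [|n IH] f g Hf Hg; (split; last first) => //.
- by move=> x Ux; apply: regularD; [exact: Cn_regular Hf Ux|exact: Cn_regular Hg Ux].
- move=> i; apply: (@Cn_eq n U (fun y => partial i f y + partial i g y)) => //.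
    by move=> x Ux; rewrite partialD//; [exact: Cn_regular Hf Ux|exact: Cn_regular Hg Ux].
  by apply: IH; [exact: Hf.2|exact: Hg.2].
- by move=> x Ux; apply: regularD; [exact: Cn_regular Hf Ux|exact: Cn_regular Hg Ux].
Qed.

Lemma CnM n U f g : open U -> Cn n U f -> Cn n U g -> Cn n U (fun y => f y * g y).
Proof.
move=> oU; elim: n f g => [|n IH] f g Hf Hg; (split; last first) => //.
- by move=> x Ux; apply: regularM; [exact: Cn_regular Hf Ux|exact: Cn_regular Hg Ux].
- move=> i; apply: (@Cn_eq n U (fun y => partial i f y * g y + f y * partial i g y)) => //.
    by move=> x Ux; rewrite partialM//; [exact: Cn_regular Hf Ux|exact: Cn_regular Hg Ux].
  by apply: CnD => //; apply: IH => //; [exact: Hf.2|exact: CnW|exact: CnW|exact: Hg.2].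
- by move=> x Ux; apply: regularM; [exact: Cn_regular Hf Ux|exact: Cn_regular Hg Ux].
Qed.

End Partials.

(** * Symmetry of second derivatives *)

Section SupNorm.
Variables (R : realType) (d : nat).
Implicit Types (x : 'rV[R]_d) (i j : 'I_d).

Lemma coord_le_norm x i : `|x 0 i| <= `|x|.
Proof.
rewrite [leRHS]/Num.norm /= mx_normrE; apply/bigmax_geP; right => /=.
by exists (0, i).
Qed.

Lemma norm_le_coord x r : 0 <= r -> (forall i, `|x 0 i| <= r) -> `|x| <= r.
Proof.
move=> r0 H; rewrite [leLHS]/Num.norm /= mx_normrE; apply/bigmax_leP; split=> //.
by move=> [a i] _ /=; rewrite (ord1 a).
Qed.

Lemma unitvE i j : unitv R i 0 j = (i == j)%:R.
Proof. by rewrite /unitv mxE eqxx /= eq_sym. Qed.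

Lemma norm_unitv i : `|unitv R i| <= 1.
Proof.
by apply: norm_le_coord => // j; rewrite unitvE; case: eqP => _; rewrite ?normr1 ?normr0.
Qed.

End SupNorm.

Section MeanValue.
Variable R : realType.

Lemma mean_value (f df : R -> R) (h : R) : 0 < h ->
  (forall t : R, 0 <= t <= h -> is_derive t (1 : R) f (df t)) ->
  exists2 c, 0 <= c <= h & f h - f 0 = df c * h.
Proof.
move=> h0 Hd.
have [c|c|c cin E] := @MVT R f df 0 h h0.
- by rewrite in_itv/= => /andP[c0 ch]; apply: Hd; rewrite !ltW.
- apply: derivable_within_continuous => t tin.
  have ht : 0 <= t <= h by move: tin; rewrite in_itv.
  by have := Hd t ht; exact: @ex_derive.
exists c; last by rewrite E subr0.
by move: cin; rewrite in_itv/= => /andP[c0 ch]; rewrite !ltW.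
Qed.

End MeanValue.

Section Schwarz.
Variables (R : realType) (d : nat).
Local Notation V := 'rV[R]_d.

(** Two applications of the mean value theorem, first along the direction i to the
    increment in the direction j, then along j. The left-hand side is symmetric
    in i and j; this is the whole proof of the symmetry of second derivatives. *)
Lemma second_difference (F Fi Fij : V -> R) (i j : 'I_d) (x : V) (r h : R) :
  0 < h -> h *+ 2 < r ->
  (forall y, `|x - y| < r -> is_derive y (unitv R i) F (Fi y)) ->
  (forall y, `|x - y| < r -> is_derive y (unitv R j) Fi (Fij y)) ->
  exists2 y, `|x - y| < r &
   F (x + h *: unitv R i + h *: unitv R j) - F (x + h *: unitv R i)
   - (F (x + h *: unitv R j) - F x) = Fij y * (h * h).
Proof.
move=> h0 hr Hi Hj.
set u := unitv R i; set v := unitv R j.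
have near_x (s t : R) : 0 <= s <= h -> 0 <= t <= h -> `|x - (x + s *: u + t *: v)| < r.
  move=> /andP[s0 sh] /andP[t0 th].
  rewrite -addrA opprD addNKr normrN.
  apply: le_lt_trans hr; rewrite mulr2n.
  apply: le_trans (ler_normD _ _) _; rewrite !normrZ !ger0_norm//.
  by apply: lerD; apply: le_trans (ler_piMr _ (norm_unitv _ _)) _.
have hh : 0 <= h <= h by rewrite lexx ltW.
have zz : (0 : R) <= 0 <= h by rewrite lexx ltW.
pose phi s := F (x + h *: v + s *: u) - F (x + s *: u).
pose dphi s := Fi (x + h *: v + s *: u) - Fi (x + s *: u).
have [s|s sh Es] := @mean_value R phi dphi h h0.
  move=> sh; apply: is_deriveB.
    by apply/is_derive_lineE; apply: Hi; rewrite addrAC; apply: near_x.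
  apply/is_derive_lineE; apply: Hi.
  by rewrite -[X in _ - X]addr0 -(scale0r v); apply: near_x.
pose psi t := Fi (x + s *: u + t *: v).
have [t|t th Et] := @mean_value R psi (fun t => Fij (x + s *: u + t *: v)) h h0.
  by move=> th; apply/is_derive_lineE; apply: Hj; apply: near_x.
exists (x + s *: u + t *: v); first exact: near_x.
move: Es; rewrite /phi !scale0r !addr0 [x + _ + _ in LHS]addrAC => ->.
rewrite mulrA; congr (_ * _); rewrite -Et /psi /dphi scale0r addr0.
by rewrite addrAC.
Qed.

(** The second differences for (i, j) and (j, i) coincide, and each of them divided
    by the square of the step is a value of a mixed derivative near x. *)
Lemma schwarz_real (F Fi Fj Fij Fji : V -> R) (i j : 'I_d) (U : set V) x :
  open U -> U x ->
  (forall y, U y -> is_derive y (unitv R i) F (Fi y)) ->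
  (forall y, U y -> is_derive y (unitv R j) F (Fj y)) ->
  (forall y, U y -> is_derive y (unitv R j) Fi (Fij y)) ->
  (forall y, U y -> is_derive y (unitv R i) Fj (Fji y)) ->
  {for x, continuous Fij} -> {for x, continuous Fji} ->
  Fij x = Fji x.
Proof.
move=> oU Ux Hi Hj Hij Hji cij cji.
apply/eqP; rewrite -subr_eq0 -normr_le0; apply/ler_addgt0Pl => e e0.
rewrite addr0.
have e20 : 0 < e / 2 by rewrite divr_gt0.
have [r /= r0 Hr] : exists2 r : R, 0 < r & forall y, `|x - y| < r ->
    [/\ U y, `|Fij x - Fij y| < e / 2 & `|Fji x - Fji y| < e / 2].
  have N1 : \forall y \near x, U y by exact: open_nbhs_nbhs.
  have N2 : \forall y \near x, `|Fij x - Fij y| < e / 2 by exact: cvgr_dist_lt cij _ _.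
  have N3 : \forall y \near x, `|Fji x - Fji y| < e / 2 by exact: cvgr_dist_lt cji _ _.
  have /nbhs_ballP[r /= r0 H] : nbhs x [set y | U y /\
    (`|Fij x - Fij y| < e / 2 /\ `|Fji x - Fji y| < e / 2)].
    exact: filterI N1 (filterI N2 N3).
  by exists r => // y yr; have := H y; rewrite -ball_normE => /(_ yr) [? []].
pose h := r / 4.
have h0 : 0 < h by rewrite divr_gt0.
have hr : h *+ 2 < r by rewrite /h mulr2n; lra.
have [y yr E1] := @second_difference F Fi Fij i j x r h h0 hr
  (fun y yr => let: And3 a _ _ := Hr y yr in Hi y a)
  (fun y yr => let: And3 a _ _ := Hr y yr in Hij y a).
have [z zr E2] := @second_difference F Fj Fji j i x r h h0 hr
  (fun y yr => let: And3 a _ _ := Hr y yr in Hj y a)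
  (fun y yr => let: And3 a _ _ := Hr y yr in Hji y a).
have E : Fij y = Fji z.
  apply: (mulIf (x := h * h)); first by rewrite mulf_neq0 ?gt_eqF.
  rewrite -E1 -E2 [x + _ + _ in LHS]addrAC; lra.
have [_ A1 _] := Hr y yr; have [_ _ A2] := Hr z zr.
rewrite (_ : Fij x - Fji x = (Fij x - Fij y) - (Fji x - Fji z)); last by rewrite E; ring.
apply: le_trans (ler_normB _ _) _.
by rewrite [leRHS]splitr lerD// ltW.
Qed.

End Schwarz.

(** * Iterated partial derivatives *)

Notation dseq s f := (foldr (@partial _ _) f s).

Section IteratedPartials.
Variables (R : realType) (d : nat).
Local Notation V := 'rV[R]_d.
Implicit Types (f g : V -> R[i]) (U : set V) (i j : 'I_d) (s t : seq 'I_d).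

Lemma smooth_regular U f x : smooth U f -> U x -> regular_at f x.
Proof. by move=> /smoothP H; exact: (H [::]). Qed.

Lemma smooth_dseq U f s : smooth U f -> smooth U (dseq s f).
Proof. by move=> /smoothP H; apply/smoothP => t x Ux; rewrite -foldr_cat; exact: H. Qed.

Lemma smooth_partial U f i : smooth U f -> smooth U (partial i f).
Proof. exact: (@smooth_dseq U f [:: i]). Qed.

Lemma smooth_sub U U' f : U' `<=` U -> smooth U f -> smooth U' f.
Proof. by move=> UU H s x Ux; apply: H; exact: UU. Qed.

Lemma smooth_eq U f g : open U -> (forall x, U x -> f x = g x) ->
  smooth U f -> smooth U g.
Proof. by move=> oU fg /smooth_Cn H; apply/smooth_Cn => n; exact: Cn_eq fg (H n). Qed.

Lemma smooth_cst U (a : R[i]) : smooth U (fun=> a).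
Proof. by apply/smooth_Cn => n; exact: Cn_cst. Qed.

Lemma smoothD U f g : open U -> smooth U f -> smooth U g ->
  smooth U (fun y => f y + g y).
Proof.
by move=> oU /smooth_Cn H /smooth_Cn H'; apply/smooth_Cn => n; exact: CnD.
Qed.

Lemma smoothM U f g : open U -> smooth U f -> smooth U g ->
  smooth U (fun y => f y * g y).
Proof.
by move=> oU /smooth_Cn H /smooth_Cn H'; apply/smooth_Cn => n; exact: CnM.
Qed.

Lemma smoothZ U (a : R[i]) f : open U -> smooth U f -> smooth U (fun y => a * f y).
Proof. by move=> oU; apply: smoothM => //; exact: smooth_cst. Qed.

Lemma smooth_sum U (I : Type) (r : seq I) (F : I -> V -> R[i]) : open U ->
  (forall k, smooth U (F k)) -> smooth U (fun y => \sum_(k <- r) F k y).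
Proof.
move=> oU H; elim: r => [|k r IH].
  apply: (@smooth_eq U (fun=> 0)) => //; last exact: smooth_cst.
  by move=> x _; rewrite big_nil.
apply: (smooth_eq oU _ (smoothD oU (H k) IH)) => x _.
by rewrite big_cons.
Qed.

Lemma smooth_local U f : (forall x, U x -> exists2 W, open W /\ W x & smooth W f) ->
  smooth U f.
Proof. by move=> H s x /H[W [oW Wx]]; exact. Qed.

Lemma dseq_eq U f g s x : open U -> (forall x, U x -> f x = g x) ->
  smooth U f -> U x -> dseq s f x = dseq s g x.
Proof.
move=> oU fg /smoothP sf; elim: s x => [|i s IH] x Ux /=; first exact: fg.
by apply: (partial_eq i oU IH Ux); exact: sf.
Qed.

Lemma dseqD U f g s x : open U -> smooth U f -> smooth U g -> U x ->
  dseq s (fun y => f y + g y) x = dseq s f x + dseq s g x.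
Proof.
move=> oU sf sg; elim: s x => [|i s IH] x Ux //=.
have sD := smooth_dseq s (smoothD oU sf sg).
rewrite (partial_eq i oU IH Ux (smooth_regular sD Ux)).
by apply: partialD; apply: smooth_regular Ux; exact: smooth_dseq.
Qed.

Lemma dseqZ U (a : R[i]) f s x : open U -> smooth U f -> U x ->
  dseq s (fun y => a * f y) x = a * dseq s f x.
Proof.
move=> oU sf; elim: s x => [|i s IH] x Ux //=.
have sD := smooth_dseq s (smoothZ a oU sf).
rewrite (partial_eq i oU IH Ux (smooth_regular sD Ux)).
rewrite partialM; [|exact: regular_cst|by apply: smooth_regular Ux; exact: smooth_dseq].
by rewrite partial_cst mul0r add0r.
Qed.

Lemma dseq_cst s (a : R[i]) : (0 < size s)%N -> dseq s (fun=> a) = (fun=> 0) :> (V -> _).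
Proof.
elim: s => [//|i [|j s] IH] _; first exact: partial_cst.
by rewrite [LHS]/= -/(dseq (j :: s) _) IH// partial_cst.
Qed.

Lemma dseq0 s x : dseq s (fun=> 0 : R[i]) (x : V) = 0.
Proof. by case: s => [//|i s]; rewrite dseq_cst. Qed.

Lemma dseq_sum U (I : Type) (r : seq I) (F : I -> V -> R[i]) s x : open U ->
  (forall k, smooth U (F k)) -> U x ->
  dseq s (fun y => \sum_(k <- r) F k y) x = \sum_(k <- r) dseq s (F k) x.
Proof.
move=> oU H Ux; elim: r => [|k r IH].
  rewrite big_nil -[RHS](dseq0 s x); congr (dseq s _ x).
  by apply/funext => y; rewrite big_nil.
rewrite big_cons -IH -(dseqD s oU (H k) (smooth_sum r oU H) Ux).
by congr (dseq s _ x); apply/funext => y; rewrite big_cons.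
Qed.

Lemma schwarz U f i j x : open U -> smooth U f -> U x ->
  partial i (partial j f) x = partial j (partial i f) x.
Proof.
move=> oU sf Ux.
have P k l y : U y -> has_partial k (dseq l f) y (partial k (dseq l f) y).
  by move=> Uy; have [_ _] := smooth_regular (smooth_dseq l sf) Uy.
have [c1 c2 _] := smooth_regular (smooth_dseq [:: i; j] sf) Ux.
have [c3 c4 _] := smooth_regular (smooth_dseq [:: j; i] sf) Ux.
have ERe := schwarz_real oU Ux (fun y Uy => (P j [::] y Uy).1)
  (fun y Uy => (P i [::] y Uy).1) (fun y Uy => (P i [:: j] y Uy).1)
  (fun y Uy => (P j [:: i] y Uy).1) c1 c3.
have EIm := schwarz_real oU Ux (fun y Uy => (P j [::] y Uy).2)
  (fun y Uy => (P i [::] y Uy).2) (fun y Uy => (P i [:: j] y Uy).2)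
  (fun y Uy => (P j [:: i] y Uy).2) c2 c4.
by apply/eqP; rewrite eq_complex; apply/andP; split; apply/eqP; [exact: ERe|exact: EIm].
Qed.

(** Schwarz symmetry moves one derivative past all the others. *)
Lemma dseq_insert U f s t i x : open U -> smooth U f -> U x ->
  dseq (s ++ i :: t) f x = dseq (i :: s ++ t) f x.
Proof.
move=> oU sf; elim: s x => [|j s IH] x Ux //=.
have sD u := smooth_regular (smooth_dseq u sf) Ux.
rewrite (partial_eq j oU IH Ux (sD _)) /=.
exact: (schwarz j i oU (smooth_dseq (s ++ t) sf) Ux).
Qed.

Lemma dseq_perm U f s t x : open U -> smooth U f -> perm_eq s t -> U x ->
  dseq s f x = dseq t f x.
Proof.
move=> oU sf; elim: s t x => [|i s IH] t x; first by rewrite perm_sym => /perm_nilP ->.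
move=> st Ux; have it : i \in t by rewrite -(perm_mem st) mem_head.
case/splitPr: it st => t1 t2 st.
rewrite (dseq_insert _ _ _ oU sf Ux) /=.
apply: (partial_eq i oU _ Ux (smooth_regular (smooth_dseq s sf) Ux)) => y Uy.
apply: IH => //.
by rewrite -(perm_cons i) (perm_trans st)// -cat1s perm_catCA.
Qed.

(** The order of differentiation used by mpartial, which makes mpartialE an
    equality of functions, with no regularity assumed. *)
Definition seq_of_multi (alpha : multi_index d) : seq 'I_d :=
  flatten [seq nseq (alpha i) i | i <- enum 'I_d].

Lemma mpartialE alpha f : mpartial alpha f = dseq (seq_of_multi alpha) f.
Proof.
rewrite /mpartial /seq_of_multi; elim: (enum _) => //= i e IH.
by rewrite foldr_cat -IH; elim: (alpha i) => //= n ->.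
Qed.

Lemma size_seq_of_multi alpha : size (seq_of_multi alpha) = mdeg alpha.
Proof.
rewrite /seq_of_multi size_flatten /shape -map_comp sumnE big_map /mdeg.
rewrite big_enum /=; apply: eq_bigr => i _; exact: size_nseq.
Qed.

Definition multi_of_seq s : multi_index d := [ffun i => count_mem i s].

Lemma perm_multi_of_seq s : perm_eq s (seq_of_multi (multi_of_seq s)).
Proof.
apply/allP => i _ /=; apply/eqP.
rewrite /seq_of_multi count_flatten -map_comp sumnE big_map big_enum /=.
rewrite (bigD1 i)//= count_nseq /= eqxx mul1n ffunE big1 ?addn0// => j ji.
by rewrite count_nseq /= (negbTE ji) mul0n.
Qed.

Lemma mdeg_multi_of_seq s : mdeg (multi_of_seq s) = size s.
Proof. by rewrite -size_seq_of_multi -(perm_size (perm_multi_of_seq s)). Qed.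

(** The class and the seminorms only speak of mpartial; by symmetry of the
    derivatives they control derivatives taken in any order. *)
Lemma dseq_mpartial U f s x : open U -> smooth U f -> U x ->
  dseq s f x = mpartial (multi_of_seq s) f x.
Proof. by move=> oU sf; rewrite mpartialE; apply: dseq_perm => //; exact: perm_multi_of_seq. Qed.

End IteratedPartials.

(** * Bounds on all derivatives up to a given order *)

Section DerivativeBounds.
Variables (R : realType) (d : nat).
Local Notation V := 'rV[R]_d.
Implicit Types (f g : V -> R[i]) (K U : set V) (i j : 'I_d) (s t : seq 'I_d).

(** A bound rather than a norm: it passes through sums, products and derivatives
    with no supremum to handle. *)
Definition dbound K n f (M : R) : Prop :=
  forall s x, (size s <= n)%N -> K x -> Normc.normc (dseq s f x) <= M.

Lemma dboundS K n f M : dbound K n.+1 f M <->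
  (forall x, K x -> Normc.normc (f x) <= M) /\ forall i, dbound K n (partial i f) M.
Proof.
split=> [H|[H1 H2] s x].
  split=> [x Kx|i s x sn Kx]; first exact: (H [::]).
  by have := H (rcons s i) x; rewrite foldr_rcons size_rcons; apply.
case/lastP: s => [_|s i]; first exact: H1.
by rewrite size_rcons foldr_rcons; exact: H2.
Qed.

Lemma dbound_le K n f M M' : M <= M' -> dbound K n f M -> dbound K n f M'.
Proof. by move=> MM H s x sn Kx; apply: le_trans (H s x sn Kx) MM. Qed.

Lemma dbound_leq K n n' f M : (n' <= n)%N -> dbound K n f M -> dbound K n' f M.
Proof. by move=> nn H s x sn Kx; apply: H => //; exact: leq_trans nn. Qed.

Lemma dbound_sub K K' n f M : K' `<=` K -> dbound K n f M -> dbound K' n f M.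
Proof. by move=> KK H s x sn Kx; apply: H => //; exact: KK. Qed.

Lemma dbound_eq U K n f g M : open U -> K `<=` U -> (forall x, U x -> f x = g x) ->
  smooth U f -> dbound K n f M -> dbound K n g M.
Proof.
move=> oU KU fg sf H s x sn Kx.
by rewrite -(dseq_eq s oU fg sf (KU _ Kx)); exact: H.
Qed.

Lemma dboundD U K n f g A B : open U -> K `<=` U -> smooth U f -> smooth U g ->
  dbound K n f A -> dbound K n g B -> dbound K n (fun y => f y + g y) (A + B).
Proof.
move=> oU KU sf sg Hf Hg s x sn Kx.
rewrite (dseqD s oU sf sg (KU _ Kx)).
by apply: le_trans (normcD _ _) _; rewrite lerD ?Hf ?Hg.
Qed.

Lemma dbound_partial K n f i M : dbound K n.+1 f M -> dbound K n (partial i f) M.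
Proof. by move=> /dboundS[_]. Qed.

Lemma dbound_dseq K n f s M : dbound K (size s + n) f M -> dbound K n (dseq s f) M.
Proof.
by move=> H t x tn Kx; rewrite -foldr_cat; apply: H => //; rewrite size_cat addnC leq_add2l.
Qed.

(** Leibniz formula, one derivative at a time; each of the n derivatives doubles the
    number of terms. *)
Lemma dboundM U K n f g A B : open U -> K `<=` U -> smooth U f -> smooth U g ->
  0 <= A -> 0 <= B ->
  dbound K n f A -> dbound K n g B -> dbound K n (fun y => f y * g y) (2 ^+ n * (A * B)).
Proof.
move=> oU KU + + A0 B0; elim: n f g => [|n IH] f g sf sg Hf Hg.
  move=> s x; rewrite leqn0 size_eq0 => /eqP -> Kx /=.
  by rewrite expr0 mul1r Normc.normcM ler_pM ?normc_ge0 ?(Hf [::]) ?(Hg [::]).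
apply/dboundS; split=> [x Kx|i].
  rewrite Normc.normcM; apply: le_trans (_ : A * B <= _).
    by rewrite ler_pM ?normc_ge0 ?(Hf [::]) ?(Hg [::]).
  by rewrite ler_peMl ?mulr_ge0// exprn_ege1// ler1n.
have sfi := smooth_partial i sf; have sgi := smooth_partial i sg.
have s1 := smoothM oU sfi sg; have s2 := smoothM oU sf sgi.
have Leibniz x : U x -> partial i f x * g x + f x * partial i g x = partial i (fun y => f y * g y) x.
  by move=> Ux; rewrite (partialM i (smooth_regular sf Ux) (smooth_regular sg Ux)).
apply: (dbound_eq oU KU Leibniz (smoothD oU s1 s2)).
apply: (@dbound_le _ _ _ (2 ^+ n * (A * B) + 2 ^+ n * (A * B))).
  by rewrite exprS -mulrA mulr2n mulrDl mul1r.
apply: (dboundD oU KU s1 s2); apply: IH => //.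
- exact: dbound_partial.
- exact: dbound_leq Hg.
- exact: dbound_leq Hf.
- exact: dbound_partial.
Qed.

End DerivativeBounds.

(** * Exhaustion of an open set by compact sets *)

Section CompactSets.
Variables (R : realType) (d : nat).
Local Notation V := 'rV[R]_d.
Implicit Types (f g : V -> R[i]) (K U : set V).

(** A property indexed by n that holds for large n, locally uniformly, holds for
    one n on a compact set. *)
Lemma compact_eventually K (P : nat -> V -> Prop) : compact K ->
  (forall x, K x -> exists n, \forall y \near x, forall m, (n <= m)%N -> P m y) ->
  exists n, forall x, K x -> P n x.
Proof.
move=> /compact_near_coveringP cK H.
have [x Kx|n _ Hn] := cK nat \oo P _.
  have [n Hn] := H x Kx.
  exists ([set y | forall m, (n <= m)%N -> P m y], [set m | (n <= m)%N]).
    by split => //; exists n.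
  by move=> [y m] [/= H1 H2]; exact: H1.
by exists n => x Kx; apply: (Hn n) => //=.
Qed.

Lemma compact_normc_bounded K g : compact K -> (forall x, K x -> regular_at g x) ->
  exists2 M : R, 0 <= M & forall x, K x -> Normc.normc (g x) <= M.
Proof.
move=> cK rg.
have [x Kx|n Hn] := @compact_eventually K (fun m y => Normc.normc (g y) <= m%:R) cK.
  have [c1 c2 _] := rg x Kx.
  pose n := Num.bound (`|complex.Re (g x)| + `|complex.Im (g x)| + 2).
  exists n.
  have N1 : \forall y \near x, `|complex.Re (g x) - complex.Re (g y)| < 1.
    exact: cvgr_dist_lt c1 _ ltr01.
  have N2 : \forall y \near x, `|complex.Im (g x) - complex.Im (g y)| < 1.
    exact: cvgr_dist_lt c2 _ ltr01.
  apply: filterS (filterI N1 N2) => y [H1 H2] m nm.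
  apply: le_trans (_ : n%:R <= _); last by rewrite ler_nat.
  apply: le_trans (ltW (archi_boundP _)); last by rewrite !addr_ge0.
  apply: le_trans (normc_le_ReIm _) _.
  have := ler_distD (complex.Re (g x)) (complex.Re (g y)) 0.
  have := ler_distD (complex.Im (g x)) (complex.Im (g y)) 0.
  rewrite !subr0 [`|complex.Re (g y) - _|]distrC [`|complex.Im (g y) - _|]distrC.
  by move=> A1 A2; lra.
by exists n%:R.
Qed.

Lemma smooth_dbound U K f n : compact K -> K `<=` U -> smooth U f ->
  exists2 M : R, 0 <= M & dbound K n f M.
Proof.
move=> cK KU; elim: n f => [|n IH] f sf.
  have [x Kx|M M0 HM] := @compact_normc_bounded K f cK.
    exact: smooth_regular (KU _ Kx).
  exists M => // s x; rewrite leqn0 size_eq0 => /eqP ->; exact: HM.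
have [x Kx|M M0 HM] := @compact_normc_bounded K f cK.
  exact: smooth_regular (KU _ Kx).
have /choice[Mi HMi] : forall i, exists M, 0 <= M /\ dbound K n (partial i f) M.
  by move=> i; have [M' ? ?] := IH _ (smooth_partial i sf); exists M'.
exists (M + \sum_i Mi i).
  by rewrite addr_ge0// sumr_ge0// => i _; exact: (HMi i).1.
apply/dboundS; split.
  move=> x Kx; apply: le_trans (HM x Kx) _.
  by rewrite lerDl sumr_ge0// => i _; exact: (HMi i).1.
move=> i; apply: dbound_le (HMi i).2.
rewrite (bigD1 i)//= addrCA lerDl addr_ge0// sumr_ge0// => j _; exact: (HMi j).1.
Qed.

Definition exhaustion U (j : nat) : set V :=
  [set x | `|x| <= j%:R /\ forall y, ~ U y -> j.+1%:R^-1 <= `|x - y|].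

Lemma exhaustion_sub U j : exhaustion U j `<=` U.
Proof.
move=> x [_ H]; apply: contrapT => /H; rewrite subrr normr0.
by rewrite leNgt invr_gt0 ltr0n.
Qed.

Lemma closed_dist_ge (c : V) (r : R) : closed [set x : V | r <= `|x - c|].
Proof.
apply: (@closed_comp _ _ (fun x : V => `|x - c|) [set t | r <= t]).
  move=> x _; apply: (@continuous_comp _ _ _ (fun x : V => x - c) (fun x : V => `|x|)).
    by apply: continuousB; [exact: cvg_id|exact: (@cst_continuous _ _ c)].
  exact: norm_continuous.
exact: closed_ge.
Qed.

Lemma closed_norm_le (r : R) : closed [set x : V | `|x| <= r].
Proof.
apply: (@closed_comp _ _ (fun x : V => `|x|) [set t | t <= r]).
  by move=> x _; exact: norm_continuous.
exact: closed_le.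
Qed.

Lemma compact_norm_le (r : R) : compact [set x : V | `|x| <= r].
Proof.
apply: bounded_closed_compact (@closed_norm_le r).
exists r; split; first exact: num_real.
by move=> M rM x /= xr; apply: le_trans xr (ltW rM).
Qed.

Lemma compact_exhaustion U j : compact (exhaustion U j).
Proof.
apply: (@subclosed_compact _ _ [set x : V | `|x| <= j%:R]).
- rewrite (_ : exhaustion U j = [set x : V | `|x| <= j%:R] `&`
    \bigcap_(y in ~` U) [set x : V | j.+1%:R^-1 <= `|x - y|]).
    apply: closedI; first exact: closed_norm_le.
    by apply: closed_bigI => y _; exact: closed_dist_ge.
  by apply/seteqP; split=> x [H1 H2]; split.
- exact: compact_norm_le.
by move=> x [].
Qed.

(** Around a point at distance r from the complement of U, the ball of radius r/2
    lies in all but finitely many sets of the exhaustion. *)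
Lemma compact_sub_exhaustion U K : open U -> compact K -> K `<=` U ->
  exists n, forall m, (n <= m)%N -> K `<=` exhaustion U m.
Proof.
move=> oU cK KU.
have [x Kx|n Hn] := @compact_eventually K
  (fun n y => forall m, (n <= m)%N -> exhaustion U m y) cK; last first.
  by exists n => m nm x Kx; exact: Hn nm.
have /nbhs_ballP[r /= r0 Hr] : nbhs x U by exact: (open_nbhs_nbhs (conj oU (KU _ Kx))).
pose n1 := Num.bound (`|x| + r).
pose n2 := Num.bound (2 / r).
exists (maxn n1 n2).
apply/nbhs_ballP; exists (r / 2) => /=; first by rewrite divr_gt0.
move=> y; rewrite -ball_normE /= => xy m nm p mp.
have {nm mp} : (maxn n1 n2 <= p)%N by exact: leq_trans nm mp.
rewrite geq_max => /andP[p1 p2]; split.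
  apply: le_trans (_ : n1%:R <= _); last by rewrite ler_nat.
  apply: le_trans (ltW (archi_boundP _)); last by rewrite addr_ge0// ltW.
  have := ler_distD x y 0; rewrite !subr0 distrC => H; apply: le_trans H _.
  rewrite addrC lerD2l ltW//; apply: lt_trans xy _.
  by rewrite ltr_pdivrMr// ltr_pMr// ltr1n.
move=> z Uz; have xz : r <= `|x - z|.
  by rewrite leNgt; apply/negP => h; apply: Uz; apply: Hr; rewrite -ball_normE.
apply: le_trans (_ : r / 2 <= _).
  rewrite -[r / 2]invrK lef_pV2 ?posrE ?ltr0n ?invr_gt0 ?divr_gt0// invf_div.
  apply: le_trans (ltW (archi_boundP _)) _; first by rewrite divr_ge0// ltW.
  by rewrite ler_nat ltnW.
have := ler_distD y x z; lra.
Qed.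

End CompactSets.

(** * Seminorms and derivative bounds *)

Section Seminorms.
Variables (R : realType) (d : nat).
Local Notation V := 'rV[R]_d.
Implicit Types (f g : V -> R[i]) (K U : set V).

Lemma to_multiK k (alpha : multi_index d) : (mdeg alpha <= k)%N ->
  exists b : {ffun 'I_d -> 'I_k.+1}, to_multi b = alpha.
Proof.
move=> ak; have lei i : (alpha i < k.+1)%N.
  by rewrite ltnS; apply: leq_trans ak; rewrite /mdeg (bigD1 i)//= leq_addr.
by exists [ffun i => Ordinal (lei i)]; apply/ffunP => i; rewrite !ffunE.
Qed.

Lemma sup_normc_ge0 K g : 0 <= sup [set Normc.normc (g x) | x in K] :> R.
Proof.
set S := [set _ | _ in _].
have [[S0 SB]|nS] := pselect (has_sup S); last by rewrite sup_out.
have [y Sy] := S0; apply: le_trans (ub_le_sup SB Sy).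
by have [x _ <-] := Sy; exact: normc_ge0.
Qed.

(** A single supremum is at most the seminorm because the others are nonnegative;
    compactness of K is what makes these suprema meaningful. *)
Lemma dbound_seminorm U K k f : open U -> compact K -> K `<=` U -> smooth U f ->
  dbound K k f (seminorm K k f).
Proof.
move=> oU cK KU sf s x sk Kx.
rewrite (dseq_mpartial s oU sf (KU _ Kx)).
have ek : (mdeg (multi_of_seq s) <= k)%N by rewrite mdeg_multi_of_seq.
have [b bE] := to_multiK ek; rewrite -bE.
rewrite /seminorm /sum_multi (bigD1 b)/=; last by rewrite bE.
apply: ler_wpDr; first by apply: sumr_ge0 => c _; exact: sup_normc_ge0.
apply: ub_le_sup; last by exists x.
have [M M0 HM] := smooth_dbound k cK KU sf.
exists M => _ [y Ky <-]; rewrite mpartialE; apply: HM => //.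
by rewrite size_seq_of_multi bE.
Qed.

Definition card_multi k : R := #|{ffun 'I_d -> 'I_k.+1}|%:R.

Lemma seminorm_le_dbound K k f M : 0 <= M -> dbound K k f M ->
  seminorm K k f <= card_multi k * M.
Proof.
move=> M0 H; rewrite /seminorm /sum_multi.
apply: le_trans (_ : \sum_(b : {ffun 'I_d -> 'I_k.+1} | (mdeg (to_multi b) <= k)%N) M <= _).
  apply: ler_sum => b bk.
  have [[x Kx]|K0] := pselect (K !=set0); last first.
    have -> : K = set0 by apply/seteqP; split=> // x Kx; case: K0; exists x.
    by rewrite image_set0 sup0.
  apply: sup_le_ub; first by exists (Normc.normc (mpartial (to_multi b) f x)); exists x.
  by move=> _ [y Ky <-]; rewrite mpartialE; apply: H => //; rewrite size_seq_of_multi.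
rewrite sumr_const -[_ *+ _]mulr_natl ler_wpM2r// ler_nat; exact: max_card.
Qed.

End Seminorms.

(** * Equicontinuity of bounded sequences of distributions *)

Section CompactDistributions.
Variables (R : realType) (d : nat).
Local Notation V := 'rV[R]_d.
Implicit Types (f g : V -> R[i]) (K U : set V) (v : functional R d).

Lemma linear_on0 U v : linear_on (smooth U) v -> v (fun=> 0) = 0.
Proof.
move=> lv; have := lv 1 (fun=> 0) (fun=> 0) (@smooth_cst R d U 0) (@smooth_cst R d U 0).
rewrite mulr0 addr0 mul1r.
by move=> /eqP; rewrite -subr_eq0 opprD addNKr oppr_eq0 => /eqP.
Qed.

Lemma linear_onZ U v a f : linear_on (smooth U) v -> smooth U f ->
  v (fun x => a * f x) = a * v f.
Proof.
move=> lv sf; have := lv a f (fun=> 0) sf (@smooth_cst R d U 0).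
rewrite (linear_on0 lv) addr0 => <-; congr v.
by apply/funext => x; rewrite addr0.
Qed.

Lemma linear_onD U v f g : linear_on (smooth U) v -> smooth U f -> smooth U g ->
  v (fun x => f x + g x) = v f + v g.
Proof.
move=> lv sf sg; have := lv 1 f g sf sg.
by rewrite mul1r => <-; congr v; apply/funext => x; rewrite mul1r.
Qed.

Lemma linear_on_sum U v (I : Type) (r : seq I) (F : I -> V -> R[i]) : open U ->
  linear_on (smooth U) v -> (forall k, smooth U (F k)) ->
  v (fun x => \sum_(k <- r) F k x) = \sum_(k <- r) v (F k).
Proof.
move=> oU lv sF; elim: r => [|k r IH].
  rewrite big_nil -[RHS](linear_on0 lv); congr v.
  by apply/funext => y; rewrite big_nil.
rewrite big_cons -IH -(linear_onD lv (sF k) (smooth_sum r oU sF)); congr v.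
by apply/funext => y; rewrite big_cons.
Qed.

(** Continuity of a family of forms for one seminorm of C^oo(U), uniformly. *)
Definition equibounded U (v : nat -> functional R d) K (C : R) (k : nat) : Prop :=
  forall N f M, smooth U f -> 0 <= M -> dbound K k f M ->
    Normc.normc (v N f) <= C * M.

(** If no compact set, order and constant worked, there would be for each j a
    function g_j with derivatives of order at most j bounded by 1 on the j-th set
    of the exhaustion, and an index N with |v_N(g_j)| = j. The g_j form a bounded
    set, since a given seminorm exceeds a constant for finitely many of them only. *)
Lemma bounded_seq_equibounded U (v : nat -> functional R d) : open U ->
  bounded_seq U v ->
  exists K (C : R) (k : nat), [/\ compact K, K `<=` U, 0 <= C & equibounded U v K C k].
Proof.
move=> oU [cv bv]; apply: contrapT => nE.
have /choice[w Hw] : forall j : nat, exists p : nat * (V -> R[i]),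
    [/\ smooth U p.2, Normc.normc (v p.1 p.2) = j%:R
      & dbound (exhaustion U j) j p.2 1].
  move=> j; apply: contrapT => nj; apply: nE.
  exists (exhaustion U j), j%:R, j; split=> //.
  - exact: compact_exhaustion.
  - exact: exhaustion_sub.
  move=> N f M sf M0 fM; rewrite leNgt; apply/negP => Hlt; apply: nj.
  set A := Normc.normc (v N f) in Hlt.
  have A0 : 0 < A by apply: le_lt_trans Hlt; rewrite mulr_ge0.
  exists (N, fun x => (j%:R / A)%:C * f x); split=> /=.
  - exact: smoothZ.
  - rewrite (linear_onZ _ (cv N).1 sf) Normc.normcM normc_real -/A.
    by rewrite ger0_norm ?divr_ge0 ?divfK ?gt_eqF// ltW.
  move=> s x sj Kx; rewrite (dseqZ _ s oU sf (exhaustion_sub Kx)).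
  rewrite Normc.normcM normc_real ger0_norm; last by rewrite divr_ge0// ltW.
  rewrite mulrAC ler_pdivrMr// mul1r; apply: le_trans (ltW Hlt).
  by rewrite ler_wpM2l// fM.
pose g j := (w j).2; pose B := range g.
have bB : bounded_smooth U B.
  split; first by move=> _ [j _ <-]; have [] := Hw j.
  move=> K k cK KU.
  have [n0 Hn0] := compact_sub_exhaustion oU cK KU.
  pose J := maxn n0 k.
  have [M HM] : exists M : R, forall j, (j < J)%N -> seminorm K k (g j) <= M.
    elim: J => [|J [M HM]]; first by exists 0.
    exists (Num.max M (seminorm K k (g J))) => j.
    rewrite ltnS leq_eqVlt => /orP[/eqP ->|/HM H]; first by rewrite le_max lexx orbT.
    by rewrite le_max H.
  exists (Num.max M (card_multi R d k)) => _ [j _ <-].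
  have [jJ|Jj] := ltnP j J; first by rewrite le_max HM.
  rewrite le_max; apply/orP; right.
  have [_ _ D] := Hw j.
  rewrite -[leRHS]mulr1; apply: seminorm_le_dbound => //.
  move: Jj; rewrite geq_max => /andP[j1 j2].
  by apply: dbound_leq j2 _; apply: dbound_sub D; exact: Hn0.
have [M HM] := bv B bB.
have M0 : 0 <= M.
  by apply: le_trans (HM (w 0%N).1 (g 0%N) _); [exact: normc_ge0|exists 0%N].
have := archi_boundP M0; rewrite ltNge => /negP; apply.
have [_ E _] := Hw (Num.bound M).
by rewrite -E; apply: HM; exists (Num.bound M).
Qed.

Lemma equibounded_compact_distribution U v K C k : open U -> compact K -> K `<=` U ->
  0 <= C -> linear_on (smooth U) v -> equibounded U (fun=> v) K C k ->
  compact_distribution U v.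
Proof.
move=> oU cK KU C0 lv H; split=> //.
exists K, C, k; split=> // f sf.
have s0 : 0 <= seminorm K k f by apply: sumr_ge0 => b _; exact: sup_normc_ge0.
exact: (H 0%N f _ sf s0 (dbound_seminorm oU cK KU sf)).
Qed.

Lemma equibounded_bounded_seq U (v : nat -> functional R d) K C k :
  open U -> compact K -> K `<=` U -> 0 <= C ->
  (forall N, linear_on (smooth U) (v N)) -> equibounded U v K C k -> bounded_seq U v.
Proof.
move=> oU cK KU C0 lv H; split.
  by move=> N; apply: (equibounded_compact_distribution oU cK KU C0 (lv N)) => _; exact: (H N).
move=> B [sB bB]; have [M HM] := bB K k cK KU.
exists (C * Num.max M 0) => N f Bf; apply: H; first exact: sB.
  by rewrite le_max lexx orbT.
apply: dbound_le (dbound_seminorm oU cK KU (sB f Bf)).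
by rewrite le_max HM.
Qed.

End CompactDistributions.

(** * Complex exponentials *)

Section UnitCircle.
Variable R : realType.
Implicit Types (a b t x y : R).

Lemma derive_lipschitz (f df : R -> R) M :
  (forall t : R, is_derive t (1 : R) f (df t)) -> (forall t, `|df t| <= M) ->
  forall a b, `|f b - f a| <= M * `|b - a|.
Proof.
move=> Hd HM; suff H a b : a < b -> `|f b - f a| <= M * `|b - a|.
  move=> a b; case: (ltgtP a b) => [ab|ba|->]; first exact: H.
    by rewrite distrC [`|b - a|]distrC; exact: H.
  by rewrite !subrr normr0 mulr0.
move=> ab; have ba0 : 0 < b - a by rewrite subr_gt0.
have [t _|c _ E] := @mean_value R (fun t => f (a + t * 1)) (fun t => df (a + t * 1)) _ ba0.
  have := Hd (a + t * 1); move=> H.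
  have sh : is_derive t (1 : R) (fun s : R => a + s * 1) 1.
    rewrite (_ : (fun s : R => a + s * 1) = shift a); last by apply/funext => s /=; rewrite mulr1 addrC.
    exact: is_derive_shift.
  have := @is_derive1_comp R f (fun s => a + s * 1) t _ _ H sh.
  by rewrite mulr1.
move: E; rewrite mul0r addr0 (_ : a + (b - a) * 1 = b); last by rewrite mulr1 addrC subrK.
move=> ->.
by rewrite normrM ler_wpM2r.
Qed.

Lemma sin_le_norm x : `|sin x| <= `|x|.
Proof.
have := @derive_lipschitz sin cos 1 (fun t => is_derive_sin t) (@cos_max R) 0 x.
by rewrite sin0 !subr0 mul1r.
Qed.

Lemma one_sub_cos x : 1 - cos x = sin (x / 2) ^+ 2 *+ 2.
Proof.
have := cos_mulr2n (x / 2).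
by rewrite (_ : (x / 2) *+ 2 = x) ?cos2sin2; [move=> ->; ring|rewrite -[(x / 2) *+ 2]mulr_natr divfK].
Qed.

Lemma one_sub_cos_le x : `|1 - cos x| <= x ^+ 2.
Proof.
have h : sin (x / 2) ^+ 2 <= (x / 2) ^+ 2.
  by rewrite -[leLHS]real_normK ?num_real// -[leRHS]real_normK ?num_real// lerXn2r ?nnegrE ?sin_le_norm.
rewrite one_sub_cos ger0_norm; last by rewrite mulrn_wge0 ?sqr_ge0.
apply: le_trans (_ : (x / 2) ^+ 2 *+ 2 <= _); first by rewrite lerMn2r h orbT.
have := sqr_ge0 x; nra.
Qed.

(** A weak form of the Jordan inequality, by halving the angle: cos >= 1/2 on
    [0, pi/4]. *)
Lemma sin_ge_quarter x : 0 <= x -> x <= pi / 2 -> x / 4 <= sin x.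
Proof.
rewrite le_eqVlt => /predU1P[<-|x0 xpi]; first by rewrite mul0r sin0.
pose y := x / 2; have y0 : 0 < y by rewrite divr_gt0.
have pi0 := pi_gt0 R.
have cosc (c : R) : 0 <= c <= y -> 1 / 2 <= cos c.
  move=> /andP[c0 cy].
  have yx : y *+ 2 = x by rewrite -[y *+ 2]mulr_natr /y divfK.
  have cp : 0 <= cos c.
    apply: cos_ge0_pihalf; apply/andP; split.
      by apply: le_trans c0; rewrite oppr_le0 divr_ge0// ltW.
    by apply: le_trans cy (le_trans _ xpi); rewrite -yx mulr2n lerDl ltW.
  have c2p : 0 <= cos (c *+ 2).
    apply: cos_ge0_pihalf; apply/andP; split.
      by apply: le_trans (mulrn_wge0 2 c0); rewrite oppr_le0 divr_ge0// ltW.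
    by apply: le_trans xpi; rewrite -yx lerMn2r cy orbT.
  rewrite leNgt; apply/negP => h.
  have h2 : cos c ^+ 2 <= (1 / 2) ^+ 2 by rewrite lerXn2r ?nnegrE// ltW.
  move: c2p; rewrite cos_mulr2n mulr2n; move: h2; rewrite expr2 => h2; lra.
have [c cy] := @mean_value R sin cos y y0 (fun t _ => is_derive_sin t).
rewrite sin0 subr0 => sy.
have E : sin x = (cos y * sin y) *+ 2.
  by rewrite -sin_mulr2n; congr sin; rewrite -[y *+ 2]mulr_natr /y divfK.
have c1 := cosc c cy; have c2 := cosc y; rewrite lexx ltW//= in c2; have {}c2 := c2 isT.
rewrite E sy.
have h : 1/2 * (1/2) <= cos y * cos c by apply: ler_pM.
rewrite (_ : x / 4 = (1/2 * (1/2) * y) *+ 2); last by rewrite /y; field.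
by rewrite lerMn2r [cos y * _]mulrA ler_wpM2r ?orbT// ltW.
Qed.

Lemma sin_sub_le x : `|sin x - x| <= 2 * x ^+ 2.
Proof.
have := @derive_lipschitz (fun t => sin t - t) (fun t => cos t - 1) 2.
have Hd (t : R) : is_derive t (1 : R) (fun t => sin t - t) (cos t - 1).
  exact: is_deriveB.
move=> /(_ Hd) H.
have [x1|x1] := leP `|x| 1; last first.
  have := H _ 0 x; rewrite sin0 !subr0 => /(_ _)/le_trans; apply.
    move=> t; apply: le_trans (ler_normB _ _) _; rewrite normr1.
    by have := cos_max t; lra.
  rewrite ler_wpM2l// -[leRHS]real_normK ?num_real// expr2 ler_peMl// ltW//.
have main y : 0 < y -> y <= 1 -> `|sin y - y| <= 2 * y ^+ 2.
  move=> y0 y1; have [c /andP[c0 cy]] := @mean_value R (fun t => sin t - t) _ _ y0 (fun t _ => Hd t).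
  rewrite sin0 !subr0 => ->; rewrite normrM (gtr0_norm y0) expr2 mulrA ler_wpM2r//.
    exact: ltW.
  rewrite distrC; apply: le_trans (one_sub_cos_le c) _.
  nra.
have [x0|x0|->] := ltgtP x 0; last by rewrite sin0 subr0 normr0 expr0n mulr0.
  have := main (- x); rewrite oppr_gt0 x0 sinN sqrrN -opprD normrN; apply=> //.
  by rewrite -(ltr0_norm x0).
by apply: main => //; rewrite -(gtr0_norm x0).
Qed.

(** t |-> e^(2 pi i t) *)
Definition expi t : R[i] := cos (2 * pi * t) +i* sin (2 * pi * t).

Lemma expiD a b : expi (a + b) = expi a * expi b.
Proof.
rewrite /expi mulrDr cosD sinD; apply/eqP; rewrite eq_complex /=; apply/andP; split => //.
by rewrite addrC.
Qed.

Lemma expi0 : expi 0 = 1.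
Proof. by rewrite /expi mulr0 cos0 sin0. Qed.

Lemma normc_expi t : Normc.normc (expi t) = 1.
Proof. by rewrite /= cos2Dsin2 sqrtr1. Qed.

Lemma expi1 : expi 1 = 1.
Proof. by rewrite /expi mulr1 mulr_natl cos2pi sin2pi. Qed.

Lemma expiMn t n : expi (t * n%:R) = expi t ^+ n.
Proof.
elim: n => [|n IH]; first by rewrite mulr0 expi0 expr0.
by rewrite exprS -IH -expiD mulrS mulrDr mulr1.
Qed.

Lemma expi_nat n : expi n%:R = 1.
Proof. by rewrite -[n%:R]mul1r expiMn expi1 expr1n. Qed.

Lemma expiN t : expi (- t) * expi t = 1.
Proof. by rewrite -expiD addNr expi0. Qed.

(** The modulus is 2 |sin (pi t)|. This is what turns summation by parts into decay
    of discrete Fourier coefficients. *)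
Lemma expi_sub1_ge t : `|t| <= 1 / 2 -> `|t| <= Normc.normc (expi t - 1).
Proof.
move=> t2.
have pi0 := pi_gt0 R; have pi2 := pi_ge2 R.
have h : `|pi * t| / 4 <= `|sin (pi * t)|.
  have H : 0 <= `|pi * t| by [].
  have H2 : `|pi * t| <= pi / 2.
    by rewrite normrM gtr0_norm//; nra.
  have := sin_ge_quarter H H2.
  move=> h; apply: le_trans h _.
  case: (ger0P (pi * t)) => p0; first exact: ler_norm.
  by rewrite sinN -normrN; exact: ler_norm.
have E : Normc.normc (expi t - 1) = `|sin (pi * t)| *+ 2.
  rewrite /expi /=.
  rewrite (_ : 2 * pi * t = (pi * t) *+ 2); last by ring.
  rewrite cos_mulr2n sin_mulr2n subr0.
  rewrite -[RHS]ger0_norm ?mulrn_wge0// -sqrtr_sqr; congr Num.sqrt.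
  rewrite cos2sin2 exprMn_n [in RHS]exprMn_n real_normK ?num_real// exprMn cos2sin2; ring.
rewrite E -mulr_natr; apply: le_trans (_ : `|pi * t| / 4 * 2 <= _); last by rewrite ler_wpM2r.
rewrite normrM gtr0_norm//; have := normr_ge0 t; nra.
Qed.

Lemma expi_taylor t :
  Normc.normc (expi t - 1 - (0 +i* (2 * pi * t))) <= 3 * (2 * pi * t) ^+ 2.
Proof.
set x := 2 * pi * t.
apply: le_trans (normc_le_ReIm _) _; rewrite /expi /= -/x !subr0.
have := sin_sub_le x; have := one_sub_cos_le x; rewrite distrC; lra.
Qed.

End UnitCircle.

(** * Plane waves *)

Section Waves.
Variables (R : realType) (d : nat).
Local Notation V := 'rV[R]_d.
Implicit Types (x y xi eta : V) (i j : 'I_d) (s : seq 'I_d).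

Lemma dotvDl x y xi : dotv (x + y) xi = dotv x xi + dotv y xi.
Proof. by rewrite /dotv -big_split; apply: eq_bigr => i _; rewrite mxE mulrDl. Qed.

Lemma dotvDr x xi eta : dotv x (xi + eta) = dotv x xi + dotv x eta.
Proof. by rewrite /dotv -big_split; apply: eq_bigr => i _; rewrite mxE mulrDr. Qed.

Lemma dotvNr x xi : dotv x (- xi) = - dotv x xi.
Proof. by rewrite /dotv -sumrN; apply: eq_bigr => i _; rewrite mxE mulrN. Qed.

Lemma dotvZl (a : R) x xi : dotv (a *: x) xi = a * dotv x xi.
Proof. by rewrite /dotv mulr_sumr; apply: eq_bigr => i _; rewrite mxE mulrA. Qed.

Lemma dotv_unitv i xi : dotv (unitv R i) xi = xi 0 i.
Proof.
rewrite /dotv (bigD1 i)//= big1 ?addr0; first by rewrite unitvE eqxx mul1r.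
by move=> j ji; rewrite unitvE eq_sym (negbTE ji) mul0r.
Qed.

Lemma continuous_dotv xi : continuous (fun x => dotv x xi).
Proof.
suff H (r : seq 'I_d) : continuous (fun x : V => \sum_(i <- r) (x 0 i * xi 0 i)).
  exact: H.
move=> x; elim: r => [|i r IH].
  apply: (@continuous_near _ _ (fun=> 0)); last exact: (@cst_continuous _ _ 0).
  by apply: filterE => y; rewrite big_nil.
apply: (@continuous_near _ _ (fun y : V => y 0 i * xi 0 i + \sum_(i <- r) (y 0 i * xi 0 i))).
  by apply: filterE => y; rewrite big_cons.
apply: continuousD => //; apply: continuousM; first exact: coord_continuous.
exact: (@cst_continuous _ _ (xi 0 i)).
Qed.

Definition wave xi : V -> R[i] := fun x => expi (dotv x xi).

Lemma characterE xi : character xi = wave (- xi).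
Proof. by apply/funext => x; rewrite /character /wave /expi dotvNr mulrN cosN sinN. Qed.

Lemma waveD xi eta x : wave (xi + eta) x = wave xi x * wave eta x.
Proof. by rewrite /wave dotvDr expiD. Qed.

Lemma normc_wave xi x : Normc.normc (wave xi x) = 1.
Proof. exact: normc_expi. Qed.

(** The factor 2 pi i xi_j that differentiation in the direction j produces. *)
Definition wave_factor xi j : R[i] := 0 +i* (2 * pi * xi 0 j).

Lemma normc_wave_factor xi j : Normc.normc (wave_factor xi j) <= 2 * pi * `|xi|.
Proof.
rewrite /wave_factor /= expr0n/= add0r sqrtr_sqr normrM.
have p0 : 0 <= 2 * pi :> R by rewrite mulr_ge0// pi_ge0.
by rewrite ger0_norm// ler_wpM2l// coord_le_norm.
Qed.

Lemma has_partial_wave xi j x :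
  has_partial j (wave xi) x (wave_factor xi j * wave xi x).
Proof.
pose a := 2 * pi * dotv x xi; pose b := 2 * pi * xi 0 j.
have lin (s : R) : is_derive s (1 : R) (fun s : R => a + b * s) b.
  have H := is_deriveD (is_derive_cst a s (1 : R)) (is_deriveZ b (is_derive_id s (1 : R))).
  by apply: (is_derive_eq H); rewrite add0r [_ *: _]mulr1.
have E (s : R) : 2 * pi * dotv (x + s *: unitv R j) xi = a + b * s.
  by rewrite dotvDl dotvZl dotv_unitv /a /b; ring.
split; rewrite -[x in is_derive x]addr0 -(scale0r (unitv R j)); apply/is_derive_lineE.
  rewrite (_ : (fun s : R => _) = cos \o (fun s : R => a + b * s)); last first.
    by apply/funext => s /=; rewrite E.
  apply: (is_derive_eq (@is_derive1_comp R cos (fun s : R => a + b * s) 0 _ _ (is_derive_cos _) (lin 0))).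
  by rewrite /wave_factor /wave /expi /= -/a -/b mulr0 addr0; ring.
rewrite (_ : (fun s : R => _) = sin \o (fun s : R => a + b * s)); last first.
  by apply/funext => s /=; rewrite E.
apply: (is_derive_eq (@is_derive1_comp R sin (fun s : R => a + b * s) 0 _ _ (is_derive_sin _) (lin 0))).
by rewrite /wave_factor /wave /expi /= -/a -/b mulr0 addr0; ring.
Qed.

Lemma partial_wave xi j : partial j (wave xi) = fun x => wave_factor xi j * wave xi x.
Proof. by apply/funext => x; exact: has_partialE (has_partial_wave xi j x). Qed.

Lemma regular_wave xi x : regular_at (wave xi) x.
Proof.
have c : {for x, continuous (fun y => 2 * pi * dotv y xi)}.
  apply: continuousM; last exact: continuous_dotv.
  exact: (@cst_continuous _ _ (2 * pi)).
split.
- exact: continuous_comp c (@continuous_cos R _).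
- exact: continuous_comp c (@continuous_sin R _).
by move=> i; rewrite partial_wave; exact: has_partial_wave.
Qed.

Lemma smooth_wave U xi : open U -> smooth U (wave xi).
Proof.
move=> oU; apply/smooth_Cn => n; elim: n => [|n IH].
  by split=> // x _; exact: regular_wave.
split=> [x _|i]; first exact: regular_wave.
by rewrite partial_wave; apply: CnM => //; exact: Cn_cst.
Qed.

Definition wave_factors xi s : R[i] := \prod_(j <- s) wave_factor xi j.

Lemma dseq_wave xi s x : dseq s (wave xi) x = wave_factors xi s * wave xi x.
Proof.
rewrite /wave_factors; elim: s x => [|j s IH] x /=; first by rewrite big_nil mul1r.
rewrite big_cons -mulrA.
rewrite (_ : dseq s (wave xi) = fun x => (\prod_(j <- s) wave_factor xi j) * wave xi x).
  rewrite (@partialM _ _ j (fun=> _)); [|exact: regular_cst|exact: regular_wave].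
  by rewrite partial_cst mul0r add0r partial_wave mulrCA.
exact/funext.
Qed.

Lemma normc_wave_factors xi s :
  Normc.normc (wave_factors xi s) <= (2 * pi * `|xi|) ^+ size s.
Proof.
rewrite /wave_factors normc_prod; elim: s => [|j s IH]; first by rewrite big_nil expr0.
rewrite big_cons exprS ler_pM ?normc_ge0 ?normc_wave_factor//.
by apply: prodr_ge0 => i _; exact: normc_ge0.
Qed.

Lemma dbound_wave K n xi (M : R) : 1 <= M -> 2 * pi * `|xi| <= M ->
  dbound K n (wave xi) (M ^+ n).
Proof.
move=> M1 HM s x sn _; rewrite dseq_wave Normc.normcM normc_wave mulr1.
apply: le_trans (normc_wave_factors _ _) _.
apply: le_trans (_ : M ^+ size s <= _); last exact: ler_weXn2l.
by rewrite lerXn2r ?nnegrE// ?(le_trans ler01 M1)// ?mulr_ge0// ?pi_ge0.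
Qed.

End Waves.

(** * Translations and finite differences *)

Section Translations.
Variables (R : realType) (d : nat).
Local Notation V := 'rV[R]_d.
Implicit Types (f g : V -> R[i]) (x y v : V) (i j : 'I_d).

Lemma is_derive_translate (F : V -> R) x v w l : is_derive (x + v) w F l ->
  is_derive x w (fun y => F (y + v)) l.
Proof.
rewrite -{1}[x + v]addr0 -(scale0r w) => /(is_derive_lineE F (x + v) w 0 l).1 H.
rewrite -[x in is_derive x]addr0 -(scale0r w).
apply: (is_derive_lineE (fun y => F (y + v)) x w 0 l).2.
rewrite (_ : (fun s : R => _) = fun s : R => F (x + v + s *: w)) //.
by apply/funext => s; rewrite addrAC.
Qed.

Lemma has_partial_shift i f x v l : has_partial i f (x + v) l ->
  has_partial i (fun y => f (y + v)) x l.
Proof.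
move=> [H1 H2]; split; first exact: (@is_derive_translate (fun y => complex.Re (f y))).
exact: (@is_derive_translate (fun y => complex.Im (f y))).
Qed.

Lemma regular_shift f x v : regular_at f (x + v) -> regular_at (fun y => f (y + v)) x.
Proof.
have cv : {for x, continuous (fun y : V => y + v)}.
  by apply: continuousD; [exact: cvg_id|exact: (@cst_continuous _ _ v)].
move=> [c1 c2 H]; split.
- exact: (@continuous_comp _ _ _ (fun y : V => y + v) (fun y => complex.Re (f y)) x cv c1).
- exact: (@continuous_comp _ _ _ (fun y : V => y + v) (fun y => complex.Im (f y)) x cv c2).
by move=> i; rewrite (has_partialE (has_partial_shift (H i))); exact: has_partial_shift.
Qed.

Lemma partial_shift i f v : smooth setT f ->
  partial i (fun y => f (y + v)) = fun y => partial i f (y + v).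
Proof.
move=> sf; apply/funext => x; apply: has_partialE; apply: has_partial_shift.
by have [_ _] := @smooth_regular R d setT f (x + v) sf I.
Qed.

Lemma smooth_shift f v : smooth setT f -> smooth setT (fun y => f (y + v)).
Proof.
move=> sf; apply/smooth_Cn => n; elim: n f sf => [|n IH] f sf.
  by split=> // x _; apply: regular_shift; exact: (@smooth_regular R d setT).
split=> [x _|i]; first by apply: regular_shift; exact: (@smooth_regular R d setT).
by rewrite partial_shift//; apply: IH; exact: smooth_partial.
Qed.

Lemma partial_line i f x (t : R) : smooth setT f ->
  is_derive t (1 : R) (fun s : R => complex.Re (f (x + s *: unitv R i)))
     (complex.Re (partial i f (x + t *: unitv R i))) /\
  is_derive t (1 : R) (fun s : R => complex.Im (f (x + s *: unitv R i)))
     (complex.Im (partial i f (x + t *: unitv R i))).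
Proof.
move=> sf.
have [_ _ /(_ i) [H1 H2]] := @smooth_regular R d setT f (x + t *: unitv R i) sf I.
split.
  exact: ((is_derive_lineE (fun y => complex.Re (f y)) x (unitv R i) t _).1 H1).
exact: ((is_derive_lineE (fun y => complex.Im (f y)) x (unitv R i) t _).1 H2).
Qed.

(** Mean value inequality; the factor 2 comes from estimating real and
    imaginary parts separately. *)
Lemma partial_lipschitz i f x (t B : R) : smooth setT f ->
  (forall y, Normc.normc (partial i f y) <= B) ->
  Normc.normc (f (x + t *: unitv R i) - f x) <= 2 * B * `|t|.
Proof.
move=> sf HB.
have H1 := @derive_lipschitz R _ _ B (fun s => (partial_line i x s sf).1)
  (fun s => le_trans (Re_le_normc _) (HB _)) 0 t.
have H2 := @derive_lipschitz R _ _ B (fun s => (partial_line i x s sf).2)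
  (fun s => le_trans (Im_le_normc _) (HB _)) 0 t.
move: H1 H2; rewrite !scale0r !addr0 subr0 => H1 H2.
apply: le_trans (normc_le_ReIm _) _.
rewrite !raddfB /= (_ : 2 * B * `|t| = B * `|t| + B * `|t|); first exact: lerD.
by rewrite mulr2n; ring.
Qed.

(** The derivative varies by at most 2 B |s| at distance s, for real and imaginary
    parts separately. *)
Lemma partial_taylor i f x (t B : R) : smooth setT f -> 0 <= t ->
  (forall y, Normc.normc (partial i (partial i f) y) <= B) ->
  Normc.normc (f (x + t *: unitv R i) - f x - t%:C * partial i f x) <= 4 * B * t ^+ 2.
Proof.
rewrite le_eqVlt => sf /predU1P[<- _|t0 HB].
  by rewrite scale0r addr0 subrr mul0r subrr Normc.normc0 expr0n mulr0.
have main (F dF : R -> R) : (forall s : R, is_derive s (1 : R) F (dF s)) ->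
    (forall s, `|dF s - dF 0| <= 2 * B * `|s|) -> `|F t - F 0 - t * dF 0| <= 2 * B * t ^+ 2.
  move=> dFE HdF; have [c /andP[c0 ct] E] := mean_value t0 (fun s _ => dFE s).
  rewrite E [dF c * t]mulrC -mulrBr normrM (gtr0_norm t0) expr2 mulrCA (ler_wpM2l (ltW t0))//.
  apply: le_trans (HdF c) _; rewrite ger0_norm// ler_wpM2l// mulr_ge0//.
  by apply: le_trans (HB x); exact: normc_ge0.
have spf := smooth_partial i sf.
have K s := partial_lipschitz x s spf HB.
have HRe := main _ _ (fun s => (partial_line i x s sf).1) _.
have HIm := main _ _ (fun s => (partial_line i x s sf).2) _.
move: HRe HIm; rewrite !scale0r !addr0 => HRe HIm.
apply: le_trans (normc_le_ReIm _) _.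
have ReE (a b e : R[i]) : complex.Re (a - b - t%:C * e)
    = complex.Re a - complex.Re b - t * complex.Re e.
  by case: a b e => a1 a2 [b1 b2] [e1 e2] /=; rewrite mul0r subr0.
have ImE (a b e : R[i]) : complex.Im (a - b - t%:C * e)
    = complex.Im a - complex.Im b - t * complex.Im e.
  by case: a b e => a1 a2 [b1 b2] [e1 e2] /=; rewrite mul0r addr0.
rewrite ReE ImE (_ : 4 * B * t ^+ 2 = 2 * B * t ^+ 2 + 2 * B * t ^+ 2); last by ring.
apply: lerD; [apply: HRe => s|apply: HIm => s]; apply: le_trans (K s).
  by rewrite -raddfB; exact: Re_le_normc.
by rewrite -raddfB; exact: Im_le_normc.
Qed.

End Translations.

Section ForwardDifferences.
Variables (R : realType) (d : nat).
Local Notation V := 'rV[R]_d.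
Implicit Types (f g : V -> R[i]) (x y v : V) (i j : 'I_d).

Definition fdiff (h : R) i f : V -> R[i] := fun x => f (x + h *: unitv R i) - f x.

Lemma smooth_fdiff h i f : smooth setT f -> smooth setT (fdiff h i f).
Proof.
move=> sf; have s2 : smooth setT (fun x => -1 * f x) by exact: (smoothZ _ openT).
apply: smooth_eq (smoothD openT (smooth_shift (h *: unitv R i) sf) s2); first exact: openT.
by move=> x _; rewrite mulN1r.
Qed.

Lemma partial_fdiff h i f : smooth setT f ->
  partial i (fdiff h i f) = fdiff h i (partial i f).
Proof.
move=> sf; apply/funext => x; apply: has_partialE.
have H1 : has_partial i (fun x => f (x + h *: unitv R i)) x (partial i f (x + h *: unitv R i)).
  by apply: has_partial_shift; have [_ _] := @smooth_regular R d setT f (x + h *: unitv R i) sf I.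
have H2 : has_partial i f x (partial i f x).
  by have [_ _] := @smooth_regular R d setT f x sf I.
have H3 := has_partialD H1 (has_partialM (has_partial_cst i (-1) x) H2).
apply: (has_partial_eq (l := partial i f (x + h *: unitv R i) + (0 * f x + -1 * partial i f x))).
  apply: has_partial_near H3.
  by apply: filterE => y; rewrite mulN1r.
by rewrite mul0r add0r mulN1r.
Qed.

(** Differences commute with derivatives, so n mean value inequalities can be
    applied in turn. *)
Lemma iter_fdiff_le h i f n (B : R) : 0 <= h -> smooth setT f ->
  (forall x, Normc.normc (iter n (partial i) f x) <= B) ->
  forall x, Normc.normc (iter n (fdiff h i) f x) <= (2 * h) ^+ n * B.
Proof.
move=> h0; elim: n f B => [|n IH] f B sf HB x; first by rewrite mul1r; exact: HB.
rewrite iterSr.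
have sd : forall k g, smooth setT g -> iter k (partial i) (fdiff h i g) = fdiff h i (iter k (partial i) g).
  elim=> [|k IHk] g sg; first by [].
  by rewrite !iterSr (partial_fdiff h i sg) (IHk _ (smooth_partial i sg)).
have siter k g : smooth setT g -> smooth setT (iter k (partial i) g).
  by move=> sg; elim: k => [|k Hk]; [exact: sg|exact: smooth_partial].
have B0 : 0 <= B by apply: le_trans (HB x); exact: normc_ge0.
rewrite exprSr -mulrA; apply: IH; first exact: smooth_fdiff.
move=> y; rewrite sd// /fdiff; have := @partial_lipschitz R d i (iter n (partial i) f) y h B (siter n f sf) HB.
by rewrite ger0_norm// mulrAC.
Qed.

End ForwardDifferences.

(** * Discrete Fourier transform on a grid *)

Section Grid.
Variables (R : realType) (d : nat) (L : R) (Q : nat).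
Hypotheses (L0 : 0 < L) (Q0 : (0 < Q)%N).
Local Notation V := 'rV[R]_d.
Local Notation M := (Q.*2).
Local Notation J := {ffun 'I_d -> 'I_M}.
Implicit Types (f g F : V -> R[i]) (x y v kappa : V) (i : 'I_d) (j p : J).

(** The cube with sides from -L to L is divided into 2Q steps of length L/Q in each
    direction. Frequencies are the multiples of 1/(2L) from -Q/(2L) to
    (Q-1)/(2L), so that those of the waves periodic over the cube are represented
    once, with the product of frequency and step at most 1/2 in modulus. *)
Definition step : R := L / Q%:R.
Definition grid j : V := \row_i (- L + step * (j i)%:R).
Definition freq p : V := \row_i (((p i)%:R - Q%:R) / (2 * L)).
Definition grid_mean F : R[i] := ((M%:R ^+ d)^-1)%:C * \sum_j F (grid j).
(** The Fourier coefficient of f, with a Riemann sum in place of the integral. *)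
Definition dft kappa f : R[i] := grid_mean (fun x => f x * wave (- kappa) x).

Let Qr0 : 0 < Q%:R :> R. Proof. by rewrite ltr0n. Qed.
Let M0 : (0 < M)%N. Proof. by rewrite double_gt0. Qed.
Let Mr0 : 0 < M%:R :> R. Proof. by rewrite ltr0n. Qed.
Let ME : M%:R = 2 * Q%:R :> R. Proof. by rewrite -muln2 natrM mulrC. Qed.

Lemma step_gt0 : 0 < step. Proof. by rewrite divr_gt0. Qed.

Lemma stepM : step * M%:R = 2 * L.
Proof. by rewrite /step ME; field; rewrite gt_eqF. Qed.

Lemma grid_meanD F G : grid_mean (fun x => F x + G x) = grid_mean F + grid_mean G.
Proof. by rewrite /grid_mean big_split mulrDr. Qed.

Lemma grid_meanZ a F : grid_mean (fun x => a * F x) = a * grid_mean F.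
Proof. by rewrite /grid_mean -mulr_sumr mulrCA. Qed.

Lemma grid_mean_le F (B : R) : (forall x, Normc.normc (F x) <= B) ->
  Normc.normc (grid_mean F) <= B.
Proof.
move=> HB; rewrite /grid_mean Normc.normcM normc_real ger0_norm ?invr_ge0 ?exprn_ge0 ?ler0n//.
rewrite ler_pdivrMl ?exprn_gt0//; apply: le_trans (normc_sum _ _ _) _.
apply: le_trans (_ : \sum_(j : J) B <= _); first by apply: ler_sum => j _; exact: HB.
by rewrite sumr_const card_ffun !card_ord -[_ *+ _]mulr_natl natrX.
Qed.

Lemma dftD kappa f g : dft kappa (fun x => f x + g x) = dft kappa f + dft kappa g.
Proof.
by rewrite /dft -grid_meanD; congr grid_mean; apply/funext => x; rewrite mulrDl.
Qed.

Lemma dftZ kappa a f : dft kappa (fun x => a * f x) = a * dft kappa f.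
Proof.
by rewrite /dft -grid_meanZ; congr grid_mean; apply/funext => x; rewrite mulrA.
Qed.

Lemma dft_le kappa f (B : R) : (forall x, Normc.normc (f x) <= B) ->
  Normc.normc (dft kappa f) <= B.
Proof.
by move=> HB; apply: grid_mean_le => x; rewrite Normc.normcM normc_wave mulr1.
Qed.

(** Shifting by one step permutes the grid cyclically, up to the two opposite
    faces of the cube, where the function is asked to vanish. *)
Lemma grid_mean_shift i F :
  (forall x, x 0 i = - L \/ x 0 i = L -> F x = 0) ->
  grid_mean (fun x => F (x + step *: unitv R i)) = grid_mean F.
Proof.
move=> HF; rewrite /grid_mean; congr (_ * _).
pose h j : J := [ffun k => if k == i then ordS (j k) else j k].
have hinj : injective h.
  move=> j j' /ffunP E; apply/ffunP => k; have := E k; rewrite !ffunE.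
  by case: eqP => // _; exact: ordS_inj.
rewrite [RHS](reindex_inj hinj) /=; apply: eq_bigr => j _.
have [lt|ge] := ltnP (j i).+1 M.
  congr F; apply/rowP => k; rewrite !mxE eqxx /= ffunE.
  have [->|ki] := eqVneq k i; last by rewrite mulr0 addr0.
  by rewrite /= modn_small// mulr1 -addrA -[in RHS]natr1 mulrDr mulr1.
have E : (j i).+1 = M by apply/eqP; rewrite eqn_leq ge andbT.
rewrite !HF//; [left|right]; rewrite !mxE ?ffunE ?eqxx /=.
  by rewrite E modnn mulr0 addr0.
rewrite -addrA mulr1 -{2}[step]mulr1 -mulrDr natr1 E stepM; ring.
Qed.

End Grid.

Section DiscreteFourier.
Variables (R : realType) (d : nat) (L : R) (Q : nat).
Hypotheses (L0 : 0 < L) (Q0 : (0 < Q)%N).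
Local Notation V := 'rV[R]_d.
Local Notation M := (Q.*2).
Local Notation J := {ffun 'I_d -> 'I_M}.
Local Notation delta := (step L Q).
Local Notation dftLQ := (dft L Q).
Implicit Types (f g F : V -> R[i]) (x y v kappa : V) (i : 'I_d) (j p : J).

Let Qr0 : 0 < Q%:R :> R. Proof. by rewrite ltr0n. Qed.
Let Mr0 : 0 < M%:R :> R. Proof. by rewrite ltr0n double_gt0. Qed.
Let ME : M%:R = 2 * Q%:R :> R. Proof. by rewrite -muln2 natrM mulrC. Qed.
Let d0 : 0 < delta. Proof. exact: step_gt0. Qed.

Definition vanish i (b : R) f : Prop := forall x, (x 0 i <= b) \/ (L <= x 0 i) -> f x = 0.

(** A difference enlarges the support by one step on the left. The iterated
    differences used below still vanish on the faces of the cube, provided that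
    the support keeps a margin and the step is small. *)
Lemma vanish_fdiff i b f : vanish i b f -> vanish i (b - delta) (fdiff delta i f).
Proof.
move=> vf x H; rewrite /fdiff !vf ?subrr//.
  by case: H => H; [left; apply: le_trans H _; rewrite gerBl ltW|right].
rewrite mxE [X in _ + X]mxE unitvE eqxx mulr1; case: H => H; [left; lra|right].
by apply: le_trans H _; rewrite lerDl ltW.
Qed.

(** Summation by parts. *)
Lemma dft_fdiff kappa i f : vanish i (- L) f ->
  dftLQ kappa (fdiff delta i f) = (expi (kappa 0 i * delta) - 1) * dftLQ kappa f.
Proof.
move=> vf; pose F x := f x * wave (- kappa) x.
have HF : grid_mean L Q (fun x => F (x + delta *: unitv R i)) = grid_mean L Q F.
  apply: grid_mean_shift => // x H.
  by rewrite /F (vf x) ?mul0r//; case: H => ->; [left|right].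
rewrite mulrBl mul1r -[dftLQ kappa f]/(grid_mean L Q F) -{1}HF -grid_meanZ -mulN1r -grid_meanZ -grid_meanD.
congr grid_mean; apply/funext => x; rewrite /F /fdiff /wave dotvDl dotvZl dotv_unitv mxE expiD.
rewrite (_ : delta * - kappa 0 i = - (kappa 0 i * delta)); last by ring.
rewrite mulrBl mulN1r; congr (_ - _).
by rewrite !mulrA [_ * f _]mulrC -!mulrA; congr (_ * _); rewrite mulrCA [X in _ = _ * X]mulrC expiN mulr1.
Qed.

Lemma dft_iter_fdiff kappa i f n : vanish i (- L + n%:R * delta) f ->
  dftLQ kappa (iter n (fdiff delta i) f) = (expi (kappa 0 i * delta) - 1) ^+ n * dftLQ kappa f.
Proof.
elim: n f => [|n IH] f vf; first by rewrite expr0 mul1r.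
have le0 : (- L <= - L + n.+1%:R * delta) by rewrite lerDl mulr_ge0// ltW.
rewrite iterSr IH; last first.
  have := vanish_fdiff vf; congr (vanish i _ _).
  by rewrite -natr1; ring.
rewrite dft_fdiff ?exprSr ?mulrA//.
by move=> x [H|H]; apply: vf; [left; exact: le_trans H le0|right].
Qed.

Lemma freq_step p i : freq L p 0 i * delta = ((p i)%:R - Q%:R) / M%:R.
Proof. by rewrite mxE /step ME; field; rewrite !gt_eqF. Qed.

Lemma freq_step_le p i : `|freq L p 0 i * delta| <= 1 / 2.
Proof.
rewrite freq_step normrM [`|_^-1|]gtr0_norm ?invr_gt0// ler_pdivrMr// ME ler_norml.
have h : (p i)%:R <= M%:R :> R by rewrite ler_nat ltnW.
have h0 : 0 <= (p i)%:R :> R by [].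
by move: h; rewrite ME => h; apply/andP; split; lra.
Qed.

(** The constant is independent of Q: the step cancels between the n-th difference,
    of size step^n, and the n-th power of the multiplier, which is at least
    (|kappa_i| step)^n. *)
Lemma dft_decay_coord p i f n (B : R) : smooth setT f ->
  vanish i (- L + n%:R * delta) f ->
  (forall x, Normc.normc (iter n (partial i) f x) <= B) ->
  `|freq L p 0 i| ^+ n * Normc.normc (dftLQ (freq L p) f) <= 2 ^+ n * B.
Proof.
move=> sf vf HB; set k := freq L p.
have H := dft_le L Q0 k (iter_fdiff_le (ltW d0) sf HB).
rewrite dft_iter_fdiff// Normc.normcM normcX in H.
have H2 := expi_sub1_ge (freq_step_le p i); rewrite -/k normrM (gtr0_norm d0) in H2.
have H3 : (`|k 0 i| * delta) ^+ n <= Normc.normc (expi (k 0 i * delta) - 1) ^+ n.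
  by rewrite lerXn2r ?nnegrE ?normc_ge0// mulr_ge0// ltW.
have := le_trans (ler_wpM2r (normc_ge0 (dftLQ k f)) H3) H.
rewrite [(_ * delta) ^+ n]exprMn [(2 * delta) ^+ n]exprMn [2 ^+ n * delta ^+ n]mulrC [`|_| ^+ n * _]mulrC -!mulrA.
by rewrite ler_pM2l// exprn_gt0.
Qed.

Lemma norm_attained x : x != 0 -> exists i, `|x| = `|x 0 i|.
Proof.
move=> x0; have : mx_norm x != 0 by apply: contra x0 => /eqP/mx_norm_eq0 ->.
by move=> /mx_norm_neq0[[a i] E]; exists i; rewrite (ord1 a) in E; exact: E.
Qed.

Lemma dft_decay p f n (B : R) : smooth setT f -> freq L p != 0 ->
  (forall i, vanish i (- L + n%:R * delta) f) ->
  (forall i x, Normc.normc (iter n (partial i) f x) <= B) ->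
  `|freq L p| ^+ n * Normc.normc (dftLQ (freq L p) f) <= 2 ^+ n * B.
Proof.
by move=> sf /norm_attained[i ->] vf HB; apply: dft_decay_coord.
Qed.

Lemma expi_eq1 (t : R) : `|t| < 1 -> expi t = 1 -> t = 0.
Proof.
suff H (s : R) : 0 <= s -> s < 1 -> expi s = 1 -> s = 0.
  move=> t1 E; case: (ger0P t) t1 => t0 t1; first exact: H.
  apply/eqP; rewrite -oppr_eq0; apply/eqP; apply: H => //; first by rewrite oppr_ge0 ltW.
  by have := expiN t; rewrite E mulr1.
move=> s0 s1 E; have [le|gt] := leP s (1/2).
  have := @expi_sub1_ge R s; rewrite ger0_norm// E subrr Normc.normc0 => /(_ le) h.
  by apply/eqP; rewrite eq_le s0 h.
have E2 : expi (s - 1) = 1.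
  have := expiD (s - 1) 1; rewrite subrK expi1 mulr1 => <-; exact: E.
have := @expi_sub1_ge R (s - 1); rewrite ltr0_norm ?subr_lt0// E2 subrr Normc.normc0.
have h : - (s - 1) <= 1 / 2 by lra.
move=> /(_ h) h2; lra.
Qed.

(** A geometric sum of a (2Q)-th root of unity, which is 1 only for a = b. *)
Lemma sum_expi (a b : 'I_M) :
  \sum_(q < M) expi (((b : nat)%:R - (a : nat)%:R) * (((q : nat)%:R - Q%:R) / M%:R))
    = (if a == b then M%:R else 0) :> R[i].
Proof.
case: eqP => [->|/eqP ab].
  under eq_bigr do rewrite subrr mul0r expi0.
  by rewrite sumr_const card_ord.
pose t : R := ((b : nat)%:R - (a : nat)%:R) / M%:R.
pose z := expi t.
have zM : z ^+ M = 1.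
  rewrite -expiMn /t divfK ?gt_eqF//; have := expiD ((b : nat)%:R - (a : nat)%:R) ((a : nat)%:R : R).
  by rewrite subrK !expi_nat mulr1.
have z1 : z - 1 != 0.
  rewrite subr_eq0; apply/eqP => /expi_eq1 E.
  have /E /eqP : `|t| < 1.
    rewrite /t normrM [`|_^-1|]gtr0_norm ?invr_gt0// ltr_pdivrMr// mul1r.
    have h1 : (b : nat)%:R < M%:R :> R by rewrite ltr_nat.
    have h2 : (a : nat)%:R < M%:R :> R by rewrite ltr_nat.
    have h3 : 0 <= (b : nat)%:R :> R by [].
    have h4 : 0 <= (a : nat)%:R :> R by [].
    by rewrite ltr_norml; apply/andP; split; lra.
  rewrite mulf_eq0 invr_eq0 [M%:R == _]gt_eqF// orbF subr_eq0 eqr_nat => /eqP ba.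
  by move/eqP: ab; apply; apply: val_inj.
under eq_bigr => q _.
  rewrite (_ : _ * _ = - (t * Q%:R) + t * q%:R); last by rewrite /t; field; rewrite gt_eqF.
  rewrite expiD expiMn; over.
rewrite -mulr_sumr -/z.
suff -> : \sum_(q < M) z ^+ q = 0 by rewrite mulr0.
by apply: (mulfI z1); rewrite -subrX1 zM subrr mulr0.
Qed.

(** Orthogonality: the sum over frequencies factors into geometric sums, one for each
    coordinate. *)
Lemma fourier_inversion f (l : J) :
  f (grid L l) = \sum_(p : J) dftLQ (freq L p) f * wave (freq L p) (grid L l).
Proof.
have waveE x kappa : wave kappa x = \prod_(i < d) expi (x 0 i * kappa 0 i).
  by rewrite /wave /dotv (big_morph _ (@expiD R) (expi0 R)).
have ort j : \sum_(p : J) wave (- freq L p) (grid L j) * wave (freq L p) (grid L l)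
   = if j == l then (M%:R ^+ d)%:C else 0.
  transitivity (\sum_(p : J) \prod_(i < d)
     expi (((l i : nat)%:R - (j i : nat)%:R) * (((p i : nat)%:R - Q%:R) / M%:R)) : R[i]).
    apply: eq_bigr => p _; rewrite !waveE -big_split; apply: eq_bigr => i _ /=.
    rewrite -expiD; congr expi; rewrite !mxE /step ME; field; by rewrite !gt_eqF.
  rewrite -(bigA_distr_bigA (fun (i : 'I_d) (q : 'I_M) => expi (((l i : nat)%:R - (j i : nat)%:R) * (((q : nat)%:R - Q%:R) / M%:R)) : R[i])).
  under eq_bigr do rewrite sum_expi.
  case: eqP => [->|jl].
    under eq_bigr do rewrite eqxx.
    by rewrite prodr_const card_ord rmorphXn /= rmorph_nat.
  have [i ji] : exists i, j i != l i.
    apply/existsP; apply: contra_notT jl => /existsPn H.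
    by apply/ffunP => i; have := H i; rewrite negbK => /eqP.
  by rewrite (bigD1 i)//= (negbTE ji) mul0r.
rewrite /dft /grid_mean.
transitivity (((M%:R ^+ d)^-1)%:C * \sum_(j : J) f (grid L j) *
   (\sum_(p : J) wave (- freq L p) (grid L j) * wave (freq L p) (grid L l))).
  under eq_bigr do rewrite ort.
  rewrite (bigD1 l)//= eqxx big1 ?addr0; last by move=> j /negbTE ->; rewrite mulr0.
  rewrite mulrCA -rmorphM /= mulVf ?mulr1// expf_eq0 gt_eqF// andbF//.
under eq_bigr do rewrite mulr_sumr.
rewrite exchange_big mulr_sumr; apply: eq_bigr => p _ /=.
by rewrite -mulrA mulr_suml; congr (_ * _); apply: eq_bigr => j _; rewrite mulrA.
Qed.

End DiscreteFourier.

(** * Trigonometric approximation of functions and their derivatives *)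

Section LatticeWeights.
Variable R : realType.

(** Telescoping: increasing Q by one adds the terms at -(Q+1) and at Q, together
    less than the increase of 5 - 5/(Q+1). The integers are centred at Q because the
    frequencies are. *)
Lemma sum_lattice_weight Q :
  \sum_(q < Q.*2) (1 + ((q : nat)%:R - Q%:R) ^+ 2)^-1 <= 5 :> R.
Proof.
suff H : \sum_(q < Q.*2) (1 + ((q : nat)%:R - Q%:R) ^+ 2)^-1 <= 5 - 5 / Q.+1%:R :> R.
  by apply: le_trans H _; rewrite gerBl divr_ge0.
elim: Q => [|Q IH]; first by rewrite big_ord0 divr1 subrr.
rewrite doubleS big_ord_recl big_ord_recr /=.
have E : \sum_(q < Q.*2) (1 + ((bump 0 (q : nat))%:R - Q.+1%:R) ^+ 2)^-1
   = \sum_(q < Q.*2) (1 + ((q : nat)%:R - Q%:R) ^+ 2)^-1 :> R.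
  apply: eq_bigr => q _; congr (_ + _ ^+ 2)^-1.
  by rewrite /bump /= add1n -!natr1; ring.
rewrite E.
set x : R := Q%:R; have x0 : 0 <= x by [].
have a : 1 + (0%:R - Q.+1%:R) ^+ 2 = x ^+ 2 + 2 * x + 2 :> R.
  by rewrite -natr1 -/x; ring.
have b : 1 + ((bump 0 Q.*2)%:R - Q.+1%:R) ^+ 2 = x ^+ 2 + 1 :> R.
  by rewrite /bump /= add1n -!natr1 -muln2 natrM -/x; ring.
rewrite a b; move: IH; rewrite -[Q.+2%:R]natr1 -[Q.+1%:R]natr1 -/x => IH.
have p0 : 0 < x ^+ 2 + 2 * x + 2 by nra.
have p1 : 0 < x ^+ 2 + 1 by nra.
have p2 : 0 < x + 1 by lra.
have p3 : 0 < x + 1 + 1 by lra.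
have h1 : (x ^+ 2 + 2 * x + 2)^-1 <= (3 / 2) / ((x + 1) * (x + 1 + 1)).
  rewrite ler_pdivlMr ?mulr_gt0// ler_pdivrMl//; nra.
have h2 : (x ^+ 2 + 1)^-1 <= (7 / 2) / ((x + 1) * (x + 1 + 1)).
  rewrite ler_pdivlMr ?mulr_gt0// ler_pdivrMl//.
  have := sqr_ge0 (x - 3 / 5); nra.
have h3 : 5 / ((x + 1) * (x + 1 + 1)) = 5 / (x + 1) - 5 / (x + 1 + 1).
  by field; rewrite !gt_eqF.
have h4 : (3 / 2) / ((x + 1) * (x + 1 + 1)) + (7 / 2) / ((x + 1) * (x + 1 + 1)) <= 5 / ((x + 1) * (x + 1 + 1)).
  by rewrite -mulrDl ler_wpM2r ?invr_ge0 ?mulr_ge0//; lra.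
apply: le_trans (lerD h1 (lerD IH h2)) _.
move: h3 h4; set u := _ / (_ * _); set v := _ / (_ * _); set w := _ / (_ * _).
set y := _ / (x + 1); set z := _ / _; lra.
Qed.

Lemma sqr_2pi_le : (2 * pi) ^+ 2 <= 64 :> R.
Proof.
have := pihalf_lt2 R; have := pi_gt0 R => p0; rewrite ltr_pdivrMr// => p1.
by rewrite expr2; nra.
Qed.

End LatticeWeights.

Section FourierTails.
Variables (R : realType) (d : nat) (L L' : R).
Hypotheses (L'0 : 0 < L') (LL : L' < L).
Local Notation V := 'rV[R]_d.
Implicit Types (f g F : V -> R[i]) (x y v kappa : V) (i : 'I_d).

Let L0 : 0 < L. Proof. exact: lt_trans LL. Qed.

(** Summable over the dual grid uniformly in Q. Comparing powers of the frequency
    with it replaces counting lattice points. *)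
Definition weight Q (p : {ffun 'I_d -> 'I_(Q.*2)}) : R :=
  \prod_(i < d) (1 + ((p i : nat)%:R - Q%:R) ^+ 2)^-1.

Lemma sum_weight Q : \sum_(p : {ffun 'I_d -> 'I_(Q.*2)}) weight p <= 5 ^+ d.
Proof.
rewrite /weight -(bigA_distr_bigA (fun (i : 'I_d) (q : 'I_(Q.*2)) => (1 + ((q : nat)%:R - Q%:R) ^+ 2)^-1 : R)).
rewrite -[X in _ ^+ X](card_ord d) -prodr_const; apply: ler_prod => i _.
rewrite sum_lattice_weight andbT; apply: sumr_ge0 => q _.
by rewrite invr_ge0 addr_ge0 ?sqr_ge0.
Qed.

Lemma weight_ge0 Q (p : {ffun 'I_d -> 'I_(Q.*2)}) : 0 <= weight p.
Proof. by apply: prodr_ge0 => i _; rewrite invr_ge0 addr_ge0 ?sqr_ge0. Qed.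

(** (p_i - Q)^2 is 4 L^2 times the square of the i-th frequency. *)
Lemma weight_lower Q (p : {ffun 'I_d -> 'I_(Q.*2)}) (A : R) : 0 <= A ->
  1 + 4 * L ^+ 2 * `|freq L p| ^+ 2 <= A -> 1 <= A ^+ d * weight p.
Proof.
move=> A0 HA; rewrite /weight -[X in _ ^+ X](card_ord d) -prodr_const -big_split /=.
have E1 : \prod_(i < d) (1 : R) = 1 by rewrite big1.
rewrite -{1}E1.
apply: ler_prod => i _; rewrite ler01 /=.
have p0 : 0 < 1 + ((p i : nat)%:R - Q%:R) ^+ 2 :> R by rewrite ltr_wpDr ?sqr_ge0.
rewrite ler_pdivlMr// mul1r; apply: le_trans HA; rewrite lerD2l.
have -> : (p i : nat)%:R - Q%:R = 2 * L * freq L p 0 i.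
  by rewrite mxE; field; rewrite gt_eqF.
rewrite !exprMn (_ : 2 ^+ 2 = 4 :> R); last by ring.
apply: ler_wpM2l; first by rewrite mulr_ge0 ?sqr_ge0.
by rewrite -(real_normK (num_real (freq L p 0 i))) lerXn2r ?nnegrE// coord_le_norm.
Qed.

Definition ball_supported (r : R) f : Prop := forall x, r < `|x| -> f x = 0.

Lemma open_norm_gt (r : R) : open [set x : V | r < `|x|].
Proof.
rewrite (_ : [set x : V | _] = ~` [set x : V | `|x| <= r]).
  by apply: closed_openC; exact: closed_norm_le.
by apply/seteqP; split => x /=; rewrite ltNge => /negP.
Qed.

Lemma ball_supported_dseq r f s : smooth setT f -> ball_supported r f ->
  ball_supported r (dseq s f).
Proof.
move=> sf bf x rx; rewrite -[RHS](dseq0 s x).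
have sf' : smooth [set y : V | r < `|y|] f by exact: smooth_sub sf.
exact: (@dseq_eq R d _ f (fun=> 0) s x (@open_norm_gt r) bf sf' rx).
Qed.

Lemma ball_supported_dbound r f n : smooth setT f -> ball_supported r f ->
  exists2 B : R, 0 <= B & dbound setT n f B.
Proof.
move=> sf bf.
have [B B0 HB] := smooth_dbound n (@compact_norm_le R d r) (@subsetT _ _) sf.
exists B => // s x sn _; have [xr|rx] := leP `|x| r; first exact: HB.
by rewrite (ball_supported_dseq s sf bf rx) Normc.normc0.
Qed.

Lemma ball_supported_vanish f n Q i : ball_supported L' f ->
  n%:R * step L Q < L - L' -> vanish L i (- L + n%:R * step L Q) f.
Proof.
move=> bf; move: L'0 LL; set t := _ * _ => l0 l1 H x [xi|xi]; apply: bf;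
  apply: lt_le_trans (coord_le_norm x i); set z := x 0 i in xi *.
  by rewrite ltr0_norm; lra.
by rewrite ger0_norm; lra.
Qed.

(** Of the q + 2d powers of the frequency given by decay, q are bounded by means of
    lam, and 2d make the bound summable. *)
Lemma dft_weight Q (p : {ffun 'I_d -> 'I_(Q.*2)}) f q (B lam0 lam : R) : (0 < Q)%N ->
  0 < lam0 -> lam0 <= lam -> lam < `|freq L p| -> 0 <= B ->
  smooth setT f -> ball_supported L' f ->
  (q + d.*2)%:R * step L Q < L - L' ->
  (forall i x, Normc.normc (iter (q + d.*2) (partial i) f x) <= B) ->
  Normc.normc (dft L Q (freq L p) f) <=
    2 ^+ (q + d.*2) * B * (lam0 ^- 2 + 4 * L ^+ 2) ^+ d / lam ^+ q * weight p.
Proof.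
move=> Q0 l0 ll lk B0 sf bf HQ HB.
set k := `|freq L p|; set c := Normc.normc _.
have lam1 : 0 < lam by exact: lt_le_trans ll.
have k0 : 0 < k by exact: lt_trans lk.
have c0 : 0 <= c by exact: normc_ge0.
have H : k ^+ (q + d.*2) * c <= 2 ^+ (q + d.*2) * B.
  apply: (dft_decay L0 Q0) => //; first by rewrite -normr_gt0.
  by move=> i; exact: ball_supported_vanish.
set A := lam0 ^- 2 + 4 * L ^+ 2.
have A0 : 0 <= A by rewrite addr_ge0 ?invr_ge0 ?exprn_ge0 ?mulr_ge0 ?sqr_ge0// ltW.
have W1 : 1 <= (A * k ^+ 2) ^+ d * weight p.
  apply: weight_lower; first by rewrite mulr_ge0// exprn_ge0// ltW.
  rewrite -/k /A [leRHS]mulrDl lerD2r mulrC ler_pdivlMr ?exprn_gt0// mul1r.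
  by rewrite lerXn2r ?nnegrE ?(ltW l0) ?(ltW k0)// (le_trans ll)// ltW.
rewrite mulrAC ler_pdivlMr ?exprn_gt0//.
apply: le_trans (_ : k ^+ (q + d.*2) * c * (A ^+ d * weight p) <= _); last first.
  by rewrite -[leRHS]mulrA; apply: ler_wpM2r; first by rewrite mulr_ge0 ?exprn_ge0 ?weight_ge0.
apply: le_trans (_ : c * k ^+ q <= _).
  by rewrite ler_wpM2l// lerXn2r ?nnegrE// ltW.
rewrite -[leLHS]mulr1; apply: le_trans (ler_wpM2l _ W1) _; first by rewrite mulr_ge0// exprn_ge0// ltW.
by rewrite exprMn -exprM mul2n exprD le_eqVlt; apply/orP; left; apply/eqP; ring.
Qed.

(** The transform of a difference quotient is an exact multiple of that of f; compare
    both the quotient and the multiplier with their limits, by Taylor formula. *)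
Lemma dft_partial Q kappa i f (B Lam : R) : (0 < Q)%N -> 0 <= B -> `|kappa| <= Lam ->
  smooth setT f -> ball_supported L' f -> dbound setT 2 f B ->
  Normc.normc (dft L Q kappa (partial i f) - wave_factor kappa i * dft L Q kappa f)
   <= step L Q * (4 * B + 3 * 64 * Lam ^+ 2 * B).
Proof.
move=> Q0 B0 kL sf bf HB; set h := step L Q.
have h0 : 0 < h by exact: step_gt0.
have hn0 : h%:C != 0 :> R[i] by apply/eqP => -[/eqP]; rewrite gt_eqF.
have vf : vanish L i (- L) f.
  by have := @ball_supported_vanish f 0 Q i bf; rewrite mul0r addr0; apply; rewrite subr_gt0.
have E : dft L Q kappa (partial i f) - wave_factor kappa i * dft L Q kappa f
  = - (h^-1)%:C * dft L Q kappa (fun x => f (x + h *: unitv R i) - f x - h%:C * partial i f x)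
    + (h^-1)%:C * ((expi (kappa 0 i * h) - 1 - (0 +i* (2 * pi * (kappa 0 i * h)))) * dft L Q kappa f).
  have -> : dft L Q kappa (fun x => f (x + h *: unitv R i) - f x - h%:C * partial i f x)
      = dft L Q kappa (fdiff h i f) - h%:C * dft L Q kappa (partial i f).
    transitivity (dft L Q kappa (fun x => fdiff h i f x + (- h%:C) * partial i f x)).
      by congr (dft L Q kappa _); apply/funext => x; rewrite mulNr.
    by rewrite dftD dftZ mulNr.
  rewrite (@dft_fdiff R d L Q Q0 kappa i f vf) -/h.
  rewrite (_ : (0 +i* (2 * pi * (kappa 0 i * h))) = h%:C * wave_factor kappa i); last first.
    rewrite /wave_factor; apply/eqP; rewrite eq_complex /=; apply/andP; split; apply/eqP; ring.
  have hV : (h^-1)%:C = (h%:C)^-1 :> R[i] by rewrite fmorphV.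
  by rewrite hV; field.
have hV0 : 0 <= h^-1 by rewrite invr_ge0 ltW.
have T1 : Normc.normc (dft L Q kappa (fun x => f (x + h *: unitv R i) - f x - h%:C * partial i f x))
    <= 4 * B * h ^+ 2.
  apply: dft_le => // x; apply: partial_taylor => //; first exact: ltW.
  by move=> y; exact: (HB [:: i; i]).
have T2 : Normc.normc (dft L Q kappa f) <= B by apply: dft_le => // x; exact: (HB [::]).
have T3 := expi_taylor (kappa 0 i * h).
have T4 : 3 * (2 * pi * (kappa 0 i * h)) ^+ 2 <= 3 * 64 * Lam ^+ 2 * h ^+ 2.
  rewrite (_ : 3 * (2 * pi * (kappa 0 i * h)) ^+ 2
    = 3 * ((2 * pi) ^+ 2 * kappa 0 i ^+ 2 * h ^+ 2)); last by ring.
  rewrite (_ : 3 * 64 * Lam ^+ 2 * h ^+ 2 = 3 * (64 * Lam ^+ 2 * h ^+ 2)); last by ring.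
  apply: ler_wpM2l => //; apply: ler_wpM2r; first exact: sqr_ge0.
  apply: ler_pM; rewrite ?sqr_ge0// ?sqr_2pi_le//.
  rewrite -(real_normK (num_real (kappa 0 i))) lerXn2r ?nnegrE//.
    by apply: le_trans kL; exact: normr_ge0.
  by apply: le_trans kL; exact: coord_le_norm.
rewrite E; move: T1 T2 (le_trans T3 T4).
set e := _ - _ - Complex _ _.
move: (dft _ _ _ _) (dft _ _ _ _) e => X Y e T1 T2 T5.
apply: le_trans (normcD _ _) _.
rewrite mulNr normcN !Normc.normcM normc_real (ger0_norm hV0).
apply: le_trans (_ : h^-1 * (4 * B * h ^+ 2) + h^-1 * ((3 * 64 * Lam ^+ 2 * h ^+ 2) * B) <= _).
  apply: lerD; apply: ler_wpM2l => //.
  by apply: ler_pM => //; exact: normc_ge0.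
rewrite le_eqVlt; apply/orP; left; apply/eqP; field; by rewrite gt_eqF.
Qed.

End FourierTails.

Section TrigApproximation.
Variables (R : realType) (d : nat) (L L' : R).
Hypotheses (L'0 : 0 < L') (LL : L' < L).
Local Notation V := 'rV[R]_d.
Implicit Types (f g F : V -> R[i]) (x y v kappa : V) (i : 'I_d).

Let L0 : 0 < L. Proof. exact: lt_trans LL. Qed.

(** Only finitely many errors of size O(step) accumulate, for frequencies bounded by
    Lam. *)
Lemma dft_dseq f m (Lam : R) : 0 <= Lam -> smooth setT f -> ball_supported L' f ->
  exists2 C : R, 0 <= C & forall s Q kappa, (size s <= m)%N -> (0 < Q)%N -> `|kappa| <= Lam ->
    Normc.normc (dft L Q kappa (dseq s f) - wave_factors kappa s * dft L Q kappa f) <= C / Q%:R.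
Proof.
move=> l0 sf bf; have [B B0 HB] := ball_supported_dbound (m.+2) sf bf.
have {HB} : forall s, (size s <= m)%N -> dbound setT 2 (dseq s f) B.
  by move=> s sm; apply: dbound_dseq; apply: dbound_leq HB; rewrite addn2 !ltnS.
elim: m => [|m IH] HB.
  exists 0 => // s Q kappa; rewrite leqn0 size_eq0 => /eqP -> _ _.
  by rewrite /wave_factors big_nil mul1r subrr Normc.normc0 mul0r.
have [C C0 HC] : exists2 C : R, 0 <= C & forall s Q kappa, (size s <= m)%N -> (0 < Q)%N ->
    `|kappa| <= Lam ->
    Normc.normc (dft L Q kappa (dseq s f) - wave_factors kappa s * dft L Q kappa f) <= C / Q%:R.
  by apply: IH => s sm; apply: HB; exact: leqW.
have p0 : 0 <= 2 * pi * Lam by rewrite !mulr_ge0 ?pi_ge0.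
pose D := L * (4 * B + 3 * 64 * Lam ^+ 2 * B).
have D0 : 0 <= D by rewrite mulr_ge0 ?addr_ge0 ?mulr_ge0 ?sqr_ge0// ltW.
exists (D + 2 * pi * Lam * C) => [|s Q kappa sm Q0 kL]; first by rewrite addr_ge0// mulr_ge0.
have Qr : 0 < Q%:R :> R by rewrite ltr0n.
case: s sm => [_|i s sm].
  by rewrite /wave_factors big_nil mul1r subrr Normc.normc0 divr_ge0// addr_ge0// mulr_ge0.
have -> : wave_factors kappa (i :: s) = wave_factor kappa i * wave_factors kappa s.
  by rewrite /wave_factors big_cons.
have H1 := dft_partial L'0 LL i Q0 B0 kL (smooth_dseq s sf) (ball_supported_dseq s sf bf) (HB s (leqW sm)).
have H2 := HC s Q kappa sm Q0 kL.
have E (a b c e f0 : R[i]) : a - b * c * f0 = (a - b * e) + b * (e - c * f0) by ring.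
rewrite (E _ _ _ (dft L Q kappa (dseq s f))); apply: le_trans (normcD _ _) _.
rewrite Normc.normcM mulrDl; apply: lerD.
  by apply: le_trans H1 _; rewrite /step /D mulrAC.
rewrite -[leRHS]mulrA; apply: ler_pM => //; rewrite ?normc_ge0//.
apply: le_trans (normc_wave_factor _ _) _; rewrite ler_wpM2l// mulr_ge0 ?pi_ge0//.
Qed.

Lemma partial_lipschitz_sum g (B : R) x y : smooth setT g -> 0 <= B ->
  (forall i z, Normc.normc (partial i g z) <= B) ->
  Normc.normc (g x - g y) <= 2 * B * (d%:R * `|x - y|).
Proof.
move=> sg B0 HB; set h := x - y.
have H (r : seq 'I_d) : Normc.normc (g (y + \sum_(i <- r) h 0 i *: unitv R i) - g y)
    <= 2 * B * ((size r)%:R * `|h|).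
  elim: r => [|i r IH]; first by rewrite big_nil addr0 subrr Normc.normc0 !mul0r mulr0.
  rewrite big_cons addrCA addrC -[_ - g y]addr0 -(subrr (g (y + \sum_(i <- r) h 0 i *: unitv R i))).
  set a := g _; set b := g (y + _); rewrite (_ : a - g y + (b - b) = (a - b) + (b - g y)); last by ring.
  apply: le_trans (normcD _ _) _; rewrite (_ : (size (i :: r))%:R = 1 + (size r)%:R); last by rewrite /= -natr1 addrC.
  rewrite [X in _ <= _ * X]mulrDl mul1r [leRHS]mulrDr; apply: lerD => //.
  apply: le_trans (@partial_lipschitz R d i g _ (h 0 i) B sg (HB i)) _.
  by rewrite ler_wpM2l ?coord_le_norm// mulr_ge0.
have := H (enum 'I_d); rewrite size_enum_ord big_enum /=.
by rewrite (_ : y + _ = x)// /unitv -row_sum_delta /h addrC subrK.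
Qed.

Lemma grid_near Q x : (0 < Q)%N -> `|x| <= L' ->
  exists l : {ffun 'I_d -> 'I_(Q.*2)}, `|x - grid L l| <= step L Q.
Proof.
move=> Q0 xL; have h0 : 0 < step L Q by exact: step_gt0.
have t0 i : 0 <= (x 0 i + L) / step L Q.
  rewrite divr_ge0//; last exact: ltW.
  have := le_trans (coord_le_norm x i) xL; rewrite ler_norml => /andP[a _].
  by move: LL => b; lra.
have tM i : (Num.truncn ((x 0 i + L) / step L Q)%R < Q.*2)%N.
  rewrite -(ltr_nat R); apply: le_lt_trans (_ : (x 0 i + L) / step L Q < _).
    by have /andP[] := truncn_itv (t0 i).
  rewrite ltr_pdivrMr// mulrC stepM//.
  have := le_trans (coord_le_norm x i) xL; rewrite ler_norml => /andP[_ a].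
  by move: LL => b; lra.
exists [ffun i => Ordinal (tM i)]; apply: norm_le_coord => [|i]; first exact: ltW.
rewrite mxE [X in _ + X]mxE [X in _ - X]mxE ffunE /=.
have /andP[] := truncn_itv (t0 i).
set n := Num.truncn _; rewrite ler_pdivlMr// ltr_pdivrMr// -natr1 mulrDl mul1r.
rewrite [step L Q * _]mulrC; set w := _ * _ => a b.
by rewrite ler_norml; apply/andP; split; lra.
Qed.

(** The approximation is the part of the discrete Fourier sum with frequencies at most
    lam. At a grid point, the exact inversion formula for a derivative of f shows that
    the error consists of the tail, which decays like lam^-q, and of the discrepancy
    between the transform of the derivative and the multiple of the transform of f.
    The lower bound lam0 on lam lets S and Ct be chosen before lam. The coefficients
    depend on e through the mesh. *)
Theorem trig_approx f (lam0 : R) m : 0 < lam0 -> smooth setT f -> ball_supported L' f ->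
  exists S Ct : R, [/\ 0 <= S, 0 <= Ct &
    forall q (B lam e : R), lam0 <= lam -> 0 <= B -> 0 < e ->
    (forall s i x, (size s <= m)%N ->
        Normc.normc (iter (q + d.*2) (partial i) (dseq s f) x) <= B) ->
    exists (I : finType) (kap : I -> V) (c : I -> R[i]),
      [/\ forall p, `|kap p| <= lam, \sum_p Normc.normc (c p) <= S &
        forall s x, (size s <= m)%N -> `|x| <= L' ->
          Normc.normc (dseq s (fun y => f y - \sum_p c p * wave (kap p) y) x)
            <= Ct * 2 ^+ q * B / lam ^+ q + e]].
Proof.
move=> l0 sf bf.
have [B0 B00 HB0] := ball_supported_dbound (d.*2 + m.+1) sf bf.
pose A := lam0 ^- 2 + 4 * L ^+ 2.
pose A1 := 1 + 4 * L ^+ 2 * lam0 ^+ 2.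
have A_0 : 0 <= A by nonneg.
have A1_0 : 0 <= A1 by nonneg.
pose S := (A1 ^+ d * B0 + 2 ^+ (0 + d.*2) * B0 * A ^+ d / lam0 ^+ 0) * 5 ^+ d.
pose Ct := 2 ^+ d.*2 * A ^+ d * 5 ^+ d.
have T0 : 0 <= 2 ^+ (0 + d.*2) * B0 * A ^+ d / lam0 ^+ 0.
  by nonneg.
have S0 : 0 <= S by nonneg.
exists S, Ct; split=> //; first by nonneg.
move=> q B lam e ll B_0 e0 HB.
have lam_0 : 0 < lam by exact: lt_le_trans ll.
have [C C0 HC] := @dft_dseq f m lam (ltW lam_0) sf bf.
pose A2 := 1 + 4 * L ^+ 2 * lam ^+ 2.
have A2_0 : 0 <= A2 by nonneg.
pose W := Num.max 1 (2 * pi * lam).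
have W1 : 1 <= W by rewrite le_max lexx.
pose B' := B0 + S * W ^+ m.+1.
have B'0 : 0 <= B' by rewrite addr_ge0// mulr_ge0// exprn_ge0// (le_trans ler01 W1).
(* The first inequality keeps q + 2d differences of f supported in the cube; the
   second makes all the discretization errors together at most e. *)
have [Q [Q0 HQ1 HQ2]] : exists Q, [/\ (0 < Q)%N,
    (q + d.*2)%:R * step L Q < L - L' &
    A2 ^+ d * (C / Q%:R) * 5 ^+ d + 2 * B' * (d%:R * step L Q) <= e].
  pose X := (q + d.*2)%:R * L / (L - L') + (A2 ^+ d * C * 5 ^+ d + 2 * B' * (d%:R * L)) / e.
  have X1 : 0 <= (q + d.*2)%:R * L / (L - L').
    by rewrite divr_ge0 ?subr_ge0 ?mulr_ge0// ltW.
  have X2' : 0 <= A2 ^+ d * C * 5 ^+ d + 2 * B' * (d%:R * L).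
    by nonneg.
  have X2 : 0 <= (A2 ^+ d * C * 5 ^+ d + 2 * B' * (d%:R * L)) / e.
    by rewrite divr_ge0// ltW.
  have X0 : 0 <= X by rewrite addr_ge0.
  have HX := archi_boundP X0; set Q := Num.bound X in HX.
  have Qr : 0 < Q%:R :> R by exact: le_lt_trans HX.
  exists Q; split; first by rewrite -(ltr_nat R).
    rewrite /step mulrA ltr_pdivrMr// [_ * Q%:R]mulrC -ltr_pdivrMr ?subr_gt0//.
    by apply: le_lt_trans HX; rewrite lerDl.
  rewrite (_ : _ + _ = (A2 ^+ d * C * 5 ^+ d + 2 * B' * (d%:R * L)) / Q%:R); last first.
    by rewrite /step; field; rewrite gt_eqF.
  rewrite ler_pdivrMr// [e * _]mulrC -ler_pdivrMr//; apply: ltW.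
  by apply: le_lt_trans HX; rewrite lerDr.
have h0 : 0 < step L Q by exact: step_gt0.
pose J := {ffun 'I_d -> 'I_(Q.*2)}.
pose kap (p : J) : V := if `|freq L p| <= lam then freq L p else 0.
pose c (p : J) : R[i] := if `|freq L p| <= lam then dft L Q (freq L p) f else 0.
have kapl p : `|kap p| <= lam by rewrite /kap; case: ifP => // _; rewrite normr0 ltW.
have cS : \sum_p Normc.normc (c p) <= S.
  have cb (p : J) : Normc.normc (c p) <= (A1 ^+ d * B0 + 2 ^+ (0 + d.*2) * B0 * A ^+ d / lam0 ^+ 0) * weight R p.
    have w0 := weight_ge0 R p.
    rewrite /c; case: ifP => _; last first.
      by rewrite Normc.normc0 mulr_ge0// addr_ge0// mulr_ge0// exprn_ge0.
    have [le|gt] := leP `|freq L p| lam0.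
      apply: le_trans (_ : B0 <= _).
        by apply: dft_le => // x; exact: (HB0 [::]).
      rewrite mulrDl; apply: ler_wpDr; first exact: mulr_ge0 T0 w0.
      rewrite mulrAC; apply: ler_peMl => //; apply: (@weight_lower R d L L' L'0 LL) => //.
      rewrite lerD2l; apply: ler_wpM2l; first by nonneg.
      by rewrite lerXn2r ?nnegrE//; exact: ltW.
    apply: le_trans (_ : 2 ^+ (0 + d.*2) * B0 * A ^+ d / lam0 ^+ 0 * weight R p <= _); last first.
      by rewrite ler_wpM2r// lerDr mulr_ge0// exprn_ge0.
    apply: (@dft_weight R d L L' L'0 LL Q p f 0 B0 lam0 lam0) => //.
      apply: le_lt_trans HQ1; rewrite ler_wpM2r ?ler_nat ?leq_add2r//; exact: ltW.
    move=> i x; have := HB0 (nseq (0 + d.*2) i) x.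
    rewrite size_nseq (_ : dseq _ f = iter (0 + d.*2) (partial i) f); last first.
      by elim: (0 + _)%N => //= n ->.
    by apply => //; rewrite add0n leq_addr.
  apply: le_trans (ler_sum _ (fun p _ => cb p)) _.
  rewrite -mulr_sumr ler_wpM2l ?sum_weight//.
  by rewrite addr_ge0// mulr_ge0// exprn_ge0.
exists J, kap, c; split=> // s x sm xL.
pose T y := \sum_p c p * wave (kap p) y.
have sw p : smooth setT (wave (kap p)) by exact: (smooth_wave _ openT).
have scw p : smooth setT (fun y => c p * wave (kap p) y).
  exact: (smoothZ _ openT (sw p)).
have sT : smooth setT T by exact: (smooth_sum _ openT scw).
have sNT : smooth setT (fun y => -1 * T y) by exact: (smoothZ _ openT sT).
have TE t y : dseq t T y = \sum_p c p * (wave_factors (kap p) t * wave (kap p) y).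
  rewrite (@dseq_sum R d setT J _ _ t y openT scw I).
  apply: eq_bigr => p _; rewrite (@dseqZ R d setT (c p) _ t y openT (sw p) I).
  by rewrite dseq_wave.
pose r y := f y - T y.
have rE : r = fun y => f y + -1 * T y by apply/funext => y; rewrite mulN1r.
have sr : smooth setT r by rewrite rE; exact: (smoothD openT sf sNT).
have drE t y : dseq t r y = dseq t f y - dseq t T y.
  rewrite rE (@dseqD R d setT f _ t y openT sf sNT I) (@dseqZ R d setT _ T t y openT sT I).
  by rewrite mulN1r.
have rgrid (l : J) : Normc.normc (dseq s r (grid L l)) <=
   Ct * 2 ^+ q * B / lam ^+ q + A2 ^+ d * (C / Q%:R) * 5 ^+ d.
  rewrite drE TE (fourier_inversion L0 Q0) -sumrB.
  pose D := 2 ^+ (q + d.*2) * B * A ^+ d / lam ^+ q + A2 ^+ d * (C / Q%:R).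
  have D0 : 0 <= D.
    by nonneg.
  have pb (p : J) : Normc.normc (dft L Q (freq L p) (dseq s f) * wave (freq L p) (grid L l)
       - c p * (wave_factors (kap p) s * wave (kap p) (grid L l))) <= D * weight R p.
    have w0 := weight_ge0 R p.
    rewrite /c /kap; case: ifPn => [le|]; last rewrite -ltNge => gt.
      rewrite mulrA [dft _ _ _ f * _]mulrC -mulrBl Normc.normcM normc_wave mulr1.
      apply: le_trans (HC s Q _ sm Q0 le) _.
      rewrite /D mulrDl; apply: ler_wpDl; first by nonneg.
      rewrite mulrAC; apply: ler_peMl; first by nonneg.
      apply: (@weight_lower R d L L' L'0 LL) => //; rewrite lerD2l; apply: ler_wpM2l; first by nonneg.
      by rewrite lerXn2r ?nnegrE//; exact: ltW.
    rewrite mul0r subr0 Normc.normcM normc_wave mulr1.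
    apply: le_trans (_ : 2 ^+ (q + d.*2) * B * A ^+ d / lam ^+ q * weight R p <= _); last first.
      by rewrite ler_wpM2r// lerDl mulr_ge0 ?exprn_ge0// divr_ge0.
    apply: (@dft_weight R d L L' L'0 LL Q p (dseq s f) q B lam0 lam Q0 l0 ll gt B_0
      (smooth_dseq s sf) (ball_supported_dseq s sf bf) HQ1) => i y.
    exact: HB.
  apply: le_trans (normc_sum _ _ _) _; apply: le_trans (ler_sum _ (fun p _ => pb p)) _.
  rewrite -mulr_sumr; apply: le_trans (ler_wpM2l D0 (sum_weight _ _ _)) _.
  by rewrite /D mulrDl lerD2r /Ct exprD le_eqVlt; apply/orP; left; apply/eqP; ring.
have [l xl] := grid_near Q0 xL.
have rB i y : Normc.normc (partial i (dseq s r) y) <= B'.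
  rewrite -[partial i _]/(dseq (i :: s) r) drE TE; apply: le_trans (normcB _ _) _.
  apply: lerD; first by apply: HB0 => //=; rewrite -[X in (X <= _)%N]add0n leq_add.
  apply: le_trans (normc_sum _ _ _) _.
  apply: le_trans (_ : \sum_p Normc.normc (c p) * W ^+ m.+1 <= _); last first.
    by rewrite -mulr_suml ler_wpM2r// exprn_ge0// (le_trans ler01).
  apply: ler_sum => p _; rewrite Normc.normcM ler_wpM2l ?normc_ge0//.
  rewrite -dseq_wave; apply: (@dbound_wave R d setT m.+1 (kap p) W) => //.
  rewrite le_max; apply/orP; right; rewrite ler_wpM2l// mulr_ge0 ?pi_ge0//.
rewrite -/(r) (_ : dseq s _ x = (dseq s r x - dseq s r (grid L l)) + dseq s r (grid L l)); last first.
  by rewrite subrK.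
apply: le_trans (normcD _ _) _; rewrite addrC.
apply: le_trans (lerD (rgrid l) (partial_lipschitz_sum x (grid L l) (smooth_dseq s sr) B'0 rB)) _.
rewrite -addrA lerD2l; apply: le_trans HQ2; rewrite lerD2l ler_wpM2l ?mulr_ge0//.
by rewrite ler_wpM2l.
Qed.

End TrigApproximation.

(** * Gevrey cutoff functions *)

Section FlatFunctions.
Variable R : realType.
Implicit Types (t : R) (k n : nat).

(** The powers of 1/t make the family closed under differentiation up to linear
    combinations. *)
Definition flat k t : R := if 0 < t then t ^- k * expR (- t^-1) else 0.

Lemma flat_ge0 k t : 0 <= flat k t.
Proof.
rewrite /flat; case: ifP => // t0; apply: mulr_ge0; last exact: expR_ge0.
by rewrite invr_ge0 exprn_ge0// ltW.
Qed.

(** y^k e^(-y) is at most k! for y = 1/t, from the exponential series. *)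
Lemma flat_le k t : flat k t <= k`!%:R.
Proof.
rewrite /flat; case: ifP => // t0.
have y0 : 0 <= t^-1 by rewrite invr_ge0 ltW.
rewrite expRN ler_pdivrMr ?expR_gt0// -exprVn.
have kf : 0 < k`!%:R :> R by rewrite ltr0n fact_gt0.
case: k kf => [|k] kf.
  by rewrite expr0 mul1r; apply: le_trans (expR_ge1Dx _); rewrite lerDl.
rewrite -ler_pdivrMl// mulrC; apply: le_trans (expR_ge1Dxn k y0).
by rewrite lerDr.
Qed.

Lemma flat_shift k t : flat k t = t * flat k.+1 t.
Proof.
rewrite /flat; case: ifPn => t0; last by rewrite mulr0.
by rewrite exprS invfM !mulrA mulfV ?mul1r// gt_eqF.
Qed.

(** At t = 0 the difference quotient is t times a bounded function, by flat_shift.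
    Since flat functions are mapped to combinations of flat functions, no
    polynomial in 1/t has to be followed through the successive derivatives. *)
Lemma is_derive_flat k t : is_derive t (1 : R) (flat k) (flat k.+2 t - k%:R * flat k.+1 t).
Proof.
have [t0|t0|->] := ltgtP t 0.
- have D0 : flat k.+2 t - k%:R * flat k.+1 t = 0 by rewrite /flat ltNge (ltW t0) /= mulr0 subr0.
  rewrite D0.
  apply: (@near_eq_is_derive _ _ _ (fun=> 0)).
    near=> s; rewrite /flat ltNge ltW//.
    by near: s; exact: lt_nbhsl.
- have tn0 : t != 0 by rewrite gt_eqF.
  have tk : t ^+ k != 0 by rewrite expf_neq0.
  have D1 : is_derive t (1 : R) (fun s : R => (s ^+ k)^-1) (- (t ^+ k) ^- 2 *: (k%:R * t ^+ k.-1)).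
    have H : is_derive t (1 : R) (fun s : R => s ^+ k) (k%:R * t ^+ k.-1).
      by apply: DeriveDef; [exact: exprn_derivable|rewrite exp_derive /GRing.scale /= mulr1].
    exact: (@is_deriveV R (fun s : R => s ^+ k) t _ 1 tk H).
  have D2 : is_derive t (1 : R) (fun s : R => - s^-1) (t ^- 2).
    have H := @is_deriveV R id t 1 1 tn0 (is_derive_id _ _).
    by apply: (is_derive_eq (is_deriveN H)); rewrite /GRing.scale /= mulr1 opprK.
  have D3 := @is_derive1_comp R expR _ t _ _ (is_derive_expR (- t^-1)) D2.
  have near_flat : \forall s \near t, (fun s : R => (s ^+ k)^-1 * expR (- s^-1)) s = flat k s.
    near=> s; rewrite /flat; have -> // : 0 < s.
    by near: s; exact: lt_nbhsr.
  apply: (near_eq_is_derive near_flat).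
  apply: (is_derive_eq (is_deriveM D1 D3)).
  rewrite /flat t0 /GRing.scale /= !exprS.
  case: k tk {D1 D3 near_flat} => [|k] tk /=.
    by rewrite !expr0; field.
  by rewrite !exprS; field; rewrite tn0 expf_neq0.
have D0 : flat k.+2 0 - k%:R * flat k.+1 0 = 0 by rewrite /flat ltxx mulr0 subr0.
rewrite D0; have f0 : flat k 0 = 0 by rewrite /flat ltxx.
have lim0 : (fun h : R => h^-1 *: ((flat k \o shift 0) (h *: 1) - flat k 0)) @ 0^' --> (0 : R).
  apply/cvgr0Pnorm_lt => e e0; near=> h.
  rewrite /= addr0 f0 subr0 /GRing.scale /= mulr1.
  have hn0 : h != 0 by near: h; exact: nbhs_dnbhs_neq.
  rewrite flat_shift mulrA mulVf// mul1r flat_shift normrM.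
  apply: le_lt_trans (_ : `|h| * k.+2`!%:R < e).
    by rewrite ler_wpM2l// ger0_norm ?flat_le ?flat_ge0.
  rewrite -ltr_pdivlMr ?ltr0n ?fact_gt0//.
  near: h; apply: dnbhs0_lt; rewrite divr_gt0// ltr0n fact_gt0//.
apply: DeriveDef; first by apply/cvg_ex; exists 0.
by apply: cvg_lim => //; exact: Rhausdorff.
Unshelve. all: by end_near.
Qed.

End FlatFunctions.

Section DerivativeChains.
Variable R : realType.
Implicit Types (t a b : R) (k n : nat) (F G : nat -> R -> R).

(** A smooth function of one variable, given with all its derivatives. *)
Definition chain F : Prop := forall n t, is_derive t (1 : R) (F n) (F n.+1 t).

Fixpoint dflat n k : R -> R :=
  if n is m.+1 then fun t => dflat m k.+2 t - k%:R * dflat m k.+1 t else flat k.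

Lemma chain_dflat k : chain (fun n => dflat n k).
Proof.
move=> n; elim: n k => [|n IH] k t; first exact: is_derive_flat.
exact: (is_deriveB (IH k.+2 t) (is_deriveZ k%:R (IH k.+1 t))).
Qed.

(** The recursion doubles the constant at each step, because
    k (k + 1 + 2n)! is at most (k + 2 + 2n)!. *)
Lemma dflat_le n k t : `|dflat n k t| <= 2 ^+ n * (k + n.*2)`!%:R.
Proof.
elim: n k => [|n IH] k.
  by rewrite /= ger0_norm ?flat_ge0// mul1r addn0 flat_le.
rewrite [dflat _ _ _]/= doubleS !addnS; apply: le_trans (ler_normB _ _) _.
rewrite exprS -mulrA mulr2n mulrDl mul1r; apply: lerD.
  by apply: le_trans (IH _) _; rewrite !addSn.
rewrite normrM normr_nat; apply: le_trans (ler_wpM2l _ (IH _)) _ => //.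
rewrite mulrCA ler_wpM2l ?exprn_ge0// -natrM ler_nat addSn factS.
by apply: leq_mul => //; lia.
Qed.

Lemma is_derive_affine a b t : is_derive t (1 : R) (fun s : R => b + a * s) a.
Proof.
have H := is_deriveD (is_derive_cst b t (1 : R)) (is_deriveZ a (is_derive_id t (1 : R))).
by apply: (is_derive_eq H); rewrite add0r [_ *: _]mulr1.
Qed.

Definition reparam a b F n t : R := a ^+ n * F n (b + a * t).

Lemma chain_reparam a b F : chain F -> chain (reparam a b F).
Proof.
move=> cF n t; rewrite /reparam.
have H := @is_derive1_comp R (F n) (fun s => b + a * s) t _ _ (cF n _) (is_derive_affine a b t).
by apply: (is_derive_eq (is_deriveZ (a ^+ n) H)); rewrite /GRing.scale /= exprSr; ring.
Qed.

(** The Leibniz formula as a tree of 2^n products, which avoids binomial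
    coefficients. *)
Fixpoint leibniz n F G : R -> R :=
  if n is m.+1 then fun t => leibniz m (F \o S) G t + leibniz m F (G \o S) t
  else fun t => F 0%N t * G 0%N t.

Lemma chain_leibniz F G : chain F -> chain G -> chain (fun n => leibniz n F G).
Proof.
move=> cF cG n; elim: n F G cF cG => [|n IH] F G cF cG t.
  by apply: (is_derive_eq (is_deriveM (cF 0%N t) (cG 0%N t))); rewrite /GRing.scale /=; ring.
have cF' : chain (F \o S) by move=> k; exact: cF.
have cG' : chain (G \o S) by move=> k; exact: cG.
exact: (is_deriveD (IH _ _ cF' cG t) (IH _ _ cF cG' t)).
Qed.

Lemma leibniz_le n F G t (A B : R) : (forall k, (k <= n)%N -> `|F k t| <= A) ->
  (forall k, (k <= n)%N -> `|G k t| <= B) -> `|leibniz n F G t| <= 2 ^+ n * (A * B).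
Proof.
elim: n F G => [|n IH] F G HF HG.
  by rewrite mul1r /= normrM ler_pM// ?HF ?HG.
rewrite [leibniz _ _ _ _]/= exprS -mulrA mulr2n mulrDl mul1r.
apply: le_trans (ler_normD _ _) _; apply: lerD; apply: IH => k kn.
- exact: HF.
- by apply: HG; exact: leqW.
- by apply: HF; exact: leqW.
- exact: HG.
Qed.

(** The derivatives of t |-> flat 0 t * flat 0 (1 - t), supported in [0, 1]. *)
Definition bump n : R -> R :=
  leibniz n (fun n => dflat n 0) (reparam (-1) 1 (fun n => dflat n 0)).

Lemma chain_bump : chain bump.
Proof. by apply: chain_leibniz; [|apply: chain_reparam]; exact: chain_dflat. Qed.

Definition factorial_bound n : R := 2 ^+ n * (n.*2)`!%:R.

Lemma factorial_bound_ge1 n : 1 <= factorial_bound n.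
Proof. by rewrite -[leLHS]mulr1 ler_pM// ?exprn_ege1 ?ler1n// fact_gt0. Qed.

Lemma factorial_bound_le m n : (m <= n)%N -> factorial_bound m <= factorial_bound n.
Proof.
move=> mn; apply: ler_pM => //; rewrite ?exprn_ge0//; first by rewrite ler_weXn2l// ler1n.
by rewrite ler_nat leq_fact ?leq_double.
Qed.

Lemma factorial_bound_ge0 n : 0 <= factorial_bound n.
Proof. exact: le_trans (factorial_bound_ge1 n). Qed.

Lemma sqr_factorial_bound_le m n : (m <= n)%N ->
  2 ^+ m * (factorial_bound m * factorial_bound m)
    <= 2 ^+ n * (factorial_bound n * factorial_bound n).
Proof.
move=> mn; have fm := factorial_bound_ge0 m; have mn' := factorial_bound_le mn.
apply: ler_pM; [exact: exprn_ge0|exact: mulr_ge0| |exact: ler_pM].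
by rewrite ler_weXn2l// ler1n.
Qed.

Lemma bump_le n t : `|bump n t| <= 2 ^+ n * (factorial_bound n * factorial_bound n).
Proof.
apply: leibniz_le => k kn.
  by apply: le_trans (dflat_le _ _ _) _; exact: factorial_bound_le.
rewrite /reparam normrM normrX normrN1 expr1n mul1r.
by apply: le_trans (dflat_le _ _ _) _; exact: factorial_bound_le.
Qed.

Lemma bumpE t : bump 0 t = flat 0 t * flat 0 (1 - t).
Proof. by rewrite /bump /= /reparam expr0 mul1r mulN1r. Qed.

Lemma bump_ge0 t : 0 <= bump 0 t.
Proof. by rewrite bumpE mulr_ge0 ?flat_ge0. Qed.

Lemma bump_gt0 t : 0 < t -> t < 1 -> 0 < bump 0 t.
Proof.
move=> t0 t1; rewrite bumpE /flat t0 subr_gt0 t1 !expr0 !mulr_gt0 ?expR_gt0 ?invr_gt0//.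
Qed.

Lemma bump_out t : t <= 0 \/ 1 <= t -> bump 0 t = 0.
Proof.
by rewrite bumpE => -[H|H]; [rewrite {1}/flat ltNge H mul0r|rewrite {2}/flat subr_gt0 ltNge H mulr0].
Qed.

Lemma chain_continuous F n : chain F -> continuous (F n).
Proof.
move=> cF t; apply/differentiable_continuous/derivable1_diffP.
by have := cF n t; exact: @ex_derive.
Qed.

(** The vanishing of g on t <= 0 makes the integral from -1 a primitive on the whole
    line: to the left of 0 the integral is 0. *)
Lemma antiderivative (g : R -> R) : continuous g -> (forall t, t <= 0 -> g t = 0) ->
  exists G : R -> R, forall t, is_derive t (1 : R) G (g t).
Proof.
move=> cg g0.
pose G x := (\int[@lebesgue_measure R]_(t in [set` `[(-1 : R), x]]) g t)%R.
exists G => t.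
have [tn|tp] := ltP t 0.
  rewrite g0; last exact: ltW.
  have nG : \forall s \near t, (fun=> 0 : R) s = G s.
    near=> s; have s0 : s < 0 by near: s; exact: lt_nbhsl.
    rewrite /G (@eq_Rintegral _ _ _ _ _ (cst 0)).
      by rewrite Rintegral_cst//= mul0r.
    by move=> x; rewrite inE/= in_itv/= => /andP[_ xs]; rewrite g0// (le_trans xs)// ltW.
  apply: (near_eq_is_derive nG); exact: is_derive_cst.
have t1 : t < t + 1 by rewrite ltrDl.
have tm1 : -1 < t by apply: lt_le_trans tp; rewrite ltrN10.
have ig : (@lebesgue_measure R).-integrable `[(-1 : R), t + 1] (EFin \o g).
  apply: continuous_compact_integrable; first exact: segment_compact.
  exact: continuous_subspaceT.
have [H1 H2] := continuous_FTC1_closed t1 ig tm1 (cg t).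
by apply: DeriveDef; [exact: H1|rewrite -derive1E; exact: H2].
Unshelve. all: by end_near. Qed.

Lemma constant_of_derive0 (G : R -> R) a b : a <= b ->
  (forall t, a <= t <= b -> is_derive t (1 : R) G 0) -> G b = G a.
Proof.
rewrite le_eqVlt => /predU1P[->//|ab] H.
have ba : 0 < b - a by rewrite subr_gt0.
have [s sab|c _ E] := @mean_value R (fun s => G (a + 1 * s)) (fun=> 0) _ ba.
  apply: (is_derive_eq (@is_derive1_comp R G (fun s => a + 1 * s) s 0 1 _ _)); last by rewrite mul0r.
    by apply: H; rewrite mul1r; move: sab => /andP[s0 s1]; apply/andP; split; lra.
  exact: is_derive_affine.
move: E; rewrite mul0r mulr0 addr0 (_ : a + 1 * (b - a) = b); last by ring.
move=> /eqP.
by rewrite subr_eq0 => /eqP.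
Qed.

(** Primitive of the bump, divided by the integral of the bump, which only enlarges
    the constant. *)
Lemma smooth_step : exists (F : nat -> R -> R) (C : R), [/\ chain F, 1 <= C,
  forall t, t <= 0 -> F 0%N t = 0, forall t, 1 <= t -> F 0%N t = 1 &
  forall n t, `|F n t| <= C * (2 ^+ n * (factorial_bound n * factorial_bound n))].
Proof.
have cb0 := @chain_continuous bump 0 chain_bump.
have bump0 (t : R) : t <= 0 -> bump 0 t = 0 by move=> t0; apply: bump_out; left.
have [G HG] := @antiderivative (bump 0) cb0 bump0.
have Gmono a b : a <= b -> G a <= G b.
  rewrite le_eqVlt => /predU1P[->//|ab]; have ba : 0 < b - a by rewrite subr_gt0.
  have [s _|c _ E] := @mean_value R (fun s => G (a + 1 * s)) (fun s => bump 0 (a + 1 * s)) _ ba.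
    apply: (is_derive_eq (@is_derive1_comp R G (fun s => a + 1 * s) s _ 1 (HG _) _)); last by rewrite mulr1.
    exact: is_derive_affine.
  move: E; rewrite mulr0 addr0 (_ : a + 1 * (b - a) = b); last by ring.
  move=> E.
  by rewrite -subr_ge0 E mulr_ge0 ?bump_ge0// ltW.
have Gl t : t <= 0 -> G t = G 0.
  move=> t0; symmetry; apply: constant_of_derive0 => // s /andP[_ s0].
  by apply: (is_derive_eq (HG s)); apply: bump_out; left.
have Gr t : 1 <= t -> G t = G 1.
  move=> t1; apply: constant_of_derive0 => // s /andP[s1 _].
  by apply: (is_derive_eq (HG s)); apply: bump_out; right.
have c0 : 0 < G 1 - G 0.
  have h : 0 < (3/4 - 1/4 : R) by lra.
  have [s _|c /andP[c0 c1] E] := @mean_value R (fun s => G (1/4 + 1 * s)) (fun s => bump 0 (1/4 + 1 * s)) _ h.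
    apply: (is_derive_eq (@is_derive1_comp R G (fun s => 1/4 + 1 * s) s _ 1 (HG _) _)); last by rewrite mulr1.
    exact: is_derive_affine.
  have p : 0 < G (1/4 + 1 * (3/4 - 1/4)) - G (1/4 + 1 * 0).
    by rewrite E mulr_gt0// bump_gt0//; lra.
  have := @Gmono 0 (1/4 + 1 * 0); have := @Gmono (1/4 + 1 * (3/4 - 1/4)) 1.
  have e1 : 1/4 + 1 * (3/4 - 1/4) <= 1 :> R by lra.
  have e2 : 0 <= 1/4 + 1 * 0 :> R by lra.
  by move=> /(_ e1) u1 /(_ e2) u2; lra.
set c := G 1 - G 0 in c0.
pose F n t := if n is m.+1 then c^-1 * bump m t else c^-1 * (G t - G 0).
exists F, (1 + c^-1); split.
- case=> [|n] t /=.
    apply: (is_derive_eq (is_deriveZ c^-1 (is_deriveB (HG t) (is_derive_cst (G 0) t (1 : R))))).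
    by rewrite subr0.
  exact: (is_deriveZ c^-1 (chain_bump n t)).
- by rewrite lerDl invr_ge0 ltW.
- by move=> t t0; rewrite /F Gl// subrr mulr0.
- by move=> t t1; rewrite /F Gr// mulVf// gt_eqF.
have C1 : 0 <= c^-1 by rewrite invr_ge0 ltW.
have fb n : 1 <= 2 ^+ n * (factorial_bound n * factorial_bound n).
  have := factorial_bound_ge1 n => f1; rewrite -[leLHS]mulr1 ler_pM ?exprn_ege1 ?ler1n//.
  by rewrite -[leLHS]mulr1 ler_pM.
case=> [|n] t; rewrite /F.
  have F01 : 0 <= c^-1 * (G t - G 0) <= 1.
    have g0 : G 0 <= G t.
      by have [t0|/ltW t0] := leP t 0; [rewrite Gl|apply: Gmono].
    have g1 : G t <= G 1.
      by have [t1|/ltW t1] := leP 1 t; [rewrite Gr|apply: Gmono].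
    rewrite mulr_ge0 ?subr_ge0//= mulrC ler_pdivrMr// mul1r lerB//.
  move: F01 => /andP[u v]; rewrite ger0_norm//; apply: le_trans v _.
  by rewrite -[leLHS]mulr1 ler_pM// lerDl.
rewrite normrM (ger0_norm C1) mulrDl ler_wpDl//.
  by rewrite mul1r; apply: le_trans (fb n.+1).
apply: ler_wpM2l => //; apply: le_trans (bump_le n t) _.
exact: sqr_factorial_bound_le.
Qed.

(** Product of an increasing and a decreasing step. *)
Lemma smooth_plateau : exists (F : nat -> R -> R) (C : R), [/\ chain F, 1 <= C,
  forall t, `|t| <= 1 -> F 0%N t = 1, forall t, 2 <= `|t| -> F 0%N t = 0 &
  forall n t, `|F n t| <= C * 8 ^+ n * factorial_bound n ^+ 4].
Proof.
have [F [C [cF C1 F0 F1 HF]]] := smooth_step.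
pose P n := leibniz n (reparam 1 2 F) (reparam (-1) 2 F).
exists P, (C ^+ 2); split.
- by apply: chain_leibniz; exact: chain_reparam.
- by rewrite expr2 -[leLHS]mulr1 ler_pM.
- move=> t; rewrite ler_norml => /andP[t1 t2]; rewrite /P /= /reparam !expr0 !mul1r.
  by rewrite !F1 ?mulr1//; lra.
- move=> t; rewrite ler_normr /P /= /reparam !expr0 !mul1r => /orP[h|h].
    by rewrite (F0 (2 + -1 * t)) ?mulr0//; lra.
  by rewrite (F0 (2 + t)) ?mul0r//; lra.
move=> n t; apply: le_trans (@leibniz_le n _ _ t
   (C * (2 ^+ n * (factorial_bound n * factorial_bound n)))
   (C * (2 ^+ n * (factorial_bound n * factorial_bound n))) _ _) _.
- move=> k kn; rewrite /reparam expr1n mul1r; apply: le_trans (HF _ _) _.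
  by apply: ler_wpM2l; [exact: le_trans C1|exact: sqr_factorial_bound_le].
- move=> k kn; rewrite /reparam normrM normrX normrN1 expr1n mul1r; apply: le_trans (HF _ _) _.
  by apply: ler_wpM2l; [exact: le_trans C1|exact: sqr_factorial_bound_le].
rewrite (_ : 8 ^+ n = 2 ^+ n * 2 ^+ n * 2 ^+ n); last by rewrite -!exprMn; congr (_ ^+ _); ring.
by rewrite le_eqVlt; apply/orP; left; apply/eqP; ring.
Qed.

End DerivativeChains.

Section Cutoffs.
Variables (R : realType) (d : nat).
Local Notation V := 'rV[R]_d.
Implicit Types (x : V) (i j : 'I_d) (F : nat -> R -> R) (n : nat).

Definition coord_fun F i : V -> R[i] := fun x => (F 0%N (x 0 i))%:C.

Lemma has_partial_coord_fun F i j x : chain F ->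
  has_partial j (coord_fun F i) x (if j == i then coord_fun (F \o S) i x else 0).
Proof.
move=> cF.
have E (s : R) : (x + s *: unitv R j) 0 i = x 0 i + (j == i)%:R * s.
  by rewrite mxE [X in _ + X]mxE unitvE mulrC.
split; last first.
  have -> : complex.Im (if j == i then coord_fun (F \o S) i x else 0) = 0 by case: ifP.
  exact: is_derive_cst.
rewrite -[x in is_derive x]addr0 -(scale0r (unitv R j)); apply/is_derive_lineE.
rewrite (_ : (fun s : R => _) = fun s : R => F 0%N (x 0 i + (j == i)%:R * s)); last first.
  by apply/funext => s; rewrite /coord_fun E.
apply: (is_derive_eq (@is_derive1_comp R (F 0%N) (fun s : R => x 0 i + (j == i)%:R * s) 0 _ _
  (cF 0%N _) (is_derive_affine (j == i)%:R (x 0 i) 0))).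
by rewrite mulr0 addr0; case: eqP => _; rewrite /= ?mulr1 ?mulr0.
Qed.

Lemma partial_coord_fun F i j : chain F ->
  partial j (coord_fun F i) = if j == i then coord_fun (F \o S) i else fun=> 0.
Proof.
move=> cF; apply/funext => x; rewrite (has_partialE (has_partial_coord_fun i j x cF)).
by case: ifP.
Qed.

Lemma smooth_coord_fun F i : chain F -> smooth setT (coord_fun F i).
Proof.
move=> cF; apply/smooth_Cn => n.
have reg G x : chain G -> regular_at (coord_fun G i) x.
  move=> cG; split.
  - apply: (@continuous_comp _ _ _ (fun y : V => y 0 i) (G 0%N)); first exact: coord_continuous.
    exact: chain_continuous.
  - exact: (@cst_continuous _ _ 0).
  move=> j; rewrite (has_partialE (has_partial_coord_fun i j x cG)).
  exact: has_partial_coord_fun.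
elim: n F cF => [|n IH] F cF; first by split=> // x _; exact: reg.
split=> [x _|j]; first exact: reg.
rewrite partial_coord_fun//; case: ifP => _; last exact: Cn_cst.
by apply: IH => k; exact: cF.
Qed.

Lemma dbound_coord_fun K F i n (M : R) : chain F -> 0 <= M ->
  (forall k t, (k <= n)%N -> `|F k t| <= M) -> dbound K n (coord_fun F i) M.
Proof.
elim: n F => [|n IH] F cF M0 HF.
  by move=> s x; rewrite leqn0 size_eq0 => /eqP -> _ /=; rewrite expr0n/= addr0 sqrtr_sqr HF.
apply/dboundS; split=> [x _|j]; first by rewrite /coord_fun normc_real HF.
rewrite partial_coord_fun//; case: ifP => _; last by move=> s x _ _; rewrite dseq0 Normc.normc0.
by apply: IH => // [k|k t kn]; [exact: cF|exact: HF].
Qed.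

Definition tensor_fun (F : 'I_d -> nat -> R -> R) (r : seq 'I_d) : V -> R[i] :=
  foldr (fun i g x => coord_fun (F i) i x * g x) (fun=> 1) r.

Lemma smooth_tensor_fun (F : 'I_d -> nat -> R -> R) r : (forall i, chain (F i)) -> smooth setT (tensor_fun F r).
Proof.
move=> cF; elim: r => [|i r IH]; first exact: smooth_cst.
exact: (smoothM openT (smooth_coord_fun i (cF i)) IH).
Qed.

Lemma dbound_tensor_fun K (F : 'I_d -> nat -> R -> R) r n (M : R) : (forall i, chain (F i)) -> 1 <= M ->
  (forall i k t, (k <= n)%N -> `|F i k t| <= M) ->
  dbound K n (tensor_fun F r) ((2 ^+ n * M) ^+ size r).
Proof.
move=> cF M1 HF; have M0 : 0 <= M by exact: le_trans M1.
have N0 : 0 <= 2 ^+ n * M by rewrite mulr_ge0 ?exprn_ge0.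
elim: r => [|i r IH].
  rewrite expr0; case=> [|j s] x _ _; first by rewrite (_ : dseq [::] _ x = 1) ?Normc.normc1.
  by rewrite dseq_cst// Normc.normc0.
rewrite [size _]/= exprS -mulrA; apply: (dboundM openT) => //.
- exact: smooth_coord_fun.
- exact: smooth_tensor_fun.
- exact: exprn_ge0.
- by apply: dbound_coord_fun => // k t; exact: HF.
Qed.

Lemma tensor_funE (F : 'I_d -> nat -> R -> R) r x : tensor_fun F r x = \prod_(i <- r) (F i 0%N (x 0 i))%:C.
Proof. by elim: r => [|i r IH] /=; rewrite ?big_nil ?big_cons ?IH. Qed.

(** Product over the coordinates of one-dimensional plateaus. The bounds are those of
    a Gevrey class, far below those of the classes with sigma > 1. *)
Lemma exists_cutoff (x0 : V) (rho : R) : 0 < rho ->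
  exists (chi : V -> R[i]) (C D : R), [/\ 1 <= C, 1 <= D, smooth setT chi,
   (forall x, `|x - x0| <= rho -> chi x = 1) /\ (forall x, 2 * rho <= `|x - x0| -> chi x = 0) &
   forall n, dbound setT n chi ((C * D ^+ n * factorial_bound R n ^+ 4) ^+ d)].
Proof.
move=> r0; have [P [C [cP C1 P1 P0 HP]]] := smooth_plateau R.
pose F (i : 'I_d) := reparam rho^-1 (- (rho^-1 * x0 0 i)) P.
have cF i : chain (F i) by exact: chain_reparam.
have FE i x : F i 0%N (x 0 i) = P 0%N (rho^-1 * (x - x0) 0 i).
  by rewrite /F /reparam expr0 mul1r !mxE mulrBr addrC.
pose E := Num.max 1 rho^-1.
have E1 : 1 <= E by rewrite le_max lexx.
have E0 : 0 <= E by exact: le_trans E1.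
have C0 : 0 <= C by exact: le_trans C1.
exists (tensor_fun F (enum 'I_d)), C, (2 * (8 * E)); split=> //.
- by have := E1; lra.
- exact: smooth_tensor_fun.
- split=> x xr; rewrite tensor_funE.
    rewrite big1// => i _; rewrite FE P1// normrM gtr0_norm ?invr_gt0//.
    by rewrite ler_pdivrMl// mulr1; apply: le_trans xr; exact: coord_le_norm.
  have xn0 : x - x0 != 0.
    by rewrite -normr_gt0; apply: lt_le_trans xr; rewrite mulr_gt0.
  have [i xi] := norm_attained xn0.
  rewrite big_enum (bigD1 i)//= FE P0 ?mul0r//.
  by rewrite normrM gtr0_norm ?invr_gt0// -xi ler_pdivlMl// mulrC.
move=> n; have fb1 := factorial_bound_ge1 R n; have fb0 := factorial_bound_ge0 R n.
pose M := C * (8 * E) ^+ n * factorial_bound R n ^+ 4.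
have M1 : 1 <= M.
  rewrite -[leLHS]mulr1; apply: ler_pM => //; last exact: exprn_ege1.
  by rewrite -[leLHS]mulr1; apply: ler_pM => //; apply: exprn_ege1; lra.
have HM i k t : (k <= n)%N -> `|F i k t| <= M.
  move=> kn; rewrite /F /reparam normrM normrX gtr0_norm ?invr_gt0//.
  apply: le_trans (ler_wpM2l _ (HP _ _)) _; first by rewrite exprn_ge0// invr_ge0 ltW.
  rewrite mulrA [_ * (C * _)]mulrCA /M.
  have fk0 := factorial_bound_ge0 R k.
  have iv : 0 <= rho^-1 by rewrite invr_ge0 ltW.
  apply: ler_pM; rewrite ?mulr_ge0 ?exprn_ge0//; last first.
    by rewrite lerXn2r ?nnegrE//; exact: factorial_bound_le.
  apply: ler_wpM2l => //; rewrite -exprMn.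
  apply: le_trans (_ : (8 * E) ^+ k <= _); last by rewrite ler_weXn2l//; lra.
  rewrite lerXn2r ?nnegrE ?mulr_ge0// mulrC ler_wpM2l//.
  by rewrite le_max lexx orbT.
have := @dbound_tensor_fun setT F (enum 'I_d) n M cF M1 HM.
rewrite size_enum_ord (_ : 2 ^+ n * M = C * (2 * (8 * E)) ^+ n * factorial_bound R n ^+ 4)//.
by rewrite /M [(2 * (8 * E)) ^+ n]exprMn; ring.
Qed.

End Cutoffs.

(** * Growth of the weights *)

Section Growth.
Variable R : realType.
Implicit Types (x y z t c sigma tau : R) (k n N : nat).

Lemma natr_le_powR sigma n : 1 <= sigma -> n%:R <= n%:R `^ sigma.
Proof.
move=> s1; case: n => [|n].
  by rewrite powR0// gt_eqF// (lt_le_trans ltr01).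
by apply: le1r_powR => //; rewrite ler1n.
Qed.

Lemma ln_le_powR (s y : R) : 0 < s -> 0 < y -> ln y <= y `^ s / s.
Proof.
move=> s0 y0; rewrite ler_pdivlMr// mulrC -ln_powR.
by apply: ltW; apply: ln_sublinear; exact: powR_gt0.
Qed.

Lemma expX_le_expR (D sigma : R) : 1 <= D -> 1 <= sigma ->
  exists2 c, 0 <= c & forall n, D ^+ n <= expR (c * n%:R `^ sigma).
Proof.
move=> D1 s1; exists (ln D); first exact: ln_ge0.
have D0 : 0 < D by exact: lt_le_trans D1.
move=> n; rewrite -{1}(lnK (x := D)) ?posrE// -expRM_natr ler_expR.
by apply: ler_wpM2l; [exact: ln_ge0|exact: natr_le_powR].
Qed.

Lemma fact_le_expX n : (n`! <= n ^ n)%N.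
Proof.
rewrite fact_prod big_add1 /= big_mkord.
rewrite -[X in (_ <= _ ^ X)%N](card_ord n) -prod_nat_const.
by apply: leq_prod => i _.
Qed.

(** (2n)! is at most (2n)^(2n), and n ln n = O(n^sigma) for sigma > 1: Gevrey
    cutoffs belong to all the classes with sigma > 1. *)
Lemma factorial_bound_le_expR sigma : 1 < sigma ->
  exists2 c, 0 <= c & forall n, factorial_bound R n <= expR (c * n%:R `^ sigma).
Proof.
move=> s1; have [c2 c20 Hc2] := @expX_le_expR 2 sigma (ler1n R 2) (ltW s1).
pose s := sigma - 1; have s0 : 0 < s by rewrite subr_gt0.
pose c := 2 * (2 `^ s / s).
have c0 : 0 <= c by rewrite mulr_ge0// divr_ge0 ?powR_ge0// ltW.
exists (c2 + c) => [|n]; first exact: addr_ge0.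
rewrite mulrDl expRD; apply: ler_pM; [exact: exprn_ge0|exact: ler0n|exact: Hc2|].
case: n => [|n]; first by rewrite fact0 -expR0 ler_expR mulr_ge0// powR_ge0.
set m : R := n.+1%:R; have m0 : 0 < m by rewrite ltr0n.
have E : (n.+1.*2)%:R = 2 * m :> R by rewrite -muln2 natrM mulrC.
apply: le_trans (_ : (n.+1.*2)%:R ^+ (n.+1.*2) <= _).
  by rewrite -natrX ler_nat fact_le_expX.
have m20 : 0 < 2 * m by rewrite mulr_gt0.
rewrite -{1}(lnK (x := (n.+1.*2)%:R)) ?posrE ?E// -expRM_natr ler_expR.
rewrite E; apply: le_trans (_ : (2 * m) `^ s / s * (2 * m) <= _).
  by rewrite ler_wpM2r ?(ltW m20)// ln_le_powR.
rewrite powRM ?(ltW m0)// -(mulr_powRB1 (x := m) (p := sigma)) ?(ltW m0)//; last exact: lt_trans s1.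
rewrite -/s /c le_eqVlt; apply/orP; left; apply/eqP; ring.
Qed.

Lemma cutoff_growth sigma (C D : R) d : 1 < sigma -> 1 <= C -> 1 <= D ->
  exists2 c, 0 <= c & forall n,
    (C * D ^+ n * factorial_bound R n ^+ 4) ^+ d <= C ^+ d * expR (c * n%:R `^ sigma).
Proof.
move=> s1 C1 D1.
have [c1 c10 H1] := expX_le_expR D1 (ltW s1).
have [c2 c20 H2] := factorial_bound_le_expR s1.
exists ((c1 + c2 * 4%:R) * d%:R) => [|n]; first by rewrite mulr_ge0// addr_ge0// mulr_ge0.
have C0 : 0 <= C by exact: le_trans C1.
have D0 : 0 <= D by exact: le_trans D1.
have f0 := factorial_bound_ge0 R n.
rewrite -mulrA exprMn ler_wpM2l ?exprn_ge0//.
rewrite [_ * d%:R * _]mulrAC expRM_natr lerXn2r ?nnegrE ?expR_ge0//.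
  by rewrite mulr_ge0// exprn_ge0.
rewrite mulrDl expRD ler_pM ?exprn_ge0//.
by rewrite mulrAC expRM_natr lerXn2r ?nnegrE ?expR_ge0.
Qed.

(** One term of the series of e^N is N^N / N!. *)
Lemma stirling_lower N : expR (N%:R * ln N%:R - N%:R) <= N`!%:R :> R.
Proof.
case: N => [|n]; first by rewrite mul0r subr0 expR0 fact0.
set m : R := n.+1%:R; have m0 : 0 < m by rewrite ltr0n.
rewrite expRB (_ : expR (m * ln m) = m ^+ n.+1); last by rewrite mulrC expRM_natr lnK ?posrE.
rewrite ler_pdivrMr ?expR_gt0//.
have f0 : 0 < n.+1`!%:R :> R by rewrite ltr0n fact_gt0.
rewrite -ler_pdivrMl//; apply: le_trans (@expR_ge1Dxn R m n (ltW m0)).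
by rewrite mulrC lerDr.
Qed.

Lemma expR_sub1_le t : expR t - 1 <= t * expR t.
Proof.
have h := expR_ge1Dx (- t); have e0 := expR_ge0 t.
have := ler_wpM2r e0 h; rewrite [expR (- t) * _]mulrC expRxMexpNx_1 mulrDl mul1r mulNr; lra.
Qed.

(** Shifting the order n by a constant only costs a geometric factor in N:
    with x = N^(1/sigma), (x + k)^sigma - N = O(N / x) and ln N = O(x). *)
Lemma shifted_xlnx sigma k : 1 < sigma -> exists W K : R, [/\ 1 <= W, 0 <= K &
  forall N y, (0 < N)%N -> 0 <= y -> y <= (N%:R `^ sigma^-1 + k%:R) `^ sigma + 1 ->
    y <= W * N%:R /\ y * ln y <= N%:R * ln N%:R + K * N%:R].
Proof.
move=> s1; have s0 : 0 < sigma by exact: lt_trans s1.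
pose W : R := expR (sigma * k%:R) + 1.
pose C : R := sigma * k%:R * expR (sigma * k%:R).
have W1 : 1 <= W by rewrite lerDr expR_ge0.
have C0 : 0 <= C by rewrite !mulr_ge0 ?expR_ge0// ltW.
exists W, (W * ln W + C * sigma + 1); split=> //.
  by rewrite !addr_ge0// !mulr_ge0 ?ln_ge0 ?(le_trans ler01 W1)// ltW.
move=> N y N0; set M : R := N%:R; have M1 : 1 <= M by rewrite ler1n.
have M0 : 0 < M by exact: lt_le_trans M1.
set x := M `^ sigma^-1.
have x1 : 1 <= x.
  have -> : 1 = 1 `^ sigma^-1 :> R by rewrite powR1.
  by rewrite ge0_ler_powR ?invr_ge0 ?(ltW s0)// ?nnegrE// ltW.
have x0 : 0 < x by exact: lt_le_trans x1.
have xs : x `^ sigma = M by rewrite /x -powRrM mulVf ?gt_eqF// powRr1// ltW.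
set z := (x + k%:R) `^ sigma + 1 => y0 yz.
pose q := (1 + k%:R / x) `^ sigma.
have zE : z = M * q + 1.
  rewrite /z -{1}xs /q -powRM ?(ltW x0)//; last by rewrite addr_ge0// divr_ge0// ltW.
  by rewrite mulrDr mulr1 mulrCA divff ?gt_eqF// mulr1.
have kx0 : 0 <= k%:R / x by rewrite divr_ge0// ltW.
have qe : q <= expR (sigma * (k%:R / x)).
  rewrite mulrC expRM /q ge0_ler_powR ?(ltW s0)// ?nnegrE ?expR_ge0 ?addr_ge0//.
  exact: expR_ge1Dx.
have kxk : k%:R / x <= k%:R by rewrite ler_pdivrMr// ler_peMr.
have e1 : expR (sigma * (k%:R / x)) <= expR (sigma * k%:R).
  by rewrite ler_expR ler_wpM2l// ltW.
have q1 : q - 1 <= C / x.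
  apply: le_trans (_ : expR (sigma * (k%:R / x)) - 1 <= _); first by rewrite lerD2r.
  apply: le_trans (expR_sub1_le _) _.
  rewrite (_ : C / x = sigma * (k%:R / x) * expR (sigma * k%:R)); last by rewrite /C; ring.
  by rewrite ler_wpM2l// mulr_ge0// ltW.
have zW : z <= W * M.
  rewrite zE /W mulrDl mul1r mulrC lerD// ler_wpM2r ?(ltW M0)//.
  exact: le_trans qe e1.
have q0 : 0 <= q by exact: powR_ge0.
have z1 : 1 <= z by rewrite zE lerDr mulr_ge0// ltW.
have z0 : 0 < z by exact: lt_le_trans z1.
have W0 : 0 < W by exact: lt_le_trans W1.
have lnMx : ln M <= sigma * x.
  by rewrite -xs ln_powR ler_wpM2l ?(ltW s0)// ltW// ln_sublinear.
have lnMx0 : 0 <= ln M by exact: ln_ge0.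
split; first exact: le_trans zW.
apply: le_trans (_ : z * ln z <= _).
  have [y1|y1] := leP 1 y.
    have y0' : 0 < y by exact: lt_le_trans y1.
    by apply: ler_pM => //; [exact: ln_ge0|rewrite ler_ln ?posrE].
  apply: le_trans (_ : 0 <= _); last by rewrite mulr_ge0 ?ln_ge0// ltW.
  by rewrite mulr_ge0_le0// ln_le0// ltW.
have lnz : ln z <= ln W + ln M.
  have <- : ln (W * M) = ln W + ln M by rewrite lnM ?posrE.
  by rewrite ler_ln ?posrE ?mulr_gt0.
apply: le_trans (ler_wpM2l (ltW z0) lnz) _.
have A1 : z * ln W <= W * M * ln W by rewrite ler_wpM2r// ln_ge0.
have A2 : z * ln M <= M * ln M + (M * C * sigma + M).
  rewrite (_ : z = M + (M * (q - 1) + 1)); last by rewrite zE; ring.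
  rewrite mulrDl lerD2l mulrDl mul1r; apply: lerD; last by apply: ltW; exact: ln_sublinear.
  apply: le_trans (_ : M * (C / x) * (sigma * x) <= _); last first.
    rewrite le_eqVlt; apply/orP; left; apply/eqP; field; by rewrite gt_eqF.
  apply: le_trans (_ : M * (C / x) * ln M <= _).
    by apply: ler_wpM2r => //; apply: ler_wpM2l => //; exact: ltW.
  by apply: ler_wpM2l => //; rewrite mulr_ge0 ?divr_ge0// ltW.
rewrite mulrDr; apply: le_trans (lerD A1 A2) _.
rewrite le_eqVlt; apply/orP; left; apply/eqP; ring.
Qed.

(** With the weights written as exponentials of y ln y, the estimate reduces to the
    comparison of y ln y with N ln N, and of N ln N - N with ln N!. *)
Lemma shifted_growth sigma tau c k : 1 < sigma -> 0 < tau -> 0 <= c ->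
  exists A h : R, [/\ 1 <= A, 1 <= h & forall N y, 0 <= y ->
    y <= (N%:R `^ sigma^-1 + k%:R) `^ sigma + 1 ->
    expR (c * y + tau / sigma * (y * ln y)) <= A * (h ^+ N * N`!%:R `^ (tau / sigma))].
Proof.
move=> s1 t0 c0; have s0 : 0 < sigma by exact: lt_trans s1.
have [W [K [W1 K0 HWK]]] := shifted_xlnx k s1.
have W0 : 0 <= W by exact: le_trans W1.
pose r := tau / sigma; have r0 : 0 <= r by rewrite divr_ge0// ltW.
pose y0 : R := k%:R `^ sigma + 1.
have y01 : 1 <= y0 by rewrite lerDr powR_ge0.
have y00 : 0 < y0 by exact: lt_le_trans y01.
pose a := c * y0 + r * (y0 * ln y0).
pose b := c * W + r * (K + 1).
have l0 : 0 <= ln y0 by exact: ln_ge0.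
have a0 : 0 <= a by nonneg.
have b0 : 0 <= b by nonneg.
exists (expR a), (expR b); split; rewrite ?(le_trans _ (expR_ge1Dx _)) ?lerDl//.
move=> [|N] y yn hy.
  rewrite expr0 fact0 powR1 mul1r mulr1 ler_expR.
  have {}hy : y <= y0.
    by move: hy; rewrite powR0 ?add0r// invr_eq0 gt_eqF.
  rewrite -/r /a; apply: lerD; first exact: ler_wpM2l.
  apply: ler_wpM2l => //.
  have [y1|y1] := leP 1 y.
    apply: ler_pM => //; [exact: ln_ge0|rewrite ler_ln ?posrE//].
    exact: lt_le_trans y1.
  apply: le_trans (_ : 0 <= _); last by rewrite mulr_ge0 ?ln_ge0// ltW.
  by rewrite mulr_ge0_le0// ln_le0// ltW.
have [H1 H2] := HWK N.+1 y isT yn hy.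
set M : R := N.+1%:R in H1 H2.
have M0 : 0 < M by rewrite ltr0n.
apply: le_trans (_ : expR (b * M + r * (M * ln M - M)) <= _).
  rewrite ler_expR -/r.
  apply: le_trans (lerD (ler_wpM2l c0 H1) (ler_wpM2l r0 H2)) _.
  rewrite /b le_eqVlt; apply/orP; left; apply/eqP; ring.
rewrite expRD expRM_natr -[leLHS]mul1r; apply: ler_pM => //.
- by rewrite (le_trans _ (expR_ge1Dx _))// lerDl.
apply: ler_wpM2l; first by rewrite exprn_ge0 ?expR_ge0.
rewrite mulrC expRM.
by rewrite ge0_ler_powR// ?nnegrE ?expR_ge0//; exact: stirling_lower.
Qed.

End Growth.

(** * Cones *)

Section Cones.
Variables (R : realType) (d : nat).
Local Notation V := 'rV[R]_d.
Implicit Types (x xi eta : V).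

Lemma norm_le_enorm xi : `|xi| <= enorm xi.
Proof.
apply: norm_le_coord => [|i]; first exact: sqrtr_ge0.
rewrite -sqrtr_sqr /enorm ler_wsqrtr// /dotv (bigD1 i)//= expr2 lerDl.
by apply: sumr_ge0 => j _; rewrite -expr2 sqr_ge0.
Qed.

Lemma enorm_le_norm xi : enorm xi <= d%:R * `|xi|.
Proof.
rewrite -[leRHS]ger0_norm ?mulr_ge0// -sqrtr_sqr /enorm ler_wsqrtr// /dotv.
apply: le_trans (_ : \sum_(i < d) `|xi| ^+ 2 <= _).
  apply: ler_sum => i _; rewrite -expr2 -(real_normK (num_real (xi 0 i))).
  by rewrite lerXn2r ?nnegrE// coord_le_norm.
rewrite sumr_const card_ord -[leLHS]mulr_natl exprMn ler_wpM2r ?sqr_ge0//.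
by rewrite -natrX ler_nat; case: (d) => // e; rewrite expnS leq_pmulr ?expn_gt0.
Qed.

(** Gamma contains a ball around xi0; the new cone is generated by the ball of half
    its radius, on which a fixed fraction of the norm is less than the other half. *)
Lemma conic_shrink (Gamma : set V) xi0 : xi0 != 0 -> conic_nbhs xi0 Gamma ->
  exists (Gamma' : set V) (eps : R), [/\ conic_nbhs xi0 Gamma', 0 < eps, eps <= 1 / 2 &
    forall xi eta, Gamma' xi -> `|eta| <= eps * `|xi| -> Gamma (xi + eta)].
Proof.
move=> x0 [oG G0 coneG].
have /nbhs_ballP[r /= r0 Hr] : nbhs xi0 Gamma by exact: (open_nbhs_nbhs (conj oG G0)).
have n0 : 0 < `|xi0| by rewrite normr_gt0.
pose rho := r / 2; have rho0 : 0 < rho by rewrite divr_gt0.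
pose eps := Num.min (1 / 2) (rho / (`|xi0| + rho)).
have D0 : 0 < `|xi0| + rho by rewrite addr_gt0.
have eps0 : 0 < eps by rewrite lt_min divr_gt0//= divr_gt0.
exists [set xi | exists2 t : R, 0 < t & ball xi0 rho (t *: xi)], eps; split=> //.
- split.
  + rewrite (_ : [set xi | _] = \bigcup_(t in [set t : R | 0 < t])
      ((fun xi : V => t *: xi) @^-1` (ball xi0 rho))); last first.
      by apply/seteqP; split=> xi [t t0 tb]; exists t.
    apply: bigcup_open => t _; apply: open_comp; last exact: ball_open.
    by move=> xi _; exact: scaler_continuous.
  + by exists 1; rewrite ?scale1r//; exact: ballxx.
  + move=> t eta t0 [s s0 sb]; exists (s / t); first exact: divr_gt0.
    by rewrite scalerA divfK// gt_eqF.
- by rewrite ge_min lexx.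
move=> xi eta [t t0]; rewrite -ball_normE /= => tb etab.
have tn0 : t != 0 by rewrite gt_eqF.
rewrite -[xi + eta]scale1r -(mulVf tn0) -scalerA; apply: coneG; first by rewrite invr_gt0.
apply: Hr; rewrite -ball_normE /= scalerDr opprD addrA.
apply: le_lt_trans (ler_normB _ _) _; rewrite normrZ gtr0_norm//.
have h : t * `|xi| <= `|xi0| + rho.
  rewrite -{1}(gtr0_norm t0) -normrZ.
  have := ler_distD xi0 (t *: xi) 0; rewrite !subr0 distrC => H; apply: le_trans H _.
  by rewrite addrC lerD2l ltW.
have h2 : t * `|eta| <= rho.
  apply: le_trans (ler_wpM2l (ltW t0) etab) _; rewrite mulrCA.
  apply: le_trans (ler_wpM2l (ltW eps0) h) _.
  by rewrite -ler_pdivlMr// ge_min lexx orbT.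
by rewrite [r]splitr; apply: ltr_leD.
Qed.

End Cones.

(** * Shifting the index of the sequence *)

Section Reindexing.
Variable R : realType.
Variables (tau sigma : R).
Hypotheses (s1 : 1 < sigma) (t0 : 0 < tau).
Implicit Types (k n N : nat).

Let s0 : 0 < sigma. Proof. exact: lt_trans s1. Qed.

Definition decay_order N : nat := Num.truncn (N%:R `^ sigma^-1 : R).

(** The successor makes the index larger than (decay_order N + k)^sigma, hence
    its decay order at least decay_order N + k. *)
Definition shifted_index k N : nat := (Num.truncn ((decay_order N + k)%:R `^ sigma : R)).+1.

(** The constant h of the class is written e^c, so that weights are compared through
    their exponents. *)
Definition ets_weight (c : R) n : R := expR (c * n%:R `^ sigma) * n%:R `^ (tau * n%:R `^ sigma).

Lemma floor_order N : Num.floor (N%:R `^ sigma^-1 : R) = (decay_order N)%:Z.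
Proof.
have h : 0 <= (N%:R `^ sigma^-1 : R) by exact: powR_ge0.
by rewrite /decay_order truncn_floor h gez0_abs// floor_ge0.
Qed.

Lemma decay_order_le_root N : (decay_order N)%:R <= (N%:R `^ sigma^-1 : R).
Proof. by have /andP[] := truncn_itv (powR_ge0 (N%:R : R) sigma^-1). Qed.

Lemma decay_order_le N : (decay_order N <= N)%N.
Proof.
rewrite -(ler_nat R); apply: le_trans (decay_order_le_root N) _.
case: N => [|N]; first by rewrite powR0// invr_eq0 gt_eqF.
apply: ler1_powR; first by rewrite ler1n.
by rewrite invf_le1// ltW.
Qed.

Lemma decay_order_shifted_index k N : (decay_order N + k <= decay_order (shifted_index k N))%N.
Proof.
rewrite /decay_order truncn_ge_nat ?powR_ge0// -/(decay_order N).
set T := (decay_order N + k)%N.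
have -> : T%:R = (T%:R `^ sigma) `^ sigma^-1 :> R.
  by rewrite -powRrM mulfV ?gt_eqF// powRr1.
rewrite ge0_ler_powR ?invr_ge0 ?(ltW s0)// ?nnegrE ?powR_ge0//.
by have /andP[_ /ltW] := truncn_itv (powR_ge0 (T%:R : R) sigma).
Qed.

Lemma powR_order_le k N : (decay_order N + k)%:R `^ sigma <= (N%:R `^ sigma^-1 + k%:R) `^ sigma :> R.
Proof.
rewrite ge0_ler_powR ?(ltW s0)// ?nnegrE ?addr_ge0 ?powR_ge0//.
by rewrite natrD lerD2r decay_order_le_root.
Qed.

Lemma shifted_index_le k N : (shifted_index k N)%:R <= (N%:R `^ sigma^-1 + k%:R) `^ sigma + 1 :> R.
Proof.
rewrite /shifted_index -natr1 lerD2r; apply: le_trans (powR_order_le k N).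
by have /andP[] := truncn_itv (powR_ge0 ((decay_order N + k)%:R : R) sigma).
Qed.

(** At n = 0 both sides are 1, thanks to the conventions 0 `^ 0 = 1 and ln 0 = 0. *)
Lemma ets_weightE c n : ets_weight c n
  = expR (c * n%:R `^ sigma + tau / sigma * (n%:R `^ sigma * ln (n%:R `^ sigma))).
Proof.
rewrite /ets_weight expRD; congr (_ * _).
have p0 : 0 `^ sigma = 0 :> R by rewrite powR0// gt_eqF.
case: n => [|n].
  by rewrite p0 !mulr0 powRr0 mul0r mulr0 expR0.
by rewrite ln_powR /powR pnatr_eq0 /=; congr expR; field; rewrite gt_eqF.
Qed.

Lemma ets_weight_mono c m n : 0 <= c -> (m <= n)%N -> ets_weight c m <= ets_weight c n.
Proof.
move=> c0 mn.
have h : m%:R `^ sigma <= n%:R `^ sigma :> R.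
  by rewrite ge0_ler_powR ?(ltW s0)// ?nnegrE// ler_nat.
apply: ler_pM; rewrite ?expR_ge0 ?powR_ge0//.
  by rewrite ler_expR ler_wpM2l.
have p0 : 0 `^ sigma = 0 :> R by rewrite powR0// gt_eqF.
case: m mn h => [|m] mn h.
  rewrite p0 mulr0 powRr0.
  case: n {mn h} => [|n]; first by rewrite p0 mulr0 powRr0.
  have := @ler_powR R n.+1%:R (ler1n R n.+1) 0 (tau * n.+1%:R `^ sigma).
  by rewrite powRr0; apply; rewrite mulr_ge0 ?powR_ge0// ltW.
apply: le_trans (_ : m.+1%:R `^ (tau * n%:R `^ sigma) <= _).
  by rewrite ler_powR ?ler1n// ler_wpM2l// ltW.
rewrite ge0_ler_powR ?nnegrE ?ler_nat//.
by rewrite mulr_ge0 ?powR_ge0// ltW.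
Qed.

(** Both quantities are exponentials of c y + (tau/sigma) y ln y, with y equal to
    (n + k)^sigma in one case and to N' in the other. *)
Lemma reindexed_growth (c H : R) k : 0 <= c -> 0 <= H ->
  exists A h : R, [/\ 1 <= A, 1 <= h & forall N,
    ets_weight c (decay_order N + k) <= A * (h ^+ N * N`!%:R `^ (tau / sigma)) /\
    H ^+ (shifted_index k N) * (shifted_index k N)`!%:R `^ (tau / sigma)
      <= A * (h ^+ N * N`!%:R `^ (tau / sigma))].
Proof.
move=> c0 H0; pose H1 := Num.max 1 H.
have H11 : 1 <= H1 by rewrite le_max lexx.
have l0 : 0 <= ln H1 by exact: ln_ge0.
have [A [h [A1 h1 G]]] := shifted_growth k s1 t0 (addr_ge0 c0 l0).
have r0 : 0 <= tau / sigma by rewrite divr_ge0// ltW.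
exists A, h; split=> // N; split.
  have y0 : 0 <= (decay_order N + k)%:R `^ sigma :> R by exact: powR_ge0.
  apply: le_trans (G N _ y0 _); last first.
    by apply: le_trans (powR_order_le k N) _; rewrite lerDl.
  by rewrite ets_weightE ler_expR lerD2r mulrDl lerDl mulr_ge0.
apply: le_trans (G N _ (ler0n _ _) (shifted_index_le k N)).
set M := shifted_index k N; have M0 : 0 < M%:R :> R by rewrite ltr0n.
rewrite expRD; apply: ler_pM; rewrite ?exprn_ge0 ?powR_ge0//.
  rewrite mulrDl expRD -[leLHS]mul1r; apply: ler_pM => //.
  - exact: exprn_ge0.
  - by rewrite -expR0 ler_expR mulr_ge0.
  rewrite expRM_natr lnK ?posrE ?(lt_le_trans ltr01 H11)//.
  by rewrite lerXn2r ?nnegrE ?(le_trans ler01 H11)// le_max lexx orbT.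
rewrite [tau / sigma * _]mulrC expRM ge0_ler_powR ?nnegrE ?expR_ge0//.
rewrite mulrC expRM_natr lnK ?posrE//.
by rewrite -natrX ler_nat fact_le_expX.
Qed.

End Reindexing.

(** * Fourier transform of a product *)

Lemma iter_partial_dseq (R : realType) d n i (f : 'rV[R]_d -> R[i]) : iter n (partial i) f = dseq (nseq n i) f.
Proof. by elim: n => //= n ->. Qed.

Lemma total_order_le (n M e z : nat) : (z <= M)%N -> (n + M + e + z <= n + (M.*2 + e))%N.
Proof. by lia. Qed.

Lemma derivatives_le_gain (k0 m e : nat) : (m <= (k0 + m).*2 + e)%N.
Proof. by lia. Qed.

Section Bookkeeping.
Variable F : fieldType.

Lemma scale_quotient (z f x y : F) : y != 0 -> z * f / y * (x * y) = z * x * f.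
Proof. by move=> y0; field. Qed.

(** The powers of the frequency in the contribution of the waves of the approximation. *)
Lemma bookkeeping_low (p a A Ag f two : F) m n : a != 0 ->
  (two * two * p * a) ^+ m * (A * (Ag * f * (two / a) ^+ (n + m)))
    = (two * two * two * p) ^+ m * A * Ag * (two ^+ n * f / a ^+ n).
Proof.
move=> a0; rewrite exprD !exprMn exprVn.
have x0 : a ^+ m != 0 by rewrite expf_neq0.
have y0 : a ^+ n != 0 by rewrite expf_neq0.
by rewrite !exprVn; field; rewrite x0 y0.
Qed.

(** The powers of the frequency in the contribution of the remainder. *)
Lemma bookkeeping_high (p a C C1 C2 Ag f e two : F) M n : a != 0 -> e != 0 ->
  C * (two ^+ M * (C1 * (two ^+ (n + M) * (C2 * (Ag * f)) / (e * a) ^+ (n + M))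
     * (two * p * a) ^+ M))
    = C * (two * two * p * (two / e)) ^+ M * C1 * C2 * Ag * ((two / e) ^+ n * f / a ^+ n).
Proof.
move=> a0 e0; rewrite !exprD !exprMn !exprVn.
have x0 : a ^+ M != 0 by rewrite expf_neq0.
have y0 : a ^+ n != 0 by rewrite expf_neq0.
have z0 : e ^+ M != 0 by rewrite expf_neq0.
have w0 : e ^+ n != 0 by rewrite expf_neq0.
by field; rewrite x0 y0 z0 w0.
Qed.

Lemma remainder_split (c y b l : F) : (c + 1) * (y * b / l) = c * y * b / l + y * (b / l).
Proof. by rewrite mulrDl mul1r !mulrA. Qed.

End Bookkeeping.

Lemma fourier_product_estimate (R : realType) d (tau sigma : R) (U K : set 'rV[R]_d) (v : nat -> functional R d) (C : R) (k0 m : nat)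
   (Gamma Gamma' : set 'rV[R]_d) (A h eps : R) (b : 'rV[R]_d -> R[i])
   (A1 c1 L' : R) :
  1 < sigma -> 0 < tau ->
  open U -> K `<=` U -> 0 <= C -> (forall N, linear_on (smooth U) (v N)) ->
  equibounded U v K C k0 ->
  0 < A -> 0 < h ->
  (forall N xi, Gamma xi -> xi != 0 -> Normc.normc (fourier (v N) xi)
     <= A * (h ^+ N * N`!%:R `^ (tau / sigma) / enorm xi ^+ decay_order sigma N)) ->
  0 < eps -> eps <= 1 / 2 ->
  (forall xi eta, Gamma' xi -> `|eta| <= eps * `|xi| -> Gamma (xi + eta)) ->
  smooth setT b -> 0 < L' -> ball_supported L' b -> (forall x, K x -> `|x| <= L') ->
  0 <= A1 -> 0 <= c1 ->
  (forall s x, Normc.normc (dseq s b x) <= A1 * ets_weight tau sigma c1 (size s)) ->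
  exists A2 h2 : R, [/\ 0 <= A2, 1 <= h2 &
    forall s N xi, (size s <= m)%N -> Gamma' xi -> 2 <= `|xi| ->
    Normc.normc (v (shifted_index sigma ((k0 + m).*2 + d.*2) N)
                   (dseq s (fun x => b x * character xi x)))
      <= A2 * (h2 ^+ N * N`!%:R `^ (tau / sigma) / enorm xi ^+ decay_order sigma N)].
Proof.
move=> s1 t0 oU KU C0 lv ev A0 h0 Hv e0 e2 coneG sb L'0 bb KL A10 c10 Hb.
set k := ((k0 + m).*2 + d.*2)%N.
pose M := (k0 + m)%N.
have [Ag [hg [Ag1 hg1 HG]]] := reindexed_growth s1 t0 k c10 (ltW h0).
have Ag0 : 0 <= Ag by exact: le_trans Ag1.
have hg0 : 0 <= hg by exact: le_trans hg1.
have LL : L' < L' + 1 by rewrite ltrDl.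
have lam00 : 0 < 2 * eps by rewrite mulr_gt0.
have [S [Ct [S0 Ct0 HT]]] := trig_approx L'0 LL M lam00 sb bb.
pose Z := 2 / eps.
have Z4 : 4 <= Z by rewrite ler_pdivlMr//; move: e2; clear; lra.
have Z1 : 1 <= Z by move: Z4; clear; lra.
have Z0 : 0 <= Z by exact: le_trans Z1.
have pi0 := pi_gt0 R; have pi2 := pi_ge2 R; have pige := ltW pi0.
pose A2 := (S * (8 * pi) ^+ m * A + C * (4 * pi * Z) ^+ M * (Ct + 1) * (A1 + 1)) * Ag.
have A20 : 0 <= A2 by rewrite /A2; nonneg.
pose dd : R := (maxn 1 d)%:R.
have dd1 : 1 <= dd by rewrite ler1n leq_maxl.
have dd0 : 0 <= dd by exact: le_trans dd1.
exists A2, (Z * dd * hg); split=> //.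
  by rewrite -[leLHS]mulr1; apply: ler_pM => //; rewrite -[leLHS]mulr1; apply: ler_pM.
move=> s N xi sm Gxi xi2.
set n := decay_order sigma N; set N' := shifted_index sigma k N.
set F := hg ^+ N * N`!%:R `^ (tau / sigma).
have F0 : 0 < F by rewrite mulr_gt0 ?exprn_gt0 ?powR_gt0 ?ltr0n ?fact_gt0// (lt_le_trans ltr01).
have [HG1 HG2] := HG N; rewrite -/N' -/F in HG1 HG2.
set a := `|xi| in xi2 *.
have a0 : 0 < a by exact: lt_le_trans xi2.
have a1 : 1 <= a by apply: le_trans xi2; rewrite ler1n.
have age := ltW a0.
have en0 : 0 < enorm xi by exact: lt_le_trans a0 (norm_le_enorm xi).
have nN : (n <= N)%N by exact: decay_order_le.
(* All the bounds below are compared with this one. *)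
pose P := Z ^+ n * F / a ^+ n.
have P0 : 0 <= P by rewrite /P; have ? := ltW F0; nonneg.
have PE : P <= (Z * dd * hg) ^+ N * N`!%:R `^ (tau / sigma) / enorm xi ^+ n.
  have ead : enorm xi <= dd * a.
    apply: le_trans (enorm_le_norm xi) _; rewrite ler_wpM2r// ler_nat leq_maxr//.
  rewrite ler_pdivlMr ?exprn_gt0// /P.
  apply: le_trans (_ : Z ^+ n * F / a ^+ n * (dd * a) ^+ n <= _).
    by apply: ler_wpM2l => //; rewrite lerXn2r ?nnegrE ?mulr_ge0//; exact: ltW.
  rewrite [(dd * a) ^+ n]exprMn.
  rewrite scale_quotient ?expf_neq0 ?gt_eqF// -exprMn.
  rewrite /F mulrA ler_wpM2r ?powR_ge0// [(Z * dd * hg) ^+ N]exprMn ler_wpM2r ?exprn_ge0//.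
  apply: ler_weXn2l => //.
  by rewrite -[leLHS]mulr1; apply: ler_pM.
suff main : Normc.normc (v N' (dseq s (fun x => b x * character xi x)))
    <= S * (8 * pi) ^+ m * A * Ag * P + C * (4 * pi * Z) ^+ M * (Ct + 1) * (A1 + 1) * Ag * P.
  apply: le_trans main _; rewrite -mulrDl -mulrDl -/A2.
  by apply: ler_wpM2l.
pose q := (n + M)%N.
pose B := (A1 + 1) * (Ag * F).
have AF0 : 0 < Ag * F by rewrite mulr_gt0// (lt_le_trans ltr01).
have B0 : 0 < B by rewrite mulr_gt0// ltr_wpDl.
pose lam := eps * a.
have lam0 : 0 < lam by rewrite mulr_gt0.
have lamq : 0 < lam ^+ q by rewrite exprn_gt0.
have lamle : 2 * eps <= lam by rewrite /lam mulrC ler_wpM2l// ltW.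
have Bq0 : 0 < B / lam ^+ q by rewrite divr_gt0.
have HB s' i x : (size s' <= M)%N -> Normc.normc (iter (q + d.*2) (partial i) (dseq s' b) x) <= B.
  move=> s'M; rewrite iter_partial_dseq -foldr_cat.
  apply: le_trans (Hb _ _) _.
  apply: le_trans (_ : A1 * ets_weight tau sigma c1 (n + k) <= _).
    apply: ler_wpM2l => //; apply: ets_weight_mono => //.
    by rewrite size_cat size_nseq; exact: total_order_le.
  rewrite /B mulrDl mul1r; apply: ler_wpDr; first exact: ltW.
  exact: ler_wpM2l.
have [J [kap [c [kapl cS Hr]]]] := HT q B lam (B / lam ^+ q) lamle (ltW B0) Bq0 HB.
pose T x := \sum_p c p * wave (kap p) x.
pose rr x := b x - T x.
have sw p : smooth setT (wave (kap p)) by exact: (smooth_wave _ openT).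
have scw p : smooth setT (fun y => c p * wave (kap p) y).
  exact: (smoothZ _ openT (sw p)).
have sT : smooth setT T by exact: (smooth_sum _ openT scw).
have sNT : smooth setT (fun y => -1 * T y) by exact: (smoothZ _ openT sT).
have srr : smooth setT rr.
  apply: smooth_eq (smoothD openT sb sNT); first exact: openT.
  by move=> x _; rewrite mulN1r.
have sx : smooth setT (wave (- xi)) by exact: (smooth_wave _ openT).
have srx : smooth setT (fun x => rr x * wave (- xi) x) by exact: (smoothM openT srr sx).
have sp p : smooth setT (fun x => c p * wave (kap p - xi) x).
  by apply: (smoothZ _ openT); exact: (smooth_wave _ openT).
have ssum : smooth setT (fun x => \sum_p c p * wave (kap p - xi) x).
  exact: (smooth_sum _ openT sp).
have toU f : smooth setT f -> smooth U f by apply: smooth_sub.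
have split_b : dseq s (fun x => b x * character xi x) =
   fun x => dseq s (fun x => rr x * wave (- xi) x) x + \sum_p c p * dseq s (wave (kap p - xi)) x.
  apply/funext => x.
  transitivity (dseq s (fun x => rr x * wave (- xi) x + \sum_p c p * wave (kap p - xi) x) x).
    congr (dseq s _ x); apply/funext => y; rewrite characterE /rr mulrBl /T mulr_suml.
    rewrite -[LHS]addr0 -addrA; congr (_ + _); apply/esym/eqP.
    rewrite addrC subr_eq0; apply/eqP; apply: eq_bigr => p _.
    by rewrite waveD mulrA.
  rewrite (@dseqD R d setT _ _ s x openT srx ssum Logic.I).
  congr (_ + _); rewrite (@dseq_sum R d setT _ _ _ s x openT sp Logic.I).
  apply: eq_bigr => p _; apply: (@dseqZ R d setT (c p) _ s x openT _ Logic.I).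
  exact: (smooth_wave _ openT).
have sU1 : smooth U (dseq s (fun x => rr x * wave (- xi) x)) by apply: toU; exact: smooth_dseq.
have sU2 p : smooth U (fun x => c p * dseq s (wave (kap p - xi)) x).
  apply: toU; apply: (smoothZ _ openT); apply: smooth_dseq; exact: (smooth_wave _ openT).
have sU3 := smooth_sum (index_enum J) oU sU2.
rewrite split_b (linear_onD (lv N') sU1 sU3) (linear_on_sum _ oU (lv N') sU2) addrC.
apply: le_trans (normcD _ _) _; apply: lerD.
  apply: le_trans (normc_sum _ _ _) _.
  have term p : Normc.normc (v N' (fun x => c p * dseq s (wave (kap p - xi)) x))
      <= Normc.normc (c p) * ((8 * pi) ^+ m * A * Ag * P).
    have sUw : smooth U (wave (kap p - xi)) by exact: (smooth_wave _ oU).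
    have sUd : smooth U (dseq s (wave (kap p - xi))) by exact: smooth_dseq.
    rewrite (linear_onZ _ (lv N') sUd) Normc.normcM; apply: ler_wpM2l; first exact: normc_ge0.
    set eta := xi - kap p.
    have kE : kap p - xi = - eta by rewrite /eta opprB.
    have -> : dseq s (wave (kap p - xi)) = fun x => wave_factors (kap p - xi) s * wave (kap p - xi) x.
      by apply/funext => x; rewrite dseq_wave.
    rewrite (linear_onZ _ (lv N') sUw) Normc.normcM kE -characterE.
    have kle : `|kap p| <= a / 2.
      apply: le_trans (kapl p) _; rewrite /lam mulrC ler_wpM2l//.
      by move: e2; rewrite div1r.
    have eta_ge : a / 2 <= `|eta|.
      have := ler_distD (kap p) xi 0; rewrite !subr0 -/eta -/a; move: kle; clear; lra.
    have eta_le : `|eta| <= 2 * a.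
      by have := ler_normB xi (kap p); rewrite -/eta -/a; move: kle a0; clear; lra.
    have eta1 : 1 <= `|eta| by move: eta_ge xi2; clear; lra.
    have eta_n0 : eta != 0 by rewrite -normr_gt0; exact: lt_le_trans eta1.
    have Geta : Gamma eta by apply: coneG => //; rewrite normrN; exact: kapl.
    have eneta : a / 2 <= enorm eta by apply: le_trans (norm_le_enorm eta).
    have en1 : 1 <= enorm eta by apply: le_trans (norm_le_enorm eta).
    have a20 : 0 < a / 2 by exact: divr_gt0.
    have F1 : Normc.normc (wave_factors (- eta) s) <= (4 * pi * a) ^+ m.
      apply: le_trans (normc_wave_factors _ _) _; rewrite normrN.
      apply: le_trans (_ : (4 * pi * a) ^+ size s <= _).
        rewrite lerXn2r ?nnegrE; [|by nonneg|by nonneg|].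
          by [].
        rewrite (_ : 4 * pi * a = 2 * pi * (2 * a)); last by ring.
        by apply: ler_wpM2l => //; nonneg.
      apply: ler_weXn2l => //.
      rewrite -[leLHS]mulr1; apply: ler_pM => //.
      by move: pi2; clear; lra.
    have F2 : Normc.normc (v N' (character eta)) <= A * (Ag * F * (2 / a) ^+ (n + m)).
      apply: le_trans (Hv N' eta Geta eta_n0) _; apply: ler_wpM2l; first exact: ltW.
      apply: ler_pM; rewrite ?invr_ge0 ?exprn_ge0 ?mulr_ge0 ?exprn_ge0 ?powR_ge0 ?(ltW h0) ?(le_trans ler01 en1)//.
      rewrite -[2 / a]invrK invf_div exprVn lef_pV2 ?posrE ?exprn_gt0 ?(lt_le_trans ltr01 en1)//.
      apply: le_trans (_ : enorm eta ^+ (n + m) <= _).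
        by rewrite lerXn2r ?nnegrE ?(ltW a20) ?(le_trans ler01 en1).
      apply: ler_weXn2l => //; apply: leq_trans (decay_order_shifted_index s1 k N).
      by rewrite leq_add2l; exact: derivatives_le_gain.
    apply: le_trans (ler_pM (normc_ge0 _) (normc_ge0 _) F1 F2) _.
    have E4 : 4 = 2 * 2 :> R by rewrite -natrM.
    have E8 : 8 = 2 * 2 * 2 :> R by rewrite -!natrM.
    rewrite E4 bookkeeping_low ?gt_eqF// -E8.
    apply: ler_wpM2l; first by have ? := ltW A0; nonneg.
    rewrite /P ler_wpM2r ?invr_ge0 ?exprn_ge0// ler_wpM2r ?(ltW F0)//.
    by rewrite lerXn2r ?nnegrE//; move: Z4; clear; lra.
  apply: le_trans (ler_sum _ (fun p _ => term p)) _.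
  rewrite -mulr_suml (_ : S * (8 * pi) ^+ m * A * Ag * P = S * ((8 * pi) ^+ m * A * Ag * P)); last by ring.
  by apply: ler_wpM2r => //; have ? := ltW A0; nonneg.
pose Mr := Ct * 2 ^+ q * B / lam ^+ q + B / lam ^+ q.
have Mr0 : 0 <= Mr by have ? := ltW B0; have ? := ltW lamq; rewrite /Mr; nonneg.
have rb : dbound K M rr Mr by move=> s' x s'M Kx; apply: Hr => //; exact: KL.
have W1 : 1 <= 2 * pi * a.
  by rewrite -[leLHS]mulr1; apply: ler_pM => //; move: pi2; clear; lra.
have W0 : 0 <= 2 * pi * a by exact: le_trans W1.
have wb : dbound K M (wave (- xi)) ((2 * pi * a) ^+ M) by apply: dbound_wave; rewrite ?normrN.
have prod_b := @dboundM R d setT K M _ _ _ _ openT (@subsetT _ K) srr sx Mr0 (exprn_ge0 M W0) rb wb.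
have d_b : dbound K k0 (dseq s (fun x => rr x * wave (- xi) x)) (2 ^+ M * (Mr * (2 * pi * a) ^+ M)).
  apply: dbound_dseq; apply: dbound_leq prod_b; rewrite /M addnC leq_add2l//.
apply: le_trans (ev N' _ _ sU1 _ d_b) _; first by nonneg.
have MrE : Mr <= (Ct + 1) * (2 ^+ q * B / lam ^+ q).
  rewrite remainder_split /Mr lerD2l; apply: ler_peMl; first exact: ltW.
  by apply: exprn_ege1; rewrite ler1n.
apply: le_trans (_ : C * (2 ^+ M * ((Ct + 1) * (2 ^+ q * B / lam ^+ q) * (2 * pi * a) ^+ M)) <= _).
  apply: ler_wpM2l => //; apply: ler_wpM2l; first by nonneg.
  by apply: ler_wpM2r => //; nonneg.
have E4 : 4 = 2 * 2 :> R by rewrite -natrM.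
by rewrite /B /lam /q bookkeeping_high ?gt_eqF// E4.
Qed.

(** * Localized coefficients and the localized operator *)

Section CutCoefficients.
Variables (R : realType) (d : nat) (U : set 'rV[R]_d) (x0 : 'rV[R]_d) (r : R).
Variable chi : 'rV[R]_d -> R[i].
Hypotheses (oU : open U) (schi : smooth setT chi).
Hypothesis chi0 : forall x, r <= `|x - x0| -> chi x = 0.
Hypothesis rU : [set x | `|x - x0| <= r] `<=` U.
Local Notation V := 'rV[R]_d.
Implicit Types (x : V) (f g : V -> R[i]) (s : seq 'I_d).

Lemma open_dist_gt : open [set x : V | r < `|x - x0|].
Proof.
have -> : [set x : V | r < `|x - x0|] = (fun x : V => x - x0) @^-1` [set x : V | r < `|x|] by [].
apply: open_comp; last exact: open_norm_gt.
move=> x _; apply: continuousB; [exact: cvg_id|exact: (@cst_continuous _ _ x0)].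
Qed.

Lemma compact_dist_le : compact [set x : V | `|x - x0| <= r].
Proof.
apply: bounded_closed_compact.
  exists (r + `|x0|); split; first exact: num_real.
  move=> M rM x /= xr; apply: le_trans (ltW rM).
  rewrite -[x](subrK x0); apply: le_trans (ler_normD _ _) _.
  by rewrite lerD2r.
have -> : [set x : V | `|x - x0| <= r] = ~` [set x : V | r < `|x - x0|].
  by apply/seteqP; split => x /=; rewrite leNgt => /negP.
exact/open_closedC/open_dist_gt.
Qed.

Lemma cut_zero g x : r < `|x - x0| -> chi x * g x = 0.
Proof. by move=> rx; rewrite chi0 ?mul0r// ltW. Qed.

(** Outside the ball where the cutoff lives the product is 0, whatever the values of g
    off U are. *)
Lemma smooth_cut g : smooth U g -> smooth setT (fun x => chi x * g x).
Proof.
move=> sg; apply: smooth_local => x _.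
have [Ux|nUx] := pselect (U x).
  exists U; first by split.
  have schiU : smooth U chi by exact: smooth_sub schi.
  exact: (smoothM oU schiU sg).
exists [set x : V | r < `|x - x0|].
  split; first exact: open_dist_gt.
  by rewrite /= ltNge; apply/negP => xr; apply: nUx; exact: rU.
apply: (@smooth_eq R d _ (fun=> 0)); [exact: open_dist_gt| |exact: smooth_cst].
by move=> y /cut_zero ->.
Qed.

Lemma dseq_cut_zero g s x : smooth U g -> r < `|x - x0| ->
  dseq s (fun x => chi x * g x) x = 0.
Proof.
move=> sg rx; rewrite -[RHS](dseq0 s x).
have sc : smooth [set x : V | r < `|x - x0|] (fun x => chi x * g x).
  by apply: smooth_sub (smooth_cut sg).
exact: (@dseq_eq R d _ _ (fun=> 0) s x open_dist_gt (fun y => @cut_zero g y) sc rx).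
Qed.

(** On the ball, Leibniz formula with the bounds of the class for g and the Gevrey
    bounds for the cutoff; the factors 2^n and H^(n^sigma) only change the constant. *)
Lemma cut_bound (tau sigma C D : R) g : 1 < sigma -> 0 < tau -> 1 <= C -> 1 <= D ->
  (forall n, dbound setT n chi ((C * D ^+ n * factorial_bound R n ^+ 4) ^+ d)) ->
  ets_class tau sigma U g ->
  exists A1 c1 : R, [/\ 0 <= A1, 0 <= c1 & forall s x,
    Normc.normc (dseq s (fun x => chi x * g x) x) <= A1 * ets_weight tau sigma c1 (size s)].
Proof.
move=> s1 t0 C1 D1 Hchi [sg /(_ _ compact_dist_le rU)[h [A [h0 A0 Hg]]]].
have [c2 c20 H2] := cutoff_growth d s1 C1 D1.
have [c3 c30 H3] := @expX_le_expR R 2 sigma (ler1n R 2) (ltW s1).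
pose H := Num.max 1 h; have H1 : 1 <= H by rewrite le_max lexx.
have l0 : 0 <= ln H by exact: ln_ge0.
have C0 : 0 <= C ^+ d by rewrite exprn_ge0// (le_trans ler01 C1).
exists (C ^+ d * A), (c3 + c2 + ln H); split.
- by rewrite mulr_ge0// ltW.
- by rewrite !addr_ge0.
move=> s x; set n := size s.
have W0 c k : 0 <= ets_weight tau sigma c k by rewrite mulr_ge0 ?expR_ge0 ?powR_ge0.
have [xr|rx] := leP `|x - x0| r; last first.
  by rewrite dseq_cut_zero// Normc.normc0 mulr_ge0// mulr_ge0// ltW.
have g_b : dbound [set x | `|x - x0| <= r] n g (A * ets_weight tau sigma (ln H) n).
  move=> t y tn yr.
  rewrite (dseq_mpartial t oU sg (rU yr)); apply: le_trans (Hg _ _ yr) _.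
  rewrite mdeg_multi_of_seq -mulrA; apply: ler_wpM2l; first exact: ltW.
  apply: le_trans (_ : ets_weight tau sigma (ln H) (size t) <= _); last exact: ets_weight_mono.
  rewrite /ets_weight ler_wpM2r ?powR_ge0// /powR [h == 0]gt_eqF// ler_expR mulrC.
  rewrite ler_wpM2r ?powR_ge0// ler_ln ?posrE ?(lt_le_trans ltr01 H1)//.
  by rewrite le_max lexx orbT.
have chi_b : dbound [set x | `|x - x0| <= r] n chi (C ^+ d * expR (c2 * n%:R `^ sigma)).
  by apply: dbound_le (H2 n) _; apply: dbound_sub (Hchi n).
have sU : smooth U chi by exact: smooth_sub schi.
have e0 : 0 <= C ^+ d * expR (c2 * n%:R `^ sigma) by rewrite mulr_ge0 ?expR_ge0.
have f0 : 0 <= A * ets_weight tau sigma (ln H) n by rewrite mulr_ge0// ltW.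
have := dboundM oU rU sU sg e0 f0 chi_b g_b (leqnn n) xr.
move=> /le_trans; apply.
apply: le_trans (ler_wpM2r (mulr_ge0 e0 f0) (H3 n)) _.
rewrite /ets_weight !mulrDl !expRD le_eqVlt; apply/orP; left; apply/eqP; ring.
Qed.

End CutCoefficients.

Section CutOperator.
Variables (R : realType) (d : nat) (U : set 'rV[R]_d).
Local Notation V := 'rV[R]_d.
Variables (c : nat -> R[i]) (m : nat) (b : multi_index d -> V -> R[i]).
Hypothesis oU : open U.
Hypothesis sb : forall alpha f, (mdeg alpha <= m)%N -> smooth U f ->
  smooth setT (fun x => b alpha x * f x).
Implicit Types (x : V) (f g : V -> R[i]) (v : functional R d).

Lemma diffopE v f : diffop c m b v f = \sum_(B : {ffun 'I_d -> 'I_m.+1} | (mdeg (to_multi B) <= m)%N)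
  c (mdeg (to_multi B)) * ((-1) ^+ mdeg (to_multi B) *
    v (dseq (seq_of_multi (to_multi B)) (fun x => b (to_multi B) x * f x))).
Proof.
rewrite /diffop /sum_multi; apply: eq_bigr => B _.
by rewrite /dmul /dpartial mpartialE.
Qed.

Lemma diffop_linear v : linear_on (smooth U) v -> linear_on (smooth U) (diffop c m b v).
Proof.
move=> lv a f g sf sg; rewrite !diffopE mulr_sumr -big_split; apply: eq_bigr => B Bm.
set s := seq_of_multi _; set be := b _.
have sbf := sb Bm sf; have sbg := sb Bm sg.
have toU h : smooth setT h -> smooth U h by apply: smooth_sub.
have E : dseq s (fun x => be x * (a * f x + g x)) =
    fun x => a * dseq s (fun x => be x * f x) x + dseq s (fun x => be x * g x) x.
  apply/funext => x.
  rewrite -(@dseqZ R d setT a _ s x openT sbf Logic.I).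
  have saf : smooth setT (fun x => a * (be x * f x)) by exact: (smoothZ _ openT sbf).
  rewrite -(@dseqD R d setT _ _ s x openT saf sbg Logic.I).
  by congr (dseq s _ x); apply/funext => y; rewrite mulrDr mulrCA.
have s1 : smooth U (dseq s (fun x => be x * f x)) by exact: (toU _ (smooth_dseq s sbf)).
have s2 : smooth U (dseq s (fun x => be x * g x)) by exact: (toU _ (smooth_dseq s sbg)).
by rewrite E (lv a _ _ s1 s2) /=; ring.
Qed.

(** Multiplication by the coefficients and differentiation cost m derivatives. *)
Lemma diffop_equibounded (v : nat -> functional R d) (idx : nat -> nat) K C k0 :
  compact K -> K `<=` U -> 0 <= C -> equibounded U v K C k0 ->
  exists2 Cw : R, 0 <= Cw & equibounded U (fun N => diffop c m b (v (idx N))) K Cw (k0 + m).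
Proof.
move=> cK KU C0 ev.
have sbU alpha : (mdeg alpha <= m)%N -> smooth U (b alpha).
  move=> am; have := sb am (@smooth_cst R d U 1).
  move=> /(smooth_sub (@subsetT _ U)); apply: smooth_eq => // x _.
  by rewrite mulr1.
have /choice[M HM] : forall B : {ffun 'I_d -> 'I_m.+1}, exists M : R,
    (mdeg (to_multi B) <= m)%N -> 0 <= M /\ dbound K (k0 + m) (b (to_multi B)) M.
  move=> B; have [Bm|] := boolP (mdeg (to_multi B) <= m)%N; last by exists 0.
  by have [M M0 HM] := smooth_dbound (k0 + m) cK KU (sbU _ Bm); exists M.
exists (\sum_(B : {ffun 'I_d -> 'I_m.+1} | (mdeg (to_multi B) <= m)%N)
   Normc.normc (c (mdeg (to_multi B))) * (C * (2 ^+ (k0 + m) * M B))).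
  apply: sumr_ge0 => B Bm; rewrite mulr_ge0 ?normc_ge0// mulr_ge0// mulr_ge0 ?exprn_ge0//.
  exact: (HM B Bm).1.
move=> N f Mf sf Mf0 fb; rewrite diffopE mulr_suml.
apply: le_trans (normc_sum _ _ _) _; apply: ler_sum => B Bm.
have [MB0 MB] := HM B Bm.
rewrite !Normc.normcM normcX normcN Normc.normc1 expr1n mul1r -mulrA.
apply: ler_wpM2l; first exact: normc_ge0.
have P := dboundM oU KU (sbU _ Bm) sf MB0 Mf0 MB fb.
have Q : dbound K k0 (dseq (seq_of_multi (to_multi B)) (fun x => b (to_multi B) x * f x))
    (2 ^+ (k0 + m) * (M B * Mf)).
  apply: dbound_dseq; apply: dbound_leq P.
  by rewrite size_seq_of_multi addnC leq_add2l.
have sF : smooth U (dseq (seq_of_multi (to_multi B)) (fun x => b (to_multi B) x * f x)).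
  by apply: smooth_sub (smooth_dseq _ (sb Bm sf)).
rewrite -!mulrA; apply: ev => //.
by rewrite mulr_ge0 ?exprn_ge0// mulr_ge0.
Qed.

(** One geometric rate for the finitely many coefficients. *)
Lemma diffop_estimate v (X : R) (xi : V) (E H : {ffun 'I_d -> 'I_m.+1} -> R) (N : nat) :
  0 <= X ->
  (forall B : {ffun 'I_d -> 'I_m.+1}, (mdeg (to_multi B) <= m)%N -> [/\ 0 <= E B, 1 <= H B &
    Normc.normc (v (dseq (seq_of_multi (to_multi B)) (fun x => b (to_multi B) x * character xi x)))
      <= E B * (H B ^+ N * X)]) ->
  Normc.normc (diffop c m b v (character xi)) <=
   (\sum_(B : {ffun 'I_d -> 'I_m.+1} | (mdeg (to_multi B) <= m)%N)
      Normc.normc (c (mdeg (to_multi B))) * E B) *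
   ((1 + \sum_(B : {ffun 'I_d -> 'I_m.+1} | (mdeg (to_multi B) <= m)%N) H B) ^+ N * X).
Proof.
move=> X0 HE; rewrite diffopE mulr_suml.
apply: le_trans (normc_sum _ _ _) _; apply: ler_sum => B Bm.
have [E0 H1 HB] := HE B Bm.
rewrite !Normc.normcM normcX normcN Normc.normc1 expr1n mul1r -mulrA.
apply: ler_wpM2l; first exact: normc_ge0.
apply: le_trans HB _; apply: ler_wpM2l => //; apply: ler_wpM2r => //.
have H0 : 0 <= H B by exact: le_trans H1.
have rest : 0 <= \sum_(B' : {ffun 'I_d -> 'I_m.+1} | (mdeg (to_multi B') <= m)%N && (B' != B)) H B'.
  apply: sumr_ge0 => B' /andP[B'm _]; have [_ H1' _] := HE B' B'm.
  exact: le_trans H1'.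
have le : H B <= 1 + \sum_(B0 : {ffun 'I_d -> 'I_m.+1} | (mdeg (to_multi B0) <= m)%N) H B0.
  by rewrite (bigD1 B)//= addrCA lerDl addr_ge0.
by rewrite lerXn2r ?nnegrE// (le_trans H0 le).
Qed.

End CutOperator.

(** * Wave front sets *)

(** For bounded xi nothing decays, but h^N absorbs the bounded factor |xi|^n, as n is at
    most N. *)
Lemma small_frequency_target (R : realType) (D H e X : R) (n N : nat) :
  (n <= N)%N -> 0 < e -> e <= D -> 1 <= D -> D <= H -> 1 <= X ->
  1 <= H ^+ N * X / e ^+ n.
Proof.
move=> nN e0 eD D1 DH X1; rewrite ler_pdivlMr ?exprn_gt0// mul1r.
apply: le_trans (_ : D ^+ n <= _).
  by rewrite lerXn2r ?nnegrE ?(ltW e0) ?(le_trans ler01 D1).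
apply: le_trans (_ : D ^+ N <= _); first exact: ler_weXn2l.
apply: le_trans (_ : H ^+ N <= _).
  by rewrite lerXn2r ?nnegrE ?(le_trans ler01 D1)// (le_trans (le_trans ler01 D1)).
by rewrite ler_peMr// exprn_ge0// (le_trans (le_trans ler01 D1)).
Qed.

(** The decay estimate is used for |xi| >= 2; the remaining frequencies only need
    equicontinuity. *)
Lemma regular_diffop (R : realType) (d : nat) (U : set 'rV[R]_d) (tau sigma : R)
    (c : nat -> R[i]) (m : nat) (a : multi_index d -> 'rV[R]_d -> R[i])
    (u : functional R d) x0 xi0 :
  open U -> 0 < tau -> 1 < sigma -> xi0 != 0 ->
  (forall alpha, (mdeg alpha <= m)%N -> ets_class tau sigma U (a alpha)) ->
  ets_regular tau sigma U u x0 xi0 -> ets_regular tau sigma U (diffop c m a u) x0 xi0.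
Proof.
move=> oU t0 s1 xi0n Ha [Om [Ga [v [A [h [[oOm Ox0 OmU] Gcone [bv veq] [A0 h0] Hv]]]]]].
have [K [C [k0 [cK KU C0 ev]]]] := bounded_seq_equibounded oU bv.
have lv N : linear_on (smooth U) (v N) by have [H _] := bv; exact: (H N).1.
have [Ga' [eps [Gcone' eps0 eps2 Gshift]]] := conic_shrink xi0n Gcone.
have Hv' N xi : Ga xi -> xi != 0 -> Normc.normc (fourier (v N) xi)
    <= A * (h ^+ N * N`!%:R `^ (tau / sigma) / enorm xi ^+ decay_order sigma N).
  by move=> Gx xn; have := Hv N xi Gx xn; rewrite floor_order.
have /nbhs_ballP[r0 /= r00 Hr0] : nbhs x0 Om by exact: (open_nbhs_nbhs (conj oOm Ox0)).
pose rho := r0 / 4; have rho0 : 0 < rho by rewrite divr_gt0.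
pose r := 2 * rho; have rr : r < r0.
  by rewrite /r /rho; move: r00; clear; lra.
have rOm : [set x : 'rV[R]_d | `|x - x0| <= r] `<=` Om.
  move=> x /= xr; apply: Hr0; rewrite -ball_normE /= distrC; exact: le_lt_trans xr rr.
have rU := subset_trans rOm OmU.
have [chi [Cc [Dc [Cc1 Dc1 schi [chi1 chi0] chib]]]] := exists_cutoff x0 rho0.
pose b (alpha : multi_index d) x := chi x * a alpha x.
have sa alpha : (mdeg alpha <= m)%N -> smooth U (a alpha) by move=> am; have [] := Ha alpha am.
have sb alpha f : (mdeg alpha <= m)%N -> smooth U f -> smooth setT (fun x => b alpha x * f x).
  move=> am sf; have saf := smoothM oU (sa _ am) sf.
  apply: smooth_eq (smooth_cut oU schi chi0 rU saf); first exact: openT.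
  by move=> x _; rewrite mulrA.
have sb1 alpha : (mdeg alpha <= m)%N -> smooth setT (b alpha).
  by move=> am; exact: (smooth_cut oU schi chi0 rU (sa _ am)).
have [MK [MKr HMK]] := compact_bounded cK.
pose L' := Num.max 1 (Num.max (MK + 1) (r + `|x0|)).
have L'0 : 0 < L' by rewrite lt_max ltr01.
have KL x : K x -> `|x| <= L'.
  by move=> Kx; rewrite 2!le_max (HMK (MK + 1))// ?ltrDl// orbT.
have bb alpha : ball_supported L' (b alpha).
  move=> x Lx; apply: (cut_zero chi0); rewrite ltNge; apply/negP => xr.
  move: Lx; apply/negP; rewrite -leNgt 2!le_max; apply/orP; right; apply/orP; right.
  rewrite -[x](subrK x0); apply: le_trans (ler_normD _ _) _.
  by rewrite lerD2r.
pose k := ((k0 + m).*2 + d.*2)%N.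
pose idx := shifted_index sigma k.
pose w N := diffop c m b (v (idx N)).
have core (B : {ffun 'I_d -> 'I_m.+1}) : exists EH : R * R, (mdeg (to_multi B) <= m)%N ->
   [/\ 0 <= EH.1, 1 <= EH.2 & forall N xi, Ga' xi -> 2 <= `|xi| ->
    Normc.normc (v (idx N) (dseq (seq_of_multi (to_multi B)) (fun x => b (to_multi B) x * character xi x)))
      <= EH.1 * (EH.2 ^+ N * (N`!%:R `^ (tau / sigma) / enorm xi ^+ decay_order sigma N))].
  have [Bm|] := boolP (mdeg (to_multi B) <= m)%N; last by exists (0, 0).
  have [A1 [c1 [A10 c10 Hb]]] := cut_bound oU schi chi0 rU s1 t0 Cc1 Dc1 chib (Ha _ Bm).
  have [A2 [h2 [A20 h21 HA]]] := @fourier_product_estimate R d tau sigma U K v C k0 m Ga Ga' A h eps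
    (b (to_multi B)) A1 c1 L' s1 t0 oU KU C0 lv ev A0 h0 Hv' eps0 eps2 Gshift (sb1 _ Bm) L'0
    (bb _) KL A10 c10 Hb.
  exists (A2, h2) => _; split=> // N xi Gx x2; rewrite [_ ^+ N * _]mulrA; apply: HA => //.
  by rewrite size_seq_of_multi.
have /choice[EH HEH] := core.
have [Cw Cw0 ew] := diffop_equibounded c oU sb idx cK KU C0 ev.
pose E := \sum_(B : {ffun 'I_d -> 'I_m.+1} | (mdeg (to_multi B) <= m)%N)
   Normc.normc (c (mdeg (to_multi B))) * (EH B).1.
have E0 : 0 <= E.
  by apply: sumr_ge0 => B Bm; have [e1 _ _] := HEH B Bm; rewrite mulr_ge0 ?normc_ge0.
pose H := 1 + \sum_(B : {ffun 'I_d -> 'I_m.+1} | (mdeg (to_multi B) <= m)%N) (EH B).2.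
have H1 : 1 <= H.
  rewrite lerDl; apply: sumr_ge0 => B Bm; have [_ e1 _] := HEH B Bm.
  exact: le_trans e1.
pose D : R := (maxn 1 d)%:R * 2.
have D1 : 1 <= D.
  by rewrite /D -[leLHS]mulr1; apply: ler_pM; rewrite ?ler1n ?leq_maxl.
have D0 : 0 <= D by exact: le_trans D1.
pose Wb : R := Num.max 1 (2 * pi * 2).
have Wb1 : 1 <= Wb by rewrite le_max lexx.
pose Aw := Cw * Wb ^+ (k0 + m).
have Aw0 : 0 <= Aw by rewrite mulr_ge0// exprn_ge0// (le_trans ler01 Wb1).
have bw : bounded_seq U w.
  apply: (equibounded_bounded_seq oU cK KU Cw0 _ ew) => N.
  rewrite /w; apply: diffop_linear; [exact: sb|exact: lv].
exists [set x | `|x - x0| < rho], Ga', w, (E + Aw + 1), (H + D); split.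
- split.
  + have -> : [set x : 'rV[R]_d | `|x - x0| < rho] = ball x0 rho.
      by apply/seteqP; split=> x /=; rewrite -ball_normE /= distrC.
    exact: ball_open.
  + by rewrite /= subrr normr0.
  + move=> x /= xr; apply: rU => /=; apply: le_trans (ltW xr) _.
    by rewrite /r ler_peMl ?ler1n// ltW.
- exact: Gcone'.
- split=> // N f [sf [Kf [cKf KfO Kf0]]].
  rewrite /w !diffopE; apply: eq_bigr => B Bm; congr (_ * (_ * _)).
  have bE : (fun x => b (to_multi B) x * f x) = (fun x => a (to_multi B) x * f x).
    apply/funext => x; have [Kfx|nKfx] := pselect (Kf x); last by rewrite Kf0// !mulr0.
    by rewrite /b chi1 ?mul1r// ltW//; exact: KfO.
  have sfU : smooth U f by exact: smooth_sub sf.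
  have sbf := sb _ f Bm sfU.
  rewrite bE in sbf *.
  apply: veq; split; first exact: smooth_dseq.
  exists Kf; split=> //.
    move=> x /KfO /= xr; apply: rOm => /=; apply: le_trans (ltW xr) _.
    by rewrite /r ler_peMl ?ler1n// ltW.
  move=> x nKfx; rewrite -[RHS](dseq0 (seq_of_multi (to_multi B)) x).
  have oC : open (~` Kf).
    by apply: closed_openC; apply: compact_closed => //; exact: norm_hausdorff.
  have sC : smooth (~` Kf) (fun x => a (to_multi B) x * f x) by exact: smooth_sub sbf.
  apply: (@dseq_eq R d _ _ (fun=> 0) _ x oC _ sC nKfx) => y nKy.
  by rewrite Kf0// mulr0.
- by split; [rewrite ltr_wpDl// addr_ge0|rewrite ltr_wpDr// (lt_le_trans ltr01 H1)].
move=> N xi Gx xn; rewrite floor_order /fourier.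
set n := decay_order sigma N; set X := N`!%:R `^ (tau / sigma).
have xi_gt0 : 0 < `|xi| by rewrite normr_gt0.
have en0 : 0 < enorm xi by exact: lt_le_trans xi_gt0 (norm_le_enorm xi).
have r_ge0 : 0 <= tau / sigma by rewrite divr_ge0// ltW// (lt_trans ltr01 s1).
have X1 : 1 <= X.
  have -> : 1 = 1 `^ (tau / sigma) :> R by rewrite powR1.
  by rewrite ge0_ler_powR ?nnegrE// ler1n fact_gt0.
have X0 : 0 <= X by exact: le_trans X1.
have HD0 : 0 <= H + D by rewrite addr_ge0// (le_trans ler01 H1).
have tgt0 : 0 <= (H + D) ^+ N * X / enorm xi ^+ n.
  by rewrite divr_ge0 ?exprn_ge0 ?mulr_ge0 ?exprn_ge0// ltW.
have [x2|x2] := leP 2 `|xi|.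
  have Xn0 : 0 <= X / enorm xi ^+ n by rewrite divr_ge0// exprn_ge0// ltW.
  have est := @diffop_estimate R d c m b (v (idx N)) (X / enorm xi ^+ n) xi
    (fun B => (EH B).1) (fun B => (EH B).2) N Xn0.
  apply: le_trans (est _) _.
    by move=> B Bm; have [e1 e2 e3] := HEH B Bm; split=> //; exact: e3.
  rewrite -/E -/H; apply: le_trans (_ : E * ((H + D) ^+ N * X / enorm xi ^+ n) <= _).
    apply: ler_wpM2l => //; rewrite -mulrA; apply: ler_wpM2r => //.
    by rewrite lerXn2r ?nnegrE ?(le_trans ler01 H1)// lerDl.
  by apply: ler_wpM2r => //; rewrite -addrA lerDl addr_ge0.
have sch : smooth U (character xi) by rewrite characterE; exact: smooth_wave.
have chb : dbound K (k0 + m) (character xi) (Wb ^+ (k0 + m)).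
  rewrite characterE; apply: dbound_wave => //; rewrite normrN le_max; apply/orP; right.
  by apply: ler_wpM2l; [rewrite mulr_ge0 ?pi_ge0|exact: ltW].
have Wn0 : 0 <= Wb ^+ (k0 + m) by rewrite exprn_ge0// (le_trans ler01 Wb1).
apply: le_trans (ew N _ _ sch Wn0 chb) _; rewrite -/Aw.
apply: le_trans (_ : Aw * ((H + D) ^+ N * X / enorm xi ^+ n) <= _).
  rewrite -[leLHS]mulr1; apply: ler_wpM2l => //.
  apply: (small_frequency_target (D := D)) => //.
  - exact: decay_order_le.
  - apply: le_trans (enorm_le_norm xi) _; rewrite /D; apply: ler_pM => //; last exact: ltW.
    by rewrite ler_nat leq_maxr.
  - by rewrite lerDr (le_trans ler01 H1).
by apply: ler_wpM2r => //; rewrite addrAC lerDr addr_ge0.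
Qed.

Theorem theorem4p1 (R : realType) (d : nat) (U : set 'rV[R]_d) (tau sigma : R)
    (c : nat -> R[i]) (m : nat) (a : multi_index d -> 'rV[R]_d -> R[i])
    (u : functional R d) :
  open U -> 0 < tau -> 1 < sigma ->
  (forall k, c k != 0) ->
  (forall alpha, (mdeg alpha <= m)%N -> ets_class tau sigma U (a alpha)) ->
  is_distribution U u ->
  WF tau sigma U (diffop c m a u) `<=` WF tau sigma U u.
Proof.
move=> oU t0 s1 _ Ha _ p [Up pn nreg]; split=> // reg; apply: nreg.
exact: regular_diffop.
Qed.
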